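(* Let $\beta\in(0,\frac{\pi}{2})$, let $a\in C^2(\mathbb{R})$ with $a(\cdot)>0$, and let $k_1,k_2\in C^2([0,\infty)\times[0,\infty),\mathbb{R})$. Let $b>1$ and assume that $$k_i(t,u)=k_i(b^2t,bu)\quad\text{for all }t,u\geqslant 0\quad(i=1,2),$$ that there exists $\sigma\in(0,\tan\beta)$ such that $$|k_i(t,u)|\leqslant \tan\beta-\sigma\quad\text{for all }t,u\geqslant 0\quad(i=1,2),$$ and that $$\min k_1+\min k_2>0 .$$ Then the free boundary problem (P) $$\left\{\begin{array}{l} u_t=a(u_x)u_{xx},\quad -\xi_1(t)<x<\xi_2(t),\ t>0,\\ u_x(x,t)=-k_1(t,u(x,t)),\ \ u(x,t)=-x\tan\beta\quad\text{for }x=-\xi_1(t),\ t>0,\\ u_x(x,t)=k_2(t,u(x,t)),\ \ u(x,t)=x\tan\beta\quad\text{for }x=\xi_2(t),\ t>0,\end{array}\right.$$ has a discrete expanding self-similar solution $(U,\Xi_1,\Xi_2)$ (with factor $b$). If in addition $k_i(t,u)\equiv k_i(u)$ ($i=1,2$) does not depend on $t$, then: (i) the discrete expanding self-similar solution is unique, and $U_t>0$, $\Xi_{1t}>0$, $\Xi_{2t}>0$ for all $t>0$; (ii) $U$ is asymptotically stable in the following sense: for any time-global solution $u$ of (P) with initial data $u_0\in C^{2+\mu}_{\rm ad}$, $\mu\in(0,1)$, there is a constant $C$ such that $$d_{\mathcal H}(\Gamma(t),\gamma(t))\leqslant C\,t^{-1/2}\quad\text{as }t\to\infty \text{ (i.e.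 for all sufficiently large } t),$$ where $\Gamma(t)$ is the graph of $U(\cdot,t)$, $\gamma(t)$ is the graph of $u(\cdot,t)$, and $d_{\mathcal H}$ denotes the Hausdorff distance.
   Context: In problem (P) the unknowns are positive functions $u(x,t)$ (defined for $-\xi_1(t)\leqslant x\leqslant\xi_2(t)$), $\xi_1(t)$ and $\xi_2(t)$; solutions are understood in the classical sense. The minima are over $[0,\infty)\times[0,\infty)$. A solution $(U,\Xi_1,\Xi_2)$ of (P) defined for $t\in(0,\infty)$ is called a (discrete) expanding self-similar solution with factor $b>1$ if $bU(x,t)=U(bx,b^2t)$ for all $-\Xi_1(t)\leqslant x\leqslant\Xi_2(t)$, $t>0$, and $b\,\Xi_i(t)=\Xi_i(b^2t)$ for all $t>0$, $i=1,2$. The set $C^{2+\mu}_{\rm ad}$ of admissible initial data consists of the functions $u_0\in C^{2+\mu}([-\xi_{01},\xi_{02}])$, for some $\xi_{01},\xi_{02}>0$, with $u_0>0$, $u_0(-\xi_{01})=\xi_{01}\tan\beta$, $u_0(\xi_{02})=\xi_{02}\tan\beta$, $(u_0)_x(-\xi_{01})=-k_1(0,u_0(-\xi_{01}))$, $(u_0)_x(\xi_{02})=k_2(0,u_0(\xi_{02}))$, and $|(u_0)_x(x)|\leqslant\tan\beta-\sigma$ on $[-\xi_{01},\xi_{02}]$. A solution with initial data $u_0$ satisfies $\xi_i(0)=\xi_{0i}$ and $u(x,0)=u_0(x)$ for $-\xi_{01}\leqslant x\leqslant \xi_{02}$, and solutions with initial data are taken in the class $C^{2+\mu,1+\mu/2}(\overline{Q}_{t_0})$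 for each $t_0>0$, where $Q_{t_0}=\{(x,t):-\xi_1(t)<x<\xi_2(t),\ 0<t\leqslant t_0\}$. Time-global means defined for all $t\geqslant0$. *)

(* Defs.v *)
From HB Require Import structures.
From mathcomp Require Import all_boot all_order all_algebra.
From mathcomp Require Import all_classical all_reals all_analysis.

Set Implicit Arguments.
Unset Strict Implicit.
Unset Printing Implicit Defensive.

Import Order.TTheory GRing.Theory Num.Theory.
Import numFieldNormedType.Exports.

Local Open Scope ring_scope.
Local Open Scope classical_set_scope.

Section Defs.
Context {R : realType}.
Implicit Types (f df u : R * R -> R) (A : set (R * R)) (xi : R -> R).
Implicit Types (x y t s : R).

(** Derivatives up to the boundary.  As usual for [C^k] of a set [A] with
    boundary, a partial derivative is taken at the interior points of [A] and
    has to extend continuously to [A]; the extension is what a boundary value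
    such as [u_x(-xi_1(t), t)] refers to.  When [A] is contained in the closure
    of its interior, as for all the sets used below, [df] is determined on [A]
    by [f]. *)
Definition is_partial1 A f df : Prop :=
  {within A, continuous df} /\
  forall p, A° p -> is_derive p.1 1 (fun y : R => f (y, p.2)) (df p).

Definition is_partial2 A f df : Prop :=
  {within A, continuous df} /\
  forall p, A° p -> is_derive p.2 1 (fun s : R => f (p.1, s)) (df p).

Definition C1_on A f : Prop :=
  {within A, continuous f} /\
  exists f1 f2, is_partial1 A f f1 /\ is_partial2 A f f2.

Definition C2_on A f : Prop :=
  {within A, continuous f} /\
  exists f1 f2,
    [/\ is_partial1 A f f1, is_partial2 A f f2, C1_on A f1 & C1_on A f2].

Definition C2_real (a : R -> R) : Prop :=
  [/\ forall x, derivable a x 1,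
      forall x, derivable a^`() x 1 &
      continuous a^`(2)].

Definition quadrant : set (R * R) := [set p | 0 <= p.1 /\ 0 <= p.2].

Definition is_minimum (S : set R) (m : R) : Prop := S m /\ lbound S m.

(** Points of the plane are [(x, t)]; the free boundaries are [x = - xi1 t] and
    [x = xi2 t]. *)
Definition Qopen xi1 xi2 : set (R * R) :=
  [set p | 0 < p.2 /\ - xi1 p.2 < p.1 < xi2 p.2].

(* closed on the sides, but without the initial time *)
Definition Qlat xi1 xi2 : set (R * R) :=
  [set p | 0 < p.2 /\ - xi1 p.2 <= p.1 <= xi2 p.2].

Definition Qupto xi1 xi2 (t0 : R) : set (R * R) :=
  [set p | 0 < p.2 <= t0 /\ - xi1 p.2 < p.1 < xi2 p.2].

Definition C1_pos xi : Prop :=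
  forall t, 0 < t -> derivable xi t 1 /\ {for t, continuous xi^`()}.

(** Classical solutions, for [t > 0], of [u_t = a(u_x) u_xx] with the contact
    conditions on the lines [u = - x tan beta] and [u = x tan beta]: [u] is of class [C^{2,1}] up to the
    free boundaries, which are of class [C^1].  The values of [u] outside
    [Qlat xi1 xi2], and of [xi1], [xi2] outside [t > 0], play no role. *)
Record solution (beta : R) (a : R -> R) (k1 k2 : R * R -> R)
    (u : R * R -> R) (xi1 xi2 : R -> R) : Prop := Solution {
  solution_xi_gt0 : forall t, 0 < t -> 0 < xi1 t /\ 0 < xi2 t ;
  solution_xi1_C1 : C1_pos xi1 ;
  solution_xi2_C1 : C1_pos xi2 ;
  solution_u_gt0 : forall p, Qlat xi1 xi2 p -> 0 < u p ;
  solution_u_continuous : {within Qlat xi1 xi2, continuous u} ;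
  solution_eqn : exists ux uxx ut : R * R -> R,
    [/\ is_partial1 (Qlat xi1 xi2) u ux,
        is_partial1 (Qlat xi1 xi2) ux uxx &
        is_partial2 (Qlat xi1 xi2) u ut] /\
    [/\ forall p, Qopen xi1 xi2 p -> ut p = a (ux p) * uxx p,
        forall x t, 0 < t -> x = - xi1 t ->
          ux (x, t) = - k1 (t, u (x, t)) /\ u (x, t) = - x * tan beta &
        forall x t, 0 < t -> x = xi2 t ->
          ux (x, t) = k2 (t, u (x, t)) /\ u (x, t) = x * tan beta]
}.

Definition self_similar_solution (beta : R) (a : R -> R) (k1 k2 : R * R -> R)
    (b : R) (U : R * R -> R) (Xi1 Xi2 : R -> R) : Prop :=
  [/\ solution beta a k1 k2 U Xi1 Xi2,
      forall x t, 0 < t -> - Xi1 t <= x <= Xi2 t ->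
        b * U (x, t) = U (b * x, b ^+ 2 * t) &
      forall t, 0 < t ->
        b * Xi1 t = Xi1 (b ^+ 2 * t) /\ b * Xi2 t = Xi2 (b ^+ 2 * t)].

(** The data [(u0, xi01, xi02)] form an element of [C^{2+mu}_ad]; [u0x] and
    [u0xx] are the derivatives of [u0], extended to the end points. *)
Definition admissible (beta sigma mu : R) (k1 k2 : R * R -> R)
    (u0 : R -> R) (xi01 xi02 : R) : Prop :=
  let I := `[- xi01, xi02]%classic in
  [/\ 0 < xi01, 0 < xi02, forall x, I x -> 0 < u0 x,
      u0 (- xi01) = xi01 * tan beta & u0 xi02 = xi02 * tan beta] /\
  exists u0x u0xx : R -> R,
    [/\ {within I, continuous u0}, {within I, continuous u0x},
        forall x, - xi01 < x < xi02 -> is_derive x 1 u0 (u0x x),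
        forall x, - xi01 < x < xi02 -> is_derive x 1 u0x (u0xx x) &
        exists C, forall x y, I x -> I y ->
          `|u0xx x - u0xx y| <= C * `|x - y| `^ mu] /\
    [/\ u0x (- xi01) = - k1 (0, u0 (- xi01)),
        u0x xi02 = k2 (0, u0 xi02) &
        forall x, I x -> `|u0x x| <= tan beta - sigma].

Definition parabolic_holder (mu : R) A f : Prop :=
  exists C, forall p q, A p -> A q ->
    `|f p - f q| <= C * (`|p.1 - q.1| `^ mu + `|p.2 - q.2| `^ (mu / 2)).

(** The parabolic Hölder space [C^{2+mu,1+mu/2}] in the sense of
    Ladyzhenskaya, Solonnikov and Ural'ceva, hence the exponent [(1+mu)/2] in
    time for [u_x].  It is used for compact [A] only, where the sup norms are
    finite by continuity. *)
Definition C2mu_1mu2 (mu : R) A u : Prop :=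
  {within A, continuous u} /\
  exists ux uxx ut : R * R -> R,
    [/\ is_partial1 A u ux, is_partial1 A ux uxx & is_partial2 A u ut] /\
    [/\ parabolic_holder mu A uxx, parabolic_holder mu A ut &
        exists C, forall x t s, A (x, t) -> A (x, s) ->
          `|ux (x, t) - ux (x, s)| <= C * `|t - s| `^ ((1 + mu) / 2)].

Record global_solution_with_data (beta mu : R) (a : R -> R)
    (k1 k2 : R * R -> R) (u0 : R -> R) (xi01 xi02 : R)
    (u : R * R -> R) (xi1 xi2 : R -> R) : Prop := GlobalSolution {
  global_solution : solution beta a k1 k2 u xi1 xi2 ;
  global_xi1_continuous : {within `[0, +oo[%classic, continuous xi1} ;
  global_xi2_continuous : {within `[0, +oo[%classic, continuous xi2} ;
  global_xi1_init : xi1 0 = xi01 ;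
  global_xi2_init : xi2 0 = xi02 ;
  global_u_init : forall x, - xi01 <= x <= xi02 -> u (x, 0) = u0 x ;
  global_holder : forall t0, 0 < t0 ->
    C2mu_1mu2 mu (closure (Qupto xi1 xi2 t0)) u
}.

(** The norm of the library on [R * R] is the sup norm, whence the explicit
    Euclidean distance. *)
Definition eucl_dist (p q : R * R) : R :=
  Num.sqrt ((p.1 - q.1) ^+ 2 + (p.2 - q.2) ^+ 2).

Definition dist_to (A : set (R * R)) (p : R * R) : \bar R :=
  ereal_inf [set (eucl_dist p q)%:E | q in A].

Definition hausdorff_dist (A B : set (R * R)) : \bar R :=
  Order.max (ereal_sup [set dist_to B p | p in A])
            (ereal_sup [set dist_to A q | q in B]).

Definition graph_at u xi1 xi2 (t : R) : set (R * R) :=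
  [set (x, u (x, t)) | x in `[- xi1 t, xi2 t]%classic].

End Defs.

(* Main.v *)
Require Import Defs.
From HB Require Import structures.
From mathcomp Require Import all_boot all_order all_algebra.
From mathcomp Require Import all_classical all_reals all_analysis.
From mathcomp Require Import ring lra.

(** Since [k_i] is continuous at the origin and invariant under the scaling
    [(t, u) |-> (b ^+ 2 * t, b * u)], it is constant.  Hence self-similar
    solutions have the form [sqrt t * phi (x / sqrt t)] with a profile [phi]
    solving [a (phi') phi'' = (phi - s phi') / 2] on an interval [[- P, Q]],
    with [phi = |s| tan beta] and prescribed slopes [l = - k1], [r = k2] at the
    ends.  In terms of the slope [p = phi'], the function
    [g (p) = phi - s phi'] satisfies [g g'' = - 2 a (p)] on the fixed interval
    [[l, r]] and its linear extension vanishes at [- tan beta] and [tan beta];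
    this is solved by shooting in a coefficient [mu] of the equation
    [g g'' = - 2 mu a (p)], and [mu] is then scaled away.

    Uniqueness and stability both follow from the comparison principle: any
    solution lying above the cone [u >= |x| tan beta] is squeezed between two
    time shifts [S (x, t + tau)] of the self-similar solution [S], so that
    [|u - S| <= C / sqrt t].  For a discrete self-similar solution, rescaling
    this estimate gives [u = S].  A solution stays above the cone because linear
    functions solve the equation; for a self-similar solution the defect is again
    removed by rescaling. *)

Set Implicit Arguments.
Unset Strict Implicit.
Unset Printing Implicit Defensive.

Import Order.TTheory GRing.Theory Num.Theory.
Import numFieldNormedType.Exports.

Local Open Scope ring_scope.
Local Open Scope classical_set_scope.

(** * Calculus on the line *)

Section Calculus.
Context {R : realType}.
Implicit Types (f g F G : R -> R) (x y a b c : R).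

(** The obstacle is that the solution and its domain are both unknown. For the profile, the Legendre
    transform removes it because the end slopes are prescribed although the end points are not: in
    the slope variable the interval is fixed. As [g' = - s], the end conditions become linear and
    homogeneous in [(g, g')]; this is what permits shooting in the coefficient and scaling it away.

    In the comparison, two domains are never compared. The profile is extended linearly, so that a
    barrier lives on the whole line and only the domain of [u] occurs. The extended profile is
    merely of class C^1, but where it is linear it is a supersolution, since [phi - s phi' > 0]. The
    end slopes [l] and [r] are its extreme slopes, and this yields the sign needed at a contact on a
    free boundary.

    The rate [1 / sqrt t] is that of [sqrt (t + tau) - sqrt t]. The free boundaries inherit it
    because the profile crosses the lines of the cone transversally, by [- tan beta < l] and
    [r < tan beta]. *)

Lemma is_derive_id1 x : is_derive x 1 (fun y : R => y) 1.
Proof. exact: is_derive_id. Qed.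

Lemma is_derive_cst1 a x : is_derive x 1 (fun _ : R => a) 0.
Proof. exact: is_derive_cst. Qed.

Lemma is_derive_add f g x a b : is_derive x 1 f a -> is_derive x 1 g b ->
  is_derive x 1 (fun y => f y + g y) (a + b).
Proof. by move=> fa gb; exact: is_deriveD. Qed.

Lemma is_derive_opp f x a : is_derive x 1 f a ->
  is_derive x 1 (fun y => - f y) (- a).
Proof. by move=> fa; exact: is_deriveN. Qed.

Lemma is_derive_sub f g x a b : is_derive x 1 f a -> is_derive x 1 g b ->
  is_derive x 1 (fun y => f y - g y) (a - b).
Proof. by move=> fa gb; exact: is_deriveB. Qed.

Lemma is_derive_mul f g x a b : is_derive x 1 f a -> is_derive x 1 g b ->
  is_derive x 1 (fun y => f y * g y) (a * g x + f x * b).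
Proof.
move=> fa gb; have := is_deriveM fa gb.
by rewrite /GRing.scale/= addrC [g x * a]mulrC.
Qed.

Lemma is_derive_mull f c x a : is_derive x 1 f a ->
  is_derive x 1 (fun y => c * f y) (c * a).
Proof. by move=> fa; exact: is_deriveZ. Qed.

Lemma is_derive_comp f g x a b : is_derive (g x) 1 f a -> is_derive x 1 g b ->
  is_derive x 1 (fun y => f (g y)) (a * b).
Proof. by move=> fa gb; exact: is_derive1_comp. Qed.

Lemma is_derive_continuous f x a : is_derive x 1 f a -> {for x, continuous f}.
Proof.
by move=> [fx _]; apply: differentiable_continuous; apply/derivable1_diffP.
Qed.

Lemma mean_value f f' a b : a < b ->
  (forall x, a <= x <= b -> is_derive x 1 f (f' x)) ->
  exists2 c, a < c < b & f b - f a = f' c * (b - a).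
Proof.
move=> ab df; have [|x xab|c] := @MVT R f f' a b ab.
- by move=> x /[!in_itv]/= /andP[ax xb]; apply: df; rewrite !ltW.
- apply: continuous_in_subspaceT xab => z; rewrite inE/= in_itv/= => zab.
  exact: is_derive_continuous (df z zab).
- by rewrite in_itv/=; exists c.
Qed.

Lemma nondecreasing_of_derive f f' a b : a <= b ->
  (forall x, a <= x <= b -> is_derive x 1 f (f' x)) ->
  (forall x, a < x < b -> 0 <= f' x) -> f a <= f b.
Proof.
rewrite le_eqVlt => /predU1P[->//|ab] df f0.
have [c cab] := mean_value ab df => fE.
by rewrite -subr_ge0 fE mulr_ge0 ?f0// subr_ge0 ltW.
Qed.

Lemma increasing_of_derive f f' a b : a < b ->
  (forall x, a <= x <= b -> is_derive x 1 f (f' x)) ->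
  (forall x, a < x < b -> 0 < f' x) -> f a < f b.
Proof.
move=> ab df f0; have [c cab] := mean_value ab df => fE.
by rewrite -subr_gt0 fE mulr_gt0 ?f0// subr_gt0.
Qed.

Lemma primitive_right f a : continuous f ->
  exists F, forall x, a < x -> is_derive x 1 F (f x).
Proof.
move=> cf; exists (fun x => (\int[lebesgue_measure]_(t in `[a, x]) f t)%R) => x ax.
have xu : x < x + 1 by rewrite ltrDl.
have [|? <-] := @continuous_FTC1_closed R f a x (x + 1) xu _ ax (cf x).
  apply: continuous_compact_integrable; first exact: segment_compact.
  exact: continuous_subspaceT.
by rewrite derive1E; apply/derivableP.
Qed.

(** An integral from a base point gives a primitive only to the right of it. The left side comes
    from a primitive of the reflected function; the two differ by a constant where both are valid,
    and are glued at [a] after being normalised to vanish there. *)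
Lemma primitive_exists f a : continuous f ->
  exists F, F a = 0 /\ forall x, is_derive x 1 F (f x).
Proof.
move=> cf.
have [F1 dF1] := primitive_right (a - 1) cf.
have [|G dG] := @primitive_right (fun x => f (- x)) (- a - 1).
  by move=> x; apply: continuous_comp; [exact: opp_continuous|exact: cf].
pose F2 x := - G (- x).
have dF2 x : x < a + 1 -> is_derive x 1 F2 (f x).
  move=> xa; rewrite -[f x]opprK; apply: is_derive_opp.
  have -> : - f x = f (- - x) * (- 1) by rewrite opprK mulrN1.
  apply: (@is_derive_comp G (fun y => - y)); apply: dG; lra.
have F12 x : a - 1 < x < a -> F1 a - F1 x = F2 a - F2 x.
  move=> xa; have xa' : x < a by lra.
  have [|c _] := @mean_value (fun y => F1 y - F2 y) (fun y => f y - f y) x a xa'.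
    by move=> y yx; apply: is_derive_sub; [apply: dF1|apply: dF2]; lra.
  by rewrite subrr mul0r; lra.
exists (fun x => if x < a then F2 x - F2 a else F1 x - F1 a).
split=> [|x]; first by rewrite ltxx subrr.
have [xa|xa] := ltP (a - 1) x.
- apply: (@near_eq_is_derive _ _ _ (fun x => F1 x - F1 a)).
    near=> y; case: ifPn => // ya.
    have -> // : F1 y - F1 a = F2 y - F2 a.
    have : a - 1 < y < a by apply/andP; split => //; near: y; exact: lt_nbhsr.
    by move=> /F12; lra.
  rewrite -[f x]subr0; apply: is_derive_sub; exact: dF1.
- apply: (@near_eq_is_derive _ _ _ (fun x => F2 x - F2 a)).
    near=> y; have -> // : y < a by near: y; apply: lt_nbhsl; lra.
  rewrite -[f x]subr0; by apply: is_derive_sub; apply: dF2; lra.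
Unshelve. all: by end_near. Qed.

End Calculus.

(** * A second-order initial value problem *)

Section Clip.
Context {R : realType}.
Implicit Types (x y : R).

Lemma lipschitz_continuous (f : R -> R) (K : R) :
  (forall x y, `|f x - f y| <= K * `|x - y|) -> continuous f.
Proof.
move=> fK x; apply/cvgrPdist_lt => e e0; near=> y.
apply: le_lt_trans (fK x y) _.
have K0 : 0 < `|K| + 1 by rewrite ltr_wpDl.
apply: le_lt_trans (_ : _ <= (`|K| + 1) * `|x - y|) _.
  by rewrite ler_wpM2r// (le_trans (ler_norm _))// lerDl.
rewrite mulrC -ltr_pdivlMr//; near: y.
apply: cvgr_dist_lt; last by rewrite divr_gt0.
exact: cvg_id.
Unshelve. all: by end_near. Qed.

(** Composing with this projection freezes a function outside [[l, r]], so that data known on a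
    segment become continuous on the whole line. *)
Definition clip (l r x : R) := if x < l then l else if r < x then r else x.

Variables (l r : R).
Hypothesis lr : l <= r.

Lemma clip_itv x : l <= clip l r x <= r.
Proof.
move: lr => ?; rewrite /clip.
by case: ltP => ?; [|case: ltP => ?]; apply/andP; split; lra.
Qed.

Lemma clip_id x : l <= x <= r -> clip l r x = x.
Proof. by move=> /andP[? ?]; rewrite /clip; case: ltP => ?; [|case: ltP => ?]; lra. Qed.

Lemma clip_lipschitz x y : `|clip l r x - clip l r y| <= `|x - y|.
Proof.
wlog xy : x y / x <= y => [H|].
  by case/orP: (le_total x y) => /H //; rewrite distrC [`|y - x|]distrC.
move: lr => ?; rewrite ler0_norm ?[`|x - y|]ler0_norm; rewrite /clip;
  by repeat case: ltP => ?; lra.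
Qed.

Lemma clip_continuous : continuous (clip l r).
Proof.
by apply: (@lipschitz_continuous _ 1) => x y; rewrite mul1r clip_lipschitz.
Qed.

End Clip.

(** * Picard iteration in an exponentially weighted norm *)

Section Picard.
Context {R : realType}.

(** In the sup norm weighted by [expR (- la * (p - l))], integration from [l] gains a factor
    [1 / la]: the bound on [f'] is the derivative of the claimed bound, so their sum and difference
    with [f] are nondecreasing. *)
Lemma exp_dominate (l r D la : R) (f f' : R -> R) : 0 < la -> f l = 0 ->
  (forall p : R, is_derive p 1 f (f' p)) ->
  (forall p, l <= p <= r -> `|f' p| <= D * expR (la * (p - l))) ->
  forall p, l <= p <= r -> `|f p| <= D / la * expR (la * (p - l)).
Proof.
move=> la0 fl df f'D p /andP[lp pr].
have D0 : 0 <= D.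
  by have := f'D l; rewrite subrr mulr0 expR0 mulr1 lexx (le_trans lp pr) =>
    /(_ isT); exact: le_trans.
pose e q := D / la * expR (la * (q - l)).
have de (q : R) : is_derive q 1 e (D * expR (la * (q - l))).
  have -> : D * expR (la * (q - l)) = D / la * (expR (la * (q - l)) * (la * (1 - 0))).
    by field; rewrite gt_eqF.
  by apply: is_derive_mull; apply: (@is_derive_comp _ expR (fun q => la * (q - l))).
have el : 0 <= e l by rewrite /e mulr_ge0 ?expR_ge0// divr_ge0// ltW.
have qlr q : l < q < p -> l <= q <= r.
  by move=> /andP[lq qp]; rewrite ltW//= (le_trans _ pr)// ltW.
rewrite ler_norml; apply/andP; split.
- have : e l + f l <= e p + f p.
    apply: (@nondecreasing_of_derive _ (fun q => e q + f q)
      (fun q => D * expR (la * (q - l)) + f' q)) => // q /qlr/f'D.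
    by rewrite ler_norml => /andP[]; lra.
  by rewrite fl /e; rewrite /e in el; lra.
- have : e l - f l <= e p - f p.
    apply: (@nondecreasing_of_derive _ (fun q => e q - f q)
      (fun q => D * expR (la * (q - l)) - f' q)) => // q /qlr/f'D.
    by rewrite ler_norml => /andP[]; lra.
  by rewrite fl /e; rewrite /e in el; lra.
Qed.

(** With [v n = 2 * C / 2 ^+ n], the sum of the remaining increments, the intervals
    [[u n - v n, u n + v n]] are nested; the supremum of the left ends lies in all of them. *)
Lemma geometric_cauchy (u : nat -> R) (C : R) :
  (forall n, `|u n.+1 - u n| <= C / 2 ^+ n) ->
  exists L, forall n, `|u n - L| <= 2 * C / 2 ^+ n.
Proof.
move=> uC.
pose v n := 2 * C / 2 ^+ n.
have vS n : v n.+1 = v n / 2.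
  by rewrite /v exprS; field; rewrite expf_neq0// pnatr_eq0.
have vE n : C / 2 ^+ n = v n / 2 by rewrite /v; field; rewrite expf_neq0// pnatr_eq0.
have v0 n : 0 <= v n.
  by have := le_trans (normr_ge0 _) (uC n); rewrite vE; lra.
pose a n := u n - v n; pose b n := u n + v n.
have aS n : a n <= a n.+1.
  by have := uC n; rewrite ler_norml vE /a vS => /andP[]; lra.
have bS n : b n.+1 <= b n.
  by have := uC n; rewrite ler_norml vE /b vS => /andP[]; lra.
have amono : {homo a : m n / (m <= n)%N >-> m <= n}.
  by apply: homo_leq aS => //; exact: le_trans.
have bmono : {homo b : m n / (m <= n)%N >-> n <= m}.
  by apply: homo_leq bS => // y x z /= yx zy; exact: le_trans zy yx.
have ab m n : a m <= b n.
  have mk : (m <= maxn m n)%N by exact: leq_maxl.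
  have nk : (n <= maxn m n)%N by exact: leq_maxr.
  apply: le_trans (amono _ _ mk) (le_trans _ (bmono _ _ nk)).
  by rewrite /a /b; have := v0 (maxn m n); lra.
exists (sup (range a)) => n.
have hub : has_ubound (range a) by exists (b 0%N) => _ [m _ <-].
have h1 : a n <= sup (range a) by apply: ub_le_sup => //; exists n.
have h2 : sup (range a) <= b n.
  by apply: ge_sup; [exists (a 0%N); exists 0%N|move=> _ [m _ <-]].
move: h1 h2; set L := sup _; rewrite /a /b -/(v n) ler_norml => h1 h2.
by apply/andP; split; lra.
Qed.

Lemma le_geometric_eq0 (x C : R) : (forall n, `|x| <= C / 2 ^+ n) -> x = 0.
Proof.
move=> xC; apply/eqP; rewrite -normr_le0; apply/ler_addgt0Pl => e e0.
rewrite addr0.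
have [n nC] : exists n : nat, C / e < n%:R.
  by exists (Num.truncn (`|C / e|)).+1; rewrite (le_lt_trans (ler_norm _))// truncnS_gt.
apply: le_trans (xC n) _.
rewrite ler_pdivrMr ?exprn_gt0//.
rewrite ltr_pdivrMr// in nC; apply: le_trans (ltW nC) _.
rewrite [e * _]mulrC; apply: ler_wpM2r; first exact: ltW.
have -> : 2 ^+ n = (2 ^ n)%:R :> R by rewrite natrX.
by rewrite ler_nat ltnW// ltn_expl.
Qed.

Section ivp.
Variables (l r alpha beta K : R) (F : R -> R -> R).
Hypotheses (lr : l <= r) (K0 : 0 <= K).
Hypothesis F_continuous : forall g, continuous g -> continuous (fun p => F p (g p)).
Hypothesis F_lipschitz : forall p z z', `|F p z - F p z'| <= K * `|z - z'|.

(** One Picard iteration, from [g] to [h]. Reading [g] through [clip] makes only its values on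
    [[l, r]] matter; the sign in [h' = - y] is that of the Legendre transform, where [y] is the
    point of given slope. *)
Let step (g h y : R -> R) : Prop :=
  [/\ h l = alpha, y l = beta, forall p : R, is_derive p 1 h (- y p) &
      forall p : R, is_derive p 1 y (F p (g (clip l r p)))].

Let step_exists g : continuous (g \o clip l r) -> exists h, exists y, step g h y.
Proof.
move=> cg.
have [Y [Yl dY]] := primitive_exists l (F_continuous cg).
have cY : continuous (fun p => - (beta + Y p)).
  by move=> p; apply: (@is_derive_continuous _ _ _ (- (0 + F p (g (clip l r p))))).
have [H [Hl dH]] := primitive_exists l cY.
exists (fun p => alpha + H p), (fun p => beta + Y p); split.
- by rewrite Hl addr0.
- by rewrite Yl addr0.
- by move=> p; rewrite -[- _]add0r; apply: is_derive_add; exact: dH.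
- by move=> p; rewrite -[F _ _]add0r; apply: is_derive_add; exact: dY.
Qed.

(** Two integrations cost [K / la ^+ 2] in the weighted norm; this weight makes it at most
    [1 / 2]. *)
Let la := 1 + 2 * K.

Let step_contract g1 h1 y1 g2 h2 y2 D :
  step g1 h1 y1 -> step g2 h2 y2 ->
  (forall p, l <= p <= r -> `|g1 p - g2 p| <= D * expR (la * (p - l))) ->
  forall p, l <= p <= r -> `|h1 p - h2 p| <= D / 2 * expR (la * (p - l)).
Proof.
move=> [h1l y1l dh1 dy1] [h2l y2l dh2 dy2] gD p plr.
have la0 : 0 < la by move: K0; rewrite /la; lra.
have D0 : 0 <= D.
  have := gD l; rewrite subrr mulr0 expR0 mulr1 lexx lr => /(_ isT).
  exact: le_trans.
have yD q : l <= q <= r -> `|y1 q - y2 q| <= K * D / la * expR (la * (q - l)).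
  apply: (@exp_dominate _ _ _ _ (fun q => y1 q - y2 q)
    (fun q => F q (g1 (clip l r q)) - F q (g2 (clip l r q)))) => //.
  - by rewrite y1l y2l subrr.
  - move=> x xlr; apply: le_trans (F_lipschitz _ _ _) _.
    by rewrite -mulrA ler_wpM2l// clip_id// gD.
have : `|h1 p - h2 p| <= K * D / la / la * expR (la * (p - l)).
  apply: (@exp_dominate l r _ _ (fun q => h1 q - h2 q)
    (fun q => - y1 q - - y2 q)) => //.
  - by rewrite h1l h2l subrr.
  - by move=> x xlr; rewrite -opprD normrN; exact: yD.
move/le_trans; apply; rewrite ler_wpM2r ?expR_ge0//.
rewrite -mulrA -invfM ler_pdivrMr ?mulr_gt0//.
have -> : D / 2 * (la * la) = D * (la * la / 2) by field.
by rewrite mulrC ler_wpM2l// /la; move: K0; nra.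
Qed.

(** The limit [L] of the iterates is known only as a continuous pointwise limit. The solution
    returned is its image [N L], which satisfies the differential equations by construction, and
    which equals [L] on [[l, r]], the only place where [F] reads it. *)
Lemma second_order_ivp : exists G Y : R -> R,
  [/\ G l = alpha, Y l = beta, forall p : R, is_derive p 1 G (- Y p) &
      forall p : R, is_derive p 1 Y (F p (G (clip l r p)))].
Proof.
have /choice[N NE] : forall g, exists h, continuous (g \o clip l r) -> exists y, step g h y.
  move=> g; have [cg|] := pselect (continuous (g \o clip l r)); last by exists g.
  by have [h hy] := step_exists cg; exists h.
have stepc g h y : step g h y -> continuous h.
  by move=> [_ _ dh _] p; exact: is_derive_continuous (dh p).
have cclip (h : R -> R) : continuous h -> continuous (h \o clip l r).
  by move=> ch x; apply: continuous_comp; [exact: clip_continuous|exact: ch].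
pose u n := iter n N (fun=> alpha).
have uc n : continuous (u n).
  elim: n => [|n IH]; first by move=> ?; exact: cvg_cst.
  by have [y /stepc] := NE _ (cclip _ IH).
have ustep n : exists y, step (u n) (u n.+1) y by apply: NE; exact: cclip.
have expR_ge1' p : l <= p -> 1 <= expR (la * (p - l)).
  by move=> lp; rewrite -expR0 ler_expR mulr_ge0 /la ?subr_ge0//; move: K0; lra.
have [D0 D0E] : exists D0, forall p, l <= p <= r ->
    `|u 1%N p - u 0%N p| <= D0 * expR (la * (p - l)).
  have [|c _ cE] := @EVT_max R (fun p => `|u 1%N p - u 0%N p|) l r lr.
    apply: continuous_subspaceT => x; apply: cvg_norm.
    by apply: cvgB; exact: uc.
  exists `|u 1%N c - u 0%N c| => p plr; apply: le_trans (cE p plr) _.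
  by rewrite ler_peMr// expR_ge1'//; case/andP: plr.
have uD n p : l <= p <= r -> `|u n.+1 p - u n p| <= D0 / 2 ^+ n * expR (la * (p - l)).
  elim: n p => [|n IH] p plr; first by rewrite expr0 divr1 D0E.
  have [y1 s1] := ustep n.+1; have [y0 s0] := ustep n.
  have := step_contract s1 s0 IH plr.
  by rewrite exprS invfM [2^-1 * _]mulrC mulrA.
pose C := D0 * expR (la * (r - l)).
have D00 : 0 <= D0.
  have := D0E l; rewrite subrr mulr0 expR0 mulr1 lexx lr => /(_ isT).
  exact: le_trans.
have expRr p : p <= r -> expR (la * (p - l)) <= expR (la * (r - l)).
  by move=> pr; rewrite ler_expR ler_wpM2l ?lerB// /la; move: K0; lra.
have uC p : exists L, forall n, `|u n (clip l r p) - L| <= 2 * C / 2 ^+ n.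
  apply: geometric_cauchy => n; apply: le_trans (uD _ _ (clip_itv lr p)) _.
  rewrite /C mulrAC ler_pM2r ?invr_gt0 ?exprn_gt0//.
  by rewrite ler_wpM2l ?expRr//; case/andP: (clip_itv lr p).
have [L LE] := choice uC.
have Lclip p : L (clip l r p) = L p.
  apply/eqP; rewrite -subr_eq0; apply/eqP.
  apply: (@le_geometric_eq0 _ (2 * (2 * C))) => n.
  have := LE p n; have := LE (clip l r p) n.
  rewrite (clip_id (clip_itv lr p)) => h1 h2.
  have -> : L (clip l r p) - L p =
    (u n (clip l r p) - L p) - (u n (clip l r p) - L (clip l r p)) by ring.
  apply: le_trans (ler_normB _ _) _.
  by rewrite -mulrA mulr_natl mulr2n lerD.
have cL : continuous L.
  move=> p; apply/cvgrPdist_lt => e e0.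
  have [n nC] : exists n : nat, 2 * C / 2 ^+ n < e / 3.
    apply: contrapT => /forallNP h.
    have : `|e / 3| = 0.
      have := @le_geometric_eq0 (e / 3) (2 * C) _ => -> //; first by rewrite normr0.
      by move=> n; rewrite gtr0_norm ?divr_gt0// leNgt; apply/negP/h.
    by move/eqP; rewrite normr_eq0 gt_eqF// divr_gt0.
  have e30 : 0 < e / 3 by rewrite divr_gt0.
  have := cclip _ (uc n) p => /cvgrPdist_lt/(_ _ e30); apply: filterS => q /= h.
  have := LE p n; have := LE q n => h1 h2.
  have -> : L p - L q = (u n (clip l r p) - u n (clip l r q)) -
    (u n (clip l r p) - L p) + (u n (clip l r q) - L q) by ring.
  apply: le_lt_trans (ler_normD _ _) _.
  apply: le_lt_trans (lerD (ler_normB _ _) (lexx _)) _.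
  lra.
have [Y sLY] := NE L (cclip _ cL).
have NL p : l <= p <= r -> N L p = L p.
  move=> plr; apply/eqP; rewrite -subr_eq0; apply/eqP.
  apply: (@le_geometric_eq0 _ (2 * C * (expR (la * (r - l)) + 1))) => n.
  have [y0 s0] := ustep n.
  have h1 : `|N L p - u n.+1 p| <= 2 * C / 2 ^+ n / 2 * expR (la * (p - l)).
    apply: (step_contract sLY s0) plr => q qlr.
    rewrite distrC; have := LE q n; rewrite clip_id// => /le_trans; apply.
    rewrite ler_peMr ?expR_ge1'//; last by case/andP: qlr.
    by rewrite divr_ge0 ?exprn_ge0// mulr_ge0// mulr_ge0 ?expR_ge0.
  have h2 := LE p n.+1; rewrite clip_id// in h2.
  have -> : N L p - L p = (N L p - u n.+1 p) + (u n.+1 p - L p) by ring.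
  apply: le_trans (ler_normD _ _) _; apply: le_trans (lerD h1 h2) _.
  have C0 : 0 <= 2 * C / 2 ^+ n.
    by rewrite divr_ge0 ?exprn_ge0// mulr_ge0// mulr_ge0 ?expR_ge0.
  rewrite exprS invfM [2 * C * (2^-1 / _)]mulrCA [2 * C * (_ + _) / _]mulrAC.
  have pr : p <= r by case/andP: plr.
  move: (expRr p pr) (expR_ge0 (la * (p - l))) C0.
  by set a := expR _; set b := expR _; set c := 2 * C / _; nra.
case: sLY => s1 s2 s3 s4; exists (N L), Y; split=> // p.
by rewrite NL ?clip_itv.
Qed.

End ivp.
End Picard.

(** * The boundary value problem for the Legendre transform *)

Section Shooting.
Context {R : realType}.

(* Gronwall's inequality for the energy [x ^+ 2 + v ^+ 2]. *)
Lemma energy_gronwall (l r L B : R) (x v f : R -> R) : l <= r -> 0 <= L ->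
  0 <= B -> x l = 0 -> v l = 0 ->
  (forall p : R, is_derive p 1 x (- v p)) ->
  (forall p : R, is_derive p 1 v (f p)) ->
  (forall p : R, l <= p <= r -> `|f p| <= B + L * `|x p|) ->
  `|x r| <= B * expR ((2 + L) * (r - l)) /\
  `|v r| <= B * expR ((2 + L) * (r - l)).
Proof.
move=> lr L0 B0 xl vl dx dv fB; set ka := 2 + L.
have ka0 : 0 < ka by rewrite /ka; lra.
pose E p := x p * x p + v p * v p + B * B.
pose E' p := - v p * x p + x p * - v p + (f p * v p + v p * f p) + 0.
have dE (p : R) : is_derive p 1 E (E' p).
  apply: is_derive_add; apply: is_derive_add; exact: is_derive_mul.
pose e p := expR (- ka * (p - l)).
have de (p : R) : is_derive p 1 e (e p * (- ka * (1 - 0))).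
  by apply: (@is_derive_comp _ expR (fun q => - ka * (q - l))).
have E'le p : l <= p <= r -> E' p <= ka * E p.
  move=> plr; have := fB p plr => h.
  have h1 : f p * v p <= `|f p| * `|v p| by rewrite -normrM ler_norm.
  have h2 : - v p * x p <= `|v p| * `|x p| by rewrite -[`|v p|]normrN -normrM ler_norm.
  have h3 : `|f p| * `|v p| <= (B + L * `|x p|) * `|v p| by rewrite ler_wpM2r.
  rewrite /E' /E /ka.
  have <- : `|x p| * `|x p| = x p * x p by rewrite -normrM ger0_norm// -expr2 sqr_ge0.
  have <- : `|v p| * `|v p| = v p * v p by rewrite -normrM ger0_norm// -expr2 sqr_ge0.
  move: h1 h2 h3; set X := `|x p|; set V := `|v p| => h1 h2 h3.
  have : 2 * (B * V) <= B * B + V * V.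
    by have := sqr_ge0 (B - V); rewrite expr2; lra.
  have : 2 * (X * V) <= X * X + V * V.
    by have := sqr_ge0 (X - V); rewrite expr2; lra.
  have : L * (2 * (X * V)) <= L * (X * X + V * V).
    by rewrite ler_wpM2l//; have := sqr_ge0 (X - V); rewrite expr2; lra.
  have : 0 <= B * B by rewrite -expr2 sqr_ge0.
  have : 0 <= L * (B * B) by rewrite mulr_ge0// -expr2 sqr_ge0.
  have : 0 <= V * V by rewrite -expr2 sqr_ge0.
  have : 0 <= X * X by rewrite -expr2 sqr_ge0.
  by lra.
have : - (E l * e l) <= - (E r * e r).
  apply: (@nondecreasing_of_derive _ (fun p => - (E p * e p))
    (fun p => - (E' p * e p + E p * (e p * (- ka * (1 - 0)))))) => //.
    by move=> p _; apply: is_derive_opp; exact: is_derive_mul.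
  move=> p /andP[lp pr]; have : E' p <= ka * E p by rewrite E'le// !ltW.
  have : 0 <= e p by exact: expR_ge0.
  by nra.
have -> : E l * e l = B * B.
  by rewrite /E /e xl vl subrr !mulr0 expR0 mulr1 !add0r.
rewrite lerN2 /e; set c := expR _ => h.
have cE : expR (ka * (r - l)) = c^-1 by rewrite /c mulNr expRN invrK.
have c0 : 0 < c by exact: expR_gt0.
have c1 : c <= 1.
  by rewrite /c -expR0 ler_expR mulNr oppr_le0 mulr_ge0 ?subr_ge0// ltW.
have EB : E r * (c * c) <= B * B.
  apply: le_trans h; rewrite ler_wpM2l//; last by nra.
  by rewrite /E !addr_ge0// -expr2 sqr_ge0.
have EE : E r = `|x r| * `|x r| + `|v r| * `|v r| + B * B.
  by rewrite /E -!normrM ![in RHS]ger0_norm// -expr2 sqr_ge0.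
have le_of_sqr z : z <= E r -> 0 <= z -> forall w, 0 <= w -> z = w * w -> w * c <= B.
  move=> zE _ w w0 zw; rewrite -ler_sqr ?nnegrE ?mulr_ge0 ?(ltW c0)//.
  rewrite !expr2; apply: le_trans EB; rewrite mulrACA -zw.
  by rewrite ler_wpM2r ?mulr_ge0 ?(ltW c0).
have BB : 0 <= B * B by rewrite mulr_ge0.
have xx : 0 <= `|x r| * `|x r| by rewrite mulr_ge0.
have vv : 0 <= `|v r| * `|v r| by rewrite mulr_ge0.
by rewrite cE !ler_pdivlMr//; split; apply: le_of_sqr (erefl _) => //;
  rewrite EE; lra.
Qed.

Lemma is_derive_cst_on (f f' : R -> R) (l r : R) : l <= r ->
  (forall p : R, is_derive p 1 f (f' p)) -> (forall p, f' p = 0) -> f r = f l.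
Proof.
move=> lr df f0; apply: is_derive_0_is_cst => x; rewrite -(f0 x); exact: df.
Qed.

Variables (A : R -> R) (T l r : R).
Hypotheses (cA : continuous A) (A0 : forall p, 0 < A p).
Hypotheses (Tl : - T < l) (lr : l < r) (rT : r < T).

Let al := T + l.
Let al' := T - r.
(** The a priori lower bound for [g]. For a concave [g] with [g l = al], [g' = - y] and
    [g r = al' * y r], the tangent at [r] gives [al - al' * y r <= y r * (r - l)], hence
    [y r >= al / (T - l)] and [g r >= eps]. Moreover [eps <= al], because [al' <= T - l]. *)
Let eps := al * al' / (T - l).

(* The profile [g] of a self-similar solution, as a function of the slope [p],
   is [phi - x phi'], and [y p] is the point of slope [p].  Freezing [A] outside
   [l, r] and truncating [g] from below makes the problem globally Lipschitz;
   concavity of [g] shows that the truncation is not active at a solution of the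
   boundary value problem. *)
Lemma legendre_profile : exists g y y' : R -> R,
  [/\ forall p : R, is_derive p 1 g (- y p),
      forall p : R, is_derive p 1 y (y' p),
      continuous y' /\ (exists2 c, 0 < c & forall p, c <= y' p),
      forall p, l <= p <= r -> 0 < g p /\ y' p = A p / g p &
      [/\ y l < 0, 0 < y r, g l = - (T + l) * y l & g r = (T - r) * y r]].
Proof.
have al0 : 0 < al by rewrite /al; move: Tl; lra.
have al'0 : 0 < al' by rewrite /al'; move: rT; lra.
have Tl0 : 0 < T - l by move: rT lr; lra.
have eps0 : 0 < eps by rewrite divr_gt0// mulr_gt0.
have rl0 : 0 < r - l by rewrite subr_gt0.
have eal : eps <= al.
  by rewrite /eps ler_pdivrMr// ler_pM2l// /al'; move: lr; lra.
pose cl := clip l r.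
have clE p : l <= p <= r -> cl p = p by exact: clip_id.
have clI p : l <= cl p <= r by apply: clip_itv; exact: ltW.
pose A1 p := A (cl p).
have cA1 : continuous A1.
  by move=> p; apply: continuous_comp; [exact: clip_continuous (ltW lr) p|exact: cA].
have [M [M0 AM]] : exists M, 0 < M /\ forall p, A1 p <= M.
  have [|c _ cE] := @EVT_max R A l r (ltW lr); first exact: continuous_subspaceT.
  by exists (A c); split => // p; apply: cE; exact: clI.
have [m [m0 mA]] : exists m, 0 < m /\ forall p, m <= A1 p.
  have [|c _ cE] := @EVT_min R A l r (ltW lr); first exact: continuous_subspaceT.
  by exists (A c); split => // p; apply: cE; exact: clI.
pose mx z := if z < eps then eps else z.
have mxe z : eps <= mx z by rewrite /mx; case: ltP.
have mx0 z : 0 < mx z by exact: lt_le_trans (mxe z).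
have mxL z z' : `|mx z - mx z'| <= `|z - z'|.
  wlog zz : z z' / z <= z' => [H|].
    by case/orP: (le_total z z') => /H //; rewrite distrC [`|z' - z|]distrC.
  rewrite ler0_norm ?[`|z - z'|]ler0_norm; rewrite /mx;
  by repeat case: ltP => ?; lra.
have mxV z z' : `|(mx z)^-1 - (mx z')^-1| <= `|z - z'| / (eps * eps).
  have -> : (mx z)^-1 - (mx z')^-1 = (mx z' - mx z) / (mx z * mx z').
    by field; rewrite !gt_eqF.
  rewrite normrM normfV [`|mx z * _|]gtr0_norm ?mulr_gt0// distrC.
  apply: ler_pM => //; first by rewrite invr_ge0 mulr_ge0// ltW.
  rewrite lef_pV2 ?posrE; [|exact: mulr_gt0|exact: mulr_gt0].
  by apply: ler_pM => //; exact: ltW.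
pose F mu p z := mu * A1 p * (mx z)^-1.
have FL mu nu p z z' : 0 <= nu ->
    `|F mu p z - F nu p z'| <= M / eps * `|mu - nu| + nu * M / (eps * eps) * `|z - z'|.
  move=> nu0.
  have -> : F mu p z - F nu p z' =
    (mu - nu) * (A1 p * (mx z)^-1) + nu * A1 p * ((mx z)^-1 - (mx z')^-1).
    by rewrite /F; ring.
  apply: le_trans (ler_normD _ _) _; apply: lerD.
    rewrite normrM mulrC ler_wpM2r// gtr0_norm ?mulr_gt0 ?invr_gt0//; last exact: A0.
    apply: ler_pM => //; [exact/ltW/A0|by rewrite invr_ge0 ltW|].
    by rewrite lef_pV2 ?posrE.
  rewrite 2!normrM (ger0_norm nu0) gtr0_norm; last exact: A0.
  apply: le_trans (_ : nu * M * (`|z - z'| / (eps * eps)) <= _).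
    apply: ler_pM => //; rewrite ?mulr_ge0//; first exact/ltW/A0.
    by rewrite ler_wpM2l.
  by rewrite mulrA mulrAC.
have cF mu g : continuous g -> continuous (fun p => F mu p (g p)).
  move=> cg p; apply: cvgM; first by apply: cvgM; [exact: cvg_cst|exact: cA1].
  apply: cvgV; first by rewrite gt_eqF.
  have cmx : continuous mx.
    by apply: (@lipschitz_continuous _ _ 1) => x z; rewrite mul1r.
  by apply: continuous_comp; [exact: cg|exact: cmx].
have A10 p : 0 <= A1 p by exact/ltW/A0.
have mxV0 z : 0 <= (mx z)^-1 by rewrite invr_ge0 ltW.
have M0' := ltW M0; have eps0' := ltW eps0.
have ee0 : 0 <= eps * eps by exact: mulr_ge0.
(* The initial values [al] and [- 1] satisfy the left end condition [g l = - (T + l) * y l] for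
   every [mu]; only the condition at [r] is left to the shooting. *)
have ivp mu : exists GY : (R -> R) * (R -> R), 0 <= mu ->
    [/\ GY.1 l = al, GY.2 l = - 1, forall p : R, is_derive p 1 GY.1 (- GY.2 p) &
    forall p : R, is_derive p 1 GY.2 (F mu p (GY.1 (cl p)))].
  have [mu0|] := pselect (0 <= mu); last by exists (id, id).
  have [| |p z z'|G [Y [GY1 GY2 GY3 GY4]]] := @second_order_ivp R l r al (- 1)
    (mu * M / (eps * eps)) (F mu) (ltW lr).
  - by rewrite divr_ge0// mulr_ge0.
  - exact: cF.
  - by have := FL mu mu p z z' mu0; rewrite subrr normr0 mulr0 add0r.
  by exists (G, Y).
have {ivp}[GY GYE] := choice ivp.
pose G mu := (GY mu).1; pose Y mu := (GY mu).2.
have Gl mu : 0 <= mu -> G mu l = al by move=> /GYE[].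
have Yl mu : 0 <= mu -> Y mu l = - 1 by move=> /GYE[].
have dG mu (p : R) : 0 <= mu -> is_derive p 1 (G mu) (- Y mu p) by move=> /GYE[].
have dY mu (p : R) : 0 <= mu -> is_derive p 1 (Y mu) (F mu p (G mu (cl p))).
  by move=> /GYE[].
have F0 mu p z : 0 <= mu -> 0 <= F mu p z.
  by move=> mu0; rewrite /F mulr_ge0// mulr_ge0.
have Ymono mu p q : 0 <= mu -> p <= q -> Y mu p <= Y mu q.
  move=> mu0 pq; apply: (@nondecreasing_of_derive _ _ (fun p => F mu p (G mu (cl p)))) => // x _;
    first [exact: dY|exact: F0].
have Gmax mu p : 0 <= mu -> l <= p <= r -> G mu p <= al + (r - l).
  move=> mu0 /andP[lp pr].
  have : l - G mu l <= p - G mu p.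
    apply: (@nondecreasing_of_derive _ (fun x => x - G mu x) (fun x => 1 - - Y mu x)) => // x.
      by move=> _; apply: is_derive_sub; exact: dG.
    by move=> /andP[lx _]; have := Ymono _ _ _ mu0 (ltW lx); rewrite Yl//; lra.
  by rewrite Gl//; lra.
pose Gm := al + (r - l).
have Gm0 : 0 < Gm by rewrite addr_gt0.
have mxG mu p : 0 <= mu -> mx (G mu (cl p)) <= Gm.
  move=> mu0; rewrite /mx; case: ltP => _; last exact: Gmax.
  by apply: le_trans eal _; rewrite lerDl ltW.
have Flow mu p : 0 <= mu -> mu * m / Gm <= F mu p (G mu (cl p)).
  move=> mu0; rewrite /F; apply: ler_pM.
  - by rewrite mulr_ge0// ltW.
  - by rewrite invr_ge0 ltW.
  - by rewrite ler_wpM2l.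
  - by rewrite lef_pV2 ?posrE// mxG.
(* Large enough for an overshoot: [Y' >= mu * m / Gm] and [Y l = - 1] give [Y r >= 1 + Gm / al'] at
   [mu = M1], so that [al' * Y r] exceeds [Gm], an upper bound of [G r]. *)
pose M1 := Gm * (2 + Gm / al') / (m * (r - l)).
have M10 : 0 < M1.
  by apply: divr_gt0; apply: mulr_gt0 => //; rewrite addr_gt0// divr_gt0.
(* The residual of the right end condition. Clipping the parameter to [[0, M1]] makes it Lipschitz
   on the whole line, by the energy estimate. *)
pose Phi mu := G (clip 0 M1 mu) r - al' * Y (clip 0 M1 mu) r.
have clM mu : 0 <= clip 0 M1 mu <= M1 by apply: clip_itv; exact: ltW.
have cPhi : continuous Phi.
  pose k := expR ((2 + M1 * M / (eps * eps)) * (r - l)).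
  apply: (@lipschitz_continuous _ _ ((1 + al') * (M / eps * k))) => mu nu.
  have /andP[mu0 muM] := clM mu; have /andP[nu0 nuM] := clM nu.
  have := clip_lipschitz (ltW M10) mu nu.
  rewrite /Phi; move: mu0 muM nu0 nuM.
  set mu' := clip 0 M1 mu; set nu' := clip 0 M1 nu => mu0 muM nu0 nuM munu.
  have L0 : 0 <= M1 * M / (eps * eps).
    by rewrite divr_ge0// mulr_ge0// ltW.
  have B0 : 0 <= M / eps * `|mu' - nu'| by rewrite mulr_ge0// divr_ge0.
  have [|||||] := @energy_gronwall l r (M1 * M / (eps * eps)) (M / eps * `|mu' - nu'|)
     (fun p => G mu' p - G nu' p) (fun p => Y mu' p - Y nu' p)
     (fun p => F mu' p (G mu' (cl p)) - F nu' p (G nu' (cl p))) (ltW lr) L0 B0.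
  - by rewrite !Gl// subrr.
  - by rewrite !Yl// subrr.
  - by move=> p; rewrite opprB addrC -[Y nu' p]opprK; apply: is_derive_sub; exact: dG.
  - by move=> p; apply: is_derive_sub; exact: dY.
  - move=> p plr; apply: le_trans (FL _ _ _ _ _ nu0) _; rewrite clE// lerD2l.
    rewrite ler_wpM2r// ler_wpM2r//; last by rewrite ler_wpM2r// ltW.
    by rewrite invr_ge0.
  rewrite -/k => h1 h2.
  have -> : G mu' r - al' * Y mu' r - (G nu' r - al' * Y nu' r) =
    (G mu' r - G nu' r) - al' * (Y mu' r - Y nu' r) by ring.
  apply: le_trans (ler_normB _ _) _.
  rewrite normrM (gtr0_norm al'0).
  have h3 := ler_wpM2l (ltW al'0) h2.
  apply: le_trans (lerD h1 h3) _.
  have -> : M / eps * `|mu' - nu'| * k + al' * (M / eps * `|mu' - nu'| * k) =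
    (1 + al') * (M / eps * k) * `|mu' - nu'| by ring.
  rewrite ler_wpM2l// mulr_ge0//; first by rewrite addr_ge0// ltW.
  by rewrite mulr_ge0 ?expR_ge0// divr_ge0.
have Phi0 : 0 <= Phi 0.
  rewrite /Phi clip_id ?lexx ?(ltW M10)//.
  have F00 p : F 0 p (G 0 (cl p)) = 0 by rewrite /F !mul0r.
  have Y0 x : l <= x -> Y 0 x = - 1.
    move=> lx; rewrite -(Yl 0)//.
    by apply: (@is_derive_cst_on _ (fun p => F 0 p (G 0 (cl p)))) => // p; exact: dY.
  rewrite Y0 ?(ltW lr)// mulrN1 opprK addr_ge0 ?(ltW al'0)//.
  suff : G 0 l <= G 0 r by rewrite Gl//; apply: le_trans; exact: ltW.
  apply: (@nondecreasing_of_derive _ _ (fun p => - Y 0 p)) => //; first exact: ltW.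
    by move=> x _; exact: dG.
  by move=> x /andP[lx _]; rewrite Y0 ?opprK// ltW.
have PhiM : Phi M1 <= 0.
  rewrite /Phi clip_id ?lexx ?(ltW M10)//.
  have M1' := ltW M10.
  have Gr : G M1 r <= Gm by rewrite Gmax// lexx ltW.
  have Yr : 1 + Gm / al' <= Y M1 r.
    have : Y M1 l - M1 * m / Gm * l <= Y M1 r - M1 * m / Gm * r.
      apply: (@nondecreasing_of_derive _ (fun p => Y M1 p - M1 * m / Gm * p)
        (fun p => F M1 p (G M1 (cl p)) - M1 * m / Gm * 1)); first exact: ltW.
        by move=> p _; apply: is_derive_sub; exact: dY.
      by move=> p _; rewrite mulr1 subr_ge0 Flow.
    rewrite Yl//.
    have -> : M1 * m / Gm = (2 + Gm / al') / (r - l).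
      by rewrite /M1; field; rewrite !gt_eqF.
    suff : (2 + Gm / al') / (r - l) * (r - l) = 2 + Gm / al' by lra.
    by rewrite divfK// gt_eqF.
  have : al' * (1 + Gm / al') <= al' * Y M1 r by rewrite ler_pM2l.
  rewrite mulrDr mulr1 [al' * (_ / _)]mulrC divfK ?gt_eqF//.
  by lra.
have [mu mu01 Phimu] : exists2 mu, 0 <= mu <= M1 & Phi mu = 0.
  have [||mu] := @IVT R Phi 0 M1 0 (ltW M10).
  - exact: continuous_subspaceT.
  - by rewrite ge_min le_max PhiM Phi0 orbT.
  - by rewrite in_itv/=; exists mu.
have mu0 : 0 <= mu by case/andP: mu01.
move: Phimu; rewrite /Phi clip_id// => /eqP; rewrite subr_eq0 => /eqP GYr.
(* Concavity of [G mu]: its slope [- Y mu] is nonincreasing, so chords lie between the end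
   tangents. *)
have tangent p q : l <= p -> p < q -> q <= r ->
    Y mu p * (q - p) <= G mu p - G mu q <= Y mu q * (q - p).
  move=> lp pq qr.
  have [|c /andP[pc cq]] := @mean_value R (G mu) (fun x => - Y mu x) p q pq.
    by move=> x _; exact: dG.
  have qp0 : 0 < q - p by rewrite subr_gt0.
  move=> GE; have -> : G mu p - G mu q = Y mu c * (q - p) by lra.
  by rewrite !ler_pM2r// !Ymono// ltW.
have Yr0 : al / (T - l) <= Y mu r.
  rewrite ler_pdivrMr//; have /andP[_] := tangent l r (lexx l) lr (lexx r).
  by rewrite Gl// GYr /al'; lra.
have Yr_gt0 : 0 < Y mu r by apply: lt_le_trans Yr0; rewrite divr_gt0.
have Gr_eps : eps <= G mu r.
  by rewrite GYr /eps [al * al']mulrC -mulrA ler_pM2l.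
(* As long as [Y mu] is negative, [G mu] is at least its left end value; once [Y mu] is nonnegative,
   it is at least its right end value. Both are at least [eps]. *)
have Geps p : l <= p <= r -> eps <= G mu p.
  move=> /andP[lp pr]; have [Yp|Yp] := ltP (Y mu p) 0.
    apply: le_trans eal _; rewrite -(Gl mu)//.
    move: lp; rewrite le_eqVlt => /predU1P[<-//|lp].
    have /andP[_] := tangent l p (lexx l) lp pr.
    have : Y mu p * (p - l) <= 0 by rewrite nmulr_rle0// subr_ge0 ltW.
    by lra.
  apply: le_trans Gr_eps _.
  move: pr; rewrite le_eqVlt => /predU1P[->//|pr].
  have /andP[+ _] := tangent p r lp pr (lexx r).
  have : 0 <= Y mu p * (r - p) by rewrite mulr_ge0// subr_ge0 ltW.
  by lra.
have mu_gt0 : 0 < mu.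
  rewrite lt_neqAle mu0 andbT; apply/eqP => mu_eq.
  have : Y mu r = - 1.
    rewrite -(Yl mu)//; apply: (@is_derive_cst_on _ (fun p => F mu p (G mu (cl p)))).
    - exact: ltW.
    - by move=> p; exact: dY.
    - by move=> p; rewrite /F -mu_eq !mul0r.
  by move: Yr_gt0; lra.
(* Both end conditions are homogeneous in [(g, y)], while [g * y'] is quadratic and gets multiplied
   by [la ^+ 2 = 1 / mu]. *)
pose la := (Num.sqrt mu)^-1.
have la0 : 0 < la by rewrite invr_gt0 sqrtr_gt0.
have lamu : la * mu = la^-1.
  by rewrite /la invrK -{2}[mu]sqr_sqrtr// expr2 mulKf// gt_eqF// sqrtr_gt0.
exists (fun p => la * G mu p), (fun p => la * Y mu p),
  (fun p => la * F mu p (G mu (cl p))); split.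
- by move=> p; rewrite -mulrN; apply: is_derive_mull; exact: dG.
- by move=> p; apply: is_derive_mull; exact: dY.
- split.
    have cG : continuous (G mu).
      by move=> p; apply: (@is_derive_continuous _ _ _ (- Y mu p)); exact: dG.
    move=> p; apply: cvgM; first exact: cvg_cst.
    apply: (cF mu (fun p => G mu (cl p))) => q.
    by apply: continuous_comp; [exact: clip_continuous (ltW lr) q|exact: cG].
  exists (la * (mu * m / Gm)); first by rewrite mulr_gt0// divr_gt0// mulr_gt0.
  by move=> p; rewrite ler_pM2l// Flow.
- move=> p plr; have Gp : 0 < G mu p by apply: lt_le_trans (Geps p plr).
  split; first by rewrite mulr_gt0.
  rewrite /F /A1 clE// /mx ltNge Geps//=.
  have -> : la * (mu * A p / G mu p) = la * mu * (A p / G mu p) by ring.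
  by rewrite lamu invfM mulrCA.
- rewrite !pmulr_rgt0// Yl// mulrN1 oppr_lt0 la0; split=> //.
    by rewrite Gl// /al; ring.
  by rewrite GYr /al'; ring.
Qed.
End Shooting.

(** * The self-similar profile *)

Section Profile.
Context {R : realType}.

(* [phi] is the profile of the self-similar solution
   [sqrt t * phi (x / sqrt t)] with free boundaries [- P * sqrt t] and
   [Q * sqrt t], extended linearly outside [- P, Q].  Its derivative [phi']
   coincides on [- P, Q] with the smooth function [psi]. *)
Record profile (a : R -> R) (T l r P Q : R) (phi phi' psi psi' : R -> R) : Prop :=
  Profile {
  profile_slopes : [/\ - T < l, l < r & r < T] ;
  profile_PQ : 0 < P /\ 0 < Q ;
  profile_derive : forall s : R, is_derive s 1 phi (phi' s) ;
  profile_continuous' : continuous phi' ;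
  profile_derive2 : forall s : R, is_derive s 1 psi (psi' s) ;
  profile_psi'_continuous : continuous psi' ;
  profile_psiE : forall s, - P <= s <= Q -> phi' s = psi s ;
  profile_left : forall s, s <= - P -> phi' s = l ;
  profile_right : forall s, Q <= s -> phi' s = r ;
  profile_range : forall s, l <= phi' s <= r ;
  profile_eqn : forall s, - P <= s <= Q ->
    0 < psi' s /\ a (phi' s) * psi' s = (phi s - s * phi' s) / 2 ;
  profile_bounds : exists g0 g1, 0 < g0 /\
    forall s, g0 <= phi s - s * phi' s <= g1 ;
  profile_ends : phi (- P) = T * P /\ phi Q = T * Q
}.

(** The bound [c <= y'] gives at least linear growth, hence surjectivity by the intermediate value
    theorem, and keeps [y'] away from zero, so that the inverse is differentiable. *)
Lemma inverse_of_increasing (y y' : R -> R) (c : R) : 0 < c ->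
  (forall p : R, is_derive p 1 y (y' p)) -> (forall p, c <= y' p) ->
  exists psi : R -> R, [/\ cancel psi y, cancel y psi,
    {mono y : p q / p <= q} &
    forall s : R, is_derive s 1 psi (y' (psi s))^-1].
Proof.
move=> c0 dy y'c.
have cy : continuous y by move=> p; apply: is_derive_continuous (dy p).
have ylt p q : p < q -> y p + c * (q - p) <= y q.
  move=> pq; have : y p - c * p <= y q - c * q.
    apply: (@nondecreasing_of_derive _ (fun x => y x - c * x) (fun x => y' x - c * 1)).
    - exact: ltW.
    - by move=> x _; rewrite mulr1 subr_ge0.
  by lra.
have yinc : {homo y : p q / p < q}.
  move=> p q pq; apply: lt_le_trans (ylt _ _ pq).
  by rewrite ltrDl mulr_gt0// subr_gt0.
have ymono := le_mono yinc.
have /choice[psi psiK] : forall s, exists p, y p = s.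
  move=> s; pose d := (`|s - y 0| + 1) / c.
  have d0 : 0 < d by rewrite divr_gt0// ltr_wpDl.
  have cd : c * d = `|s - y 0| + 1 by rewrite /d mulrC divfK// gt_eqF.
  have h1 : s <= y d.
    have := ylt 0 d d0; rewrite subr0 cd; have := ler_norm (s - y 0); lra.
  have h2 : y (- d) <= s.
    have := ylt (- d) 0; rewrite oppr_lt0 sub0r opprK cd => /(_ d0).
    by have := ler_norm (- (s - y 0)); rewrite normrN; lra.
  have [|||p _ pE] := @IVT R y (- d) d s.
  - by move: d0; lra.
  - exact: continuous_subspaceT.
  - by rewrite ge_min le_max h1 h2 orbT.
  - by exists p.
have yK : cancel y psi.
  by move=> p; apply: (inc_inj ymono); rewrite psiK.
exists psi; split=> // s.
rewrite -{1}[s]psiK; apply: is_derive_inverse; [by near=> z; exact: yK|by near=> z; exact: cy|].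
by rewrite gt_eqF// (lt_le_trans c0).
Unshelve. all: by end_near. Qed.

(** The subgradient inequalities at [s] and at [z] squeeze the difference quotient between [phi' s]
    and [phi' z]; continuity of [phi'] at [s] concludes. *)
Lemma is_derive_of_slopes (phi phi' : R -> R) (s : R) :
  (forall u v, phi u + (v - u) * phi' u <= phi v) ->
  {for s, continuous phi'} -> is_derive s 1 phi (phi' s).
Proof.
move=> sub cphi'.
pose q z := if z == s then phi' s else (phi z - phi s) / (z - s).
apply/is_derive1_caratheodory; exists q; split; last by rewrite /q eqxx.
  move=> z; rewrite /q; case: eqP => [->|/eqP zs]; first by rewrite !subrr mulr0.
  by rewrite divfK// subr_eq0.
have qE z : `|q z - phi' s| <= `|phi' z - phi' s|.
  rewrite /q; case: eqP => [_|/eqP zs]; first by rewrite subrr normr0.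
  have := sub z s; have := sub s z.
  have zs0 : z - s != 0 by rewrite subr_eq0.
  set d := (phi z - phi s) / (z - s).
  have -> : phi z = phi s + d * (z - s) by rewrite /d divfK//; ring.
  case: (ltgtP z s) zs => // zs _ h1 h2.
    rewrite ler0_norm ?[`|phi' z - _|]ler0_norm; nra.
  rewrite ger0_norm ?[`|phi' z - _|]ger0_norm; nra.
apply/cvgrPdist_lt => e e0.
have := cphi'; move/cvgrPdist_lt => /(_ e e0); apply: filterS => z h.
rewrite /q eqxx -/(q z) distrC; apply: le_lt_trans (qE z) _.
by rewrite distrC.
Qed.

(** The profile is recovered as [phi s], the maximum of [g p + s * p] over [[l, r]]. The derivative
    [s - y p] in [p] shows that it is attained at [pi s], the solution [psi s] of [y p = s] clipped
    to [[l, r]]. Thus [pi] is a subgradient of [phi], and the clipping produces the linear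
    extension. The coefficient [2 * a] absorbs the factor [1 / 2] of the profile equation, as
    [psi' = 1 / y' = g / (2 a)]. *)
Lemma profile_exists (a : R -> R) (T l r : R) : continuous a ->
  (forall p, 0 < a p) -> - T < l -> l < r -> r < T ->
  exists P Q phi phi' psi psi', profile a T l r P Q phi phi' psi psi'.
Proof.
move=> ca a0 Tl lr rT.
have [||g [y [y' [dg dy [cy' [c c0 y'c]] gE [yl yr gl gr]]]]] :=
    @legendre_profile R (fun p => 2 * a p) T l r _ _ Tl lr rT.
- by move=> p; apply: cvgM; [exact: cvg_cst|exact: ca].
- by move=> p; rewrite mulr_gt0.
have [psi [psiK yK ymono dpsi]] := inverse_of_increasing c0 dy y'c.
have cpsi : continuous psi by move=> s; apply: is_derive_continuous (dpsi s).
have psiy s p : (psi s <= p) = (s <= y p) by rewrite -ymono psiK.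
have ypsi s p : (p <= psi s) = (y p <= s) by rewrite -ymono psiK.
pose pi s := clip l r (psi s).
have piI s : l <= pi s <= r by apply: clip_itv; exact: ltW.
pose phi s := g (pi s) + s * pi s.
have cpi : continuous pi.
  by move=> s; apply: continuous_comp; [exact: cpsi|exact: clip_continuous (ltW lr) _].
have env p s : l <= p <= r -> g p + s * p <= phi s.
  move=> /andP[lp pr]; rewrite /phi.
  have df (x : R) : is_derive x 1 (fun p => g p + s * p) (- y x + s * 1).
    by apply: is_derive_add; exact: dg.
  have [ppi|pip|<-//] := ltgtP p (pi s).
    apply: nondecreasing_of_derive (ltW ppi) (fun x _ => df x) _ => x /andP[px xpi].
    suff : y x <= s by lra.
    rewrite -ypsi; move: ppi xpi px; rewrite /pi /clip.
    by case: (ltP (psi s) l) => ?; [|case: (ltP r (psi s)) => ?]; lra.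
  rewrite -lerN2.
  apply: (@nondecreasing_of_derive _ (fun x => - (g x + s * x))
    (fun x => - (- y x + s * 1))) (ltW pip) _ _ => x /andP[px xpi].
  suff : s <= y x by lra.
  rewrite -psiy; move: pip xpi px; rewrite /pi /clip.
  by case: (ltP (psi s) l) => ?; [|case: (ltP r (psi s)) => ?]; lra.
have phiE s : phi s - s * pi s = g (pi s) by rewrite /phi addrK.
have psil s : s <= y l -> pi s = l.
  rewrite -psiy /pi /clip => ?; case: ltP => //; case: ltP => ? ?; lra.
have psir s : y r <= s -> pi s = r.
  rewrite -ypsi /pi /clip => ?; case: ltP => ?; [|case: ltP => ?]; lra.
have psilr s : y l <= s <= y r -> pi s = psi s.
  by rewrite -psiy -ypsi => ?; rewrite /pi clip_id.
exists (- y l), (y r), phi, pi, psi, (fun s => (y' (psi s))^-1); split => //.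
- by rewrite oppr_gt0; split.
- move=> s; apply: is_derive_of_slopes (cpi s) => u v.
  have := env (pi u) v (piI u); rewrite /phi; lra.
- move=> s; apply: cvgV; first by rewrite gt_eqF// (lt_le_trans c0).
  by apply: continuous_comp; [exact: cpsi|exact: cy'].
- by rewrite opprK.
- by rewrite opprK.
- rewrite opprK => s slr; rewrite invr_gt0 (lt_le_trans c0)//; split => //.
  have := piI s => /gE[g0 y'E]; rewrite phiE -psilr// y'E.
  by field; rewrite !gt_eqF.
- have cg : continuous g by move=> p; apply: is_derive_continuous (dg p).
  have [|p0 p0I p0E] := @EVT_min R g l r (ltW lr); first exact: continuous_subspaceT.
  have [|p1 _ p1E] := @EVT_max R g l r (ltW lr); first exact: continuous_subspaceT.
  exists (g p0), (g p1); split; first by have [] := gE _ p0I.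
  by move=> s; rewrite phiE (p0E _ (piI s)) (p1E _ (piI s)).
- by rewrite opprK /phi psil// psir// gl gr; split; ring.
Qed.

Section theory.
Variables (a : R -> R) (T l r P Q : R) (phi phi' psi psi' : R -> R).
Hypothesis pf : profile a T l r P Q phi phi' psi psi'.

Lemma profile_T_gt0 : 0 < T.
Proof. by have [? ? ?] := profile_slopes pf; lra. Qed.

Lemma profile_continuous : continuous phi.
Proof. by move=> s; apply: is_derive_continuous (profile_derive pf s). Qed.

Lemma profile_slope (u v : R) : u <= v ->
  l * (v - u) <= phi v - phi u <= r * (v - u).
Proof.
rewrite le_eqVlt => /predU1P[->|uv]; first by rewrite !subrr !mulr0 lexx.
have [c _ ->] := mean_value uv (fun x _ => profile_derive pf x).
by rewrite !ler_pM2r ?subr_gt0// (profile_range pf).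
Qed.

Lemma profile_lipschitz (u v : R) : `|phi u - phi v| <= T * `|u - v|.
Proof.
have [Tl lr rT] := profile_slopes pf.
wlog uv : u v / v <= u => [H|].
  by case/orP: (le_total v u) => /H //; rewrite distrC [`|v - u|]distrC.
have /andP[h1 h2] := profile_slope uv.
by rewrite [`|u - v|]ger0_norm ?subr_ge0// ler_norml; apply/andP; split; nra.
Qed.

(* The cone [|s| T <= phi s] is met exactly on [- P, Q]. *)
Lemma profile_le_right (s : R) : Q <= s -> phi s <= T * s - (T - r) * (s - Q).
Proof.
move=> /profile_slope /andP[_]; have [_ ->] := profile_ends pf; lra.
Qed.

Lemma profile_ge_right (s : R) : s <= Q -> T * s + (T - r) * (Q - s) <= phi s.
Proof.
move=> /profile_slope /andP[_]; have [_ ->] := profile_ends pf; lra.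
Qed.

Lemma profile_le_left (s : R) : s <= - P -> phi s <= - T * s - (T + l) * (- P - s).
Proof.
move=> /profile_slope /andP[+ _]; have [-> _] := profile_ends pf; lra.
Qed.

Lemma profile_ge_left (s : R) : - P <= s -> - T * s + (T + l) * (s + P) <= phi s.
Proof.
move=> /profile_slope /andP[+ _]; have [-> _] := profile_ends pf; lra.
Qed.

Lemma profile_gt0 (s : R) : - P <= s <= Q -> 0 < phi s.
Proof.
move=> /andP[Ps sQ]; have h1 := profile_ge_left Ps; have h2 := profile_ge_right sQ.
have [P0 Q0] := profile_PQ pf; have [Tl lr rT] := profile_slopes pf.
have T0 := profile_T_gt0.
have [s0|s0] := ltP s 0.
  apply: lt_le_trans h1; rewrite ltr_wpDr// ?mulNr ?oppr_gt0 ?pmulr_rlt0//.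
  by rewrite mulr_ge0//; lra.
apply: lt_le_trans h2; move: s0; rewrite le_eqVlt => /predU1P[<-|s0].
  by rewrite mulr0 add0r subr0 mulr_gt0// subr_gt0.
by rewrite ltr_wpDr ?mulr_gt0// mulr_ge0//; lra.
Qed.

End theory.
End Profile.

(** * First and second order conditions at a contact point *)

Section WithinContinuity.
Context {T U V : topologicalType}.

Lemma within_comp (A : set U) (B : set T) (f : U -> V) (g : T -> U) :
  {within A, continuous f} -> {within B, continuous g} ->
  (forall z, B z -> A (g z)) -> {within B, continuous (fun z => f (g z))}.
Proof.
move=> /subspace_continuousP cf /subspace_continuousP cg BA.
apply/subspace_continuousP => z Bz W /(cf _ (BA _ Bz)) fW.
have := cg z Bz _ fW => H; have : nbhs z [set x | B x -> A (g x) -> W (f (g x))] := H.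
by apply: filterS => x h Bx; exact: (h Bx (BA _ Bx)).
Qed.

Lemma continuous_comp_within (A : set U) (f : U -> V) (g : T -> U) :
  {within A, continuous f} -> continuous g ->
  (forall z, A (g z)) -> continuous (fun z => f (g z)).
Proof.
move=> cf cg gA; apply/continuous_subspace_setT.
apply: (@within_comp A setT) => //; exact: continuous_subspaceT.
Qed.

End WithinContinuity.

Section Touching.
Context {R : realType}.

Lemma is_derive_gt0_near (f : R -> R) (x c : R) : is_derive x 1 f c -> 0 < c ->
  \forall y \near x, (x < y -> f x < f y) /\ (y < x -> f y < f x).
Proof.
move=> /is_derive1_caratheodory[h [fE ch hx]] c0.
have hx0 : 0 < h x by rewrite hx.
have : \forall y \near x, 0 < h y by exact: (cvgr_gt (h x) ch _ hx0).
apply: filterS => y hy; split=> xy.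
  by rewrite -subr_gt0 fE mulr_gt0// subr_gt0.
by rewrite -subr_lt0 fE pmulr_rlt0// subr_lt0.
Qed.

Lemma near_exists_lt (x : R) (A : set R) : (\forall y \near x, A y) ->
  exists2 d, 0 < d & forall y, `|y - x| <= d -> A y.
Proof.
move=> /nbhs_ballP[e /= e0 eA]; exists (e / 2); first by rewrite divr_gt0.
move=> y yx; apply: eA; rewrite /ball/= distrC (le_lt_trans yx)//.
by rewrite ltr_pdivrMr// ltr_pMr// ltr1n.
Qed.

Lemma is_derive_local_max (f : R -> R) (x c : R) : is_derive x 1 f c ->
  (\forall y \near x, f y <= f x) -> c = 0.
Proof.
move=> df fx.
have [c0|c0|//] := ltgtP c 0.
- have c0' : 0 < - c by rewrite oppr_gt0.
  have [d d0 H] := near_exists_lt (filterI fx (is_derive_gt0_near (is_derive_opp df) c0')).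
  have [|fd [_]] := H (x - d); first by rewrite addrAC subrr add0r normrN gtr0_norm.
  by rewrite ltrN2 ltrBlDr ltrDl d0 ltNge fd => /(_ isT).
- have [d d0 H] := near_exists_lt (filterI fx (is_derive_gt0_near df c0)).
  have [|fd [+ _]] := H (x + d); first by rewrite addrAC subrr add0r gtr0_norm.
  by rewrite ltrDl d0 ltNge fd => /(_ isT).
Qed.

(** If [c] were positive, then on the side where [f1] agrees with [G] the function [f] would
    strictly increase away from its maximum. One side is enough, and at a junction of the profile
    with its linear extension only one side is available. *)
Lemma touching_second_order (f f1 G : R -> R) (x c : R) :
  (\forall y \near x, is_derive (y : R) 1 f (f1 y)) ->
  (\forall y \near x, f y <= f x) -> is_derive x 1 G c ->
  (\forall y \near x, x <= y -> f1 y = G y) \/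
  (\forall y \near x, y <= x -> f1 y = G y) -> f1 x = 0 /\ c <= 0.
Proof.
move=> df fx dG fG.
have f1x : f1 x = 0 by apply: is_derive_local_max fx; exact: nbhs_singleton df.
split=> //; rewrite leNgt; apply/negP => c0.
have := is_derive_gt0_near dG c0; move: fG => [] fG Gpos.
- have [d d0 H] := near_exists_lt (filterI (filterI df fx) (filterI fG Gpos)).
  have Gx : G x = 0.
    by have [|_ [<- // _]] := H x; rewrite subrr normr0 ltW.
  have xd : x < x + d by rewrite ltrDl.
  have dist y : x <= y <= x + d -> `|y - x| <= d.
    by move=> /andP[? ?]; rewrite ger0_norm; lra.
  have : f x < f (x + d).
    apply: (@increasing_of_derive _ f f1) => // [y /dist/H[[]]//|y /andP[xy yd]].
    have [|_ [/(_ (ltW xy)) -> [+ _]]] := H y; first by apply: dist; rewrite !ltW.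
    by rewrite Gx; apply.
  have [|[_ fd] _] := H (x + d); last by rewrite ltNge fd.
  by apply: dist; rewrite lexx andbT ltW.
- have [d d0 H] := near_exists_lt (filterI (filterI df fx) (filterI fG Gpos)).
  have Gx : G x = 0.
    by have [|_ [<- // _]] := H x; rewrite subrr normr0 ltW.
  have xd : x - d < x by rewrite ltrBlDr ltrDl.
  have dist y : x - d <= y <= x -> `|y - x| <= d.
    by move=> /andP[? ?]; rewrite ler0_norm; lra.
  have : - f (x - d) < - f x.
    apply: (@increasing_of_derive _ (fun y => - f y) (fun y => - f1 y)) => //.
      by move=> y /dist/H[[? _] _]; exact: is_derive_opp.
    move=> y /andP[xy yd].
    have [|_ [/(_ (ltW yd)) -> [_ +]]] := H y; first by apply: dist; rewrite !ltW.
    by rewrite Gx oppr_gt0; apply.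
  rewrite ltrN2; have [|[_ fd] _] := H (x - d); last by rewrite ltNge fd.
  by apply: dist; rewrite lexx ltW.
Qed.

(** Only earlier times are compared, which is all that a first contact provides. *)
Lemma touching_first_order (f : R -> R) (t c : R) : is_derive t 1 f c ->
  (\forall s \near t, s <= t -> f s <= f t) -> 0 <= c.
Proof.
move=> df ft; rewrite leNgt; apply/negP => c0.
have c0' : 0 < - c by rewrite oppr_gt0.
have [d d0 H] := near_exists_lt (filterI ft (is_derive_gt0_near (is_derive_opp df) c0')).
have [|h [_ +]] := H (t - d); first by rewrite addrAC subrr add0r normrN gtr0_norm.
have td : t - d < t by rewrite ltrBlDr ltrDl.
by move=> /(_ td); rewrite ltrN2 ltNge h// ltW.
Qed.

(** Here [f1 b] is a limit of interior derivatives. If it were negative, so would be [f1] near [b],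
    and the mean value theorem would give a value of [f] above [f b]. *)
Lemma touching_right_end (f f1 : R -> R) (a b : R) : a < b ->
  {within `[a, b], continuous f} -> {within `[a, b], continuous f1} ->
  (forall x : R, a < x < b -> is_derive x 1 f (f1 x)) ->
  (forall x, a <= x <= b -> f x <= f b) -> 0 <= f1 b.
Proof.
move=> ab cf cf1 df fb; rewrite leNgt; apply/negP => f1b.
have bI : `[a, b]%classic b by rewrite /= in_itv/= lexx ltW.
have : \forall x \near b, `[a, b]%classic x -> f1 x < 0.
  move/subspace_continuousP : cf1 => /(_ b bI) cf1.
  exact: (cvgr_lt (f1 b) cf1 _ f1b).
move=> /near_exists_lt[d d0 H].
pose y := Order.max a (b - d).
have yb : y < b by rewrite gt_max ab ltrBlDr ltrDl.
have ay : a <= y by rewrite le_max lexx.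
have dy : b - d <= y by rewrite le_max lexx orbT.
have [|x xyb|c] := @MVT R f f1 y b yb.
- by move=> x /[!in_itv]/= /andP[yx xb]; apply: df; rewrite xb (le_lt_trans ay).
- move: x xyb; apply: continuous_subspaceW cf => x /=.
  by rewrite !in_itv/= => /andP[yx ->]; rewrite (le_trans ay).
rewrite in_itv/= => /andP[yc cb] fE.
have f1c : f1 c < 0.
  apply: H; first by rewrite ler0_norm; lra.
  by rewrite /= in_itv/= (ltW cb) (le_trans ay (ltW yc)).
have : f b - f y < 0 by rewrite fE nmulr_rlt0// subr_gt0.
have : f y <= f b by apply: fb; rewrite ay ltW.
by lra.
Qed.

Lemma touching_left_end (f f1 : R -> R) (a b : R) : a < b ->
  {within `[a, b], continuous f} -> {within `[a, b], continuous f1} ->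
  (forall x : R, a < x < b -> is_derive x 1 f (f1 x)) ->
  (forall x, a <= x <= b -> f x <= f a) -> f1 a <= 0.
Proof.
move=> ab cf cf1 df fa.
have maps z : `[- b, - a]%classic z -> `[a, b]%classic (- z).
  by rewrite /= !in_itv/= lerNr lerNl andbC.
have cN : {within `[- b, - a], continuous (fun z : R => - z)}.
  by apply: continuous_subspaceT => x; exact: opp_continuous.
have := @touching_right_end (fun x => f (- x)) (fun x => - f1 (- x)) (- b) (- a).
rewrite ltrN2 opprK oppr_ge0; apply => //.
- exact: within_comp cN maps.
- apply: (within_comp (A := setT) (g := fun x => f1 (- x)) (f := -%R)) => //.
  + by apply: continuous_subspaceT => x; exact: opp_continuous.
  + exact: within_comp cN maps.
- move=> x xab; rewrite -mulrN1; apply: (@is_derive_comp _ f (fun x => - x)).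
  by apply: df; rewrite ltrNr ltrNl andbC.
- by move=> x xab; apply: fa; rewrite lerNr lerNl andbC.
Qed.

End Touching.

(** * Comparison with strict barriers *)

Lemma near_gt0 {R : realType} {T : topologicalType} (h : T -> R) (z : T) :
  {for z, continuous h} -> 0 < h z -> \forall y \near z, 0 < h y.
Proof. by move=> ch hz; exact: (cvgr_gt (h z) ch _ hz). Qed.

Lemma within_scaled_difference {R : realType} {T : topologicalType} (A : set T)
    (c : R) (f g : T -> R) :
  {within A, continuous f} -> {within A, continuous g} ->
  {within A, continuous (fun z => c * (f z - g z))}.
Proof.
move=> cf cg z; apply: cvgM; first exact: cvg_cst.
by apply: cvgB; [exact: cf|exact: cg].
Qed.

Section FirstTouch.
Context {R : realType}.

Definition slab (xi1 xi2 : R -> R) (t0 t1 : R) : set (R * R) :=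
  [set p | t0 <= p.2 <= t1 /\ - xi1 p.2 <= p.1 <= xi2 p.2].

(** If [f] became nonnegative, the points of the straightened rectangle where it is so would form a
    nonempty compact set; one of least time is a first contact. *)
Lemma first_touch (xi1 xi2 : R -> R) (t0 t1 : R) (f : R * R -> R) : t0 <= t1 ->
  {within `[t0, t1], continuous xi1} -> {within `[t0, t1], continuous xi2} ->
  (forall t, t0 <= t <= t1 -> 0 < xi1 t /\ 0 < xi2 t) ->
  {within slab xi1 xi2 t0 t1, continuous f} ->
  (forall x, - xi1 t0 <= x <= xi2 t0 -> f (x, t0) < 0) ->
  (forall p, slab xi1 xi2 t0 t1 p -> t0 < p.2 -> f p = 0 ->
    (forall q, slab xi1 xi2 t0 t1 q -> q.2 <= p.2 -> f q <= 0) -> False) ->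
  forall p, slab xi1 xi2 t0 t1 p -> f p < 0.
Proof.
move=> t01 cxi1 cxi2 xi_gt0 cf f0 nocontact.
pose ct := clip t0 t1.
have ctI t : `[t0, t1]%classic (ct t) by rewrite /= in_itv/=; exact: clip_itv.
have cct : continuous ct by exact: clip_continuous.
have cx1 : continuous (fun t => xi1 (ct t)) by exact: (continuous_comp_within cxi1 cct ctI).
have cx2 : continuous (fun t => xi2 (ct t)) by exact: continuous_comp_within cxi2 cct ctI.
pose c01 := clip (0 : R) 1.
have c01I s : 0 <= c01 s <= 1 by exact: clip_itv ler01 _.
(* straightens the slab into the rectangle [0, 1] x [t0, t1] *)
pose m (z : R * R) : R * R :=
  (- xi1 (ct z.2) + c01 z.1 * (xi1 (ct z.2) + xi2 (ct z.2)), ct z.2).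
have cc2 (h : R -> R) : continuous h -> continuous (fun z : R * R => h z.2).
  by move=> ch z; apply: continuous_comp; [exact: cvg_snd|exact: ch].
have cc1 (h : R -> R) : continuous h -> continuous (fun z : R * R => h z.1).
  by move=> ch z; apply: continuous_comp; [exact: cvg_fst|exact: ch].
have cm : continuous m.
  have c1 : continuous (fun z : R * R =>
      - xi1 (ct z.2) + c01 z.1 * (xi1 (ct z.2) + xi2 (ct z.2))).
    move=> z; apply: cvgD; first by apply: cvgN; exact: (cc2 _ cx1 z).
    apply: cvgM; first exact: (cc1 _ (clip_continuous ler01) z).
    by apply: cvgD; [exact: (cc2 _ cx1 z)|exact: (cc2 _ cx2 z)].
  by move=> z; exact: (cvg_pair (c1 z) (cc2 _ cct z)).
have mD z : slab xi1 xi2 t0 t1 (m z).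
  split; first exact: clip_itv.
  have [x1 x2] := xi_gt0 _ (ctI z.2); have /andP[s0 s1] := c01I z.1.
  by apply/andP; split; rewrite /=; nra.
pose F z := f (m z).
have cF : continuous F by exact: continuous_comp_within cf cm mD.
have mE p : slab xi1 xi2 t0 t1 p -> exists2 s, 0 <= s <= 1 & m (s, p.2) = p.
  case: p => x t [/= tI xI]; have [x1 x2] := xi_gt0 t tI.
  have w0 : 0 < xi1 t + xi2 t by rewrite addr_gt0.
  have s01 : 0 <= (x + xi1 t) / (xi1 t + xi2 t) <= 1.
    case/andP: xI => xa xb; apply/andP; split.
      by apply: divr_ge0; [lra|exact: ltW].
    by rewrite ler_pdivrMr// mul1r; lra.
  exists ((x + xi1 t) / (xi1 t + xi2 t)) => //.
  rewrite /m /= /c01 /ct (clip_id tI) (clip_id s01) divfK ?gt_eqF//.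
  by congr (_, _); ring.
move=> p pD; rewrite ltNge; apply/negP => fp.
pose S := `[0 : R, 1]%classic `*` `[t0, t1]%classic.
pose K := S `&` [set z | 0 <= F z].
have cK : compact K.
  apply: compact_closedI.
    by apply: compact_setX; exact: segment_compact.
  apply: (@preimage_closed _ _ F [set y : R | 0 <= y]); last exact: closed_ge.
  by move=> z _; exact: cF.
have K0 : K !=set0.
  have [s s01 sp] := mE p pD; exists (s, p.2); split.
    by split; rewrite /= in_itv//=; case: pD.
  by rewrite /= /F sp.
have [|z zK zmin] := @compact_EVT_min _ R (fun z : R * R => z.2) K K0 cK.
  by apply: continuous_subspaceT => z; exact: cvg_snd.
move: zK; rewrite inE => -[[/= z1I z2I] Fz].
rewrite in_itv/= in z1I; rewrite in_itv/= in z2I.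
have early q : slab xi1 xi2 t0 t1 q -> q.2 < z.2 -> f q < 0.
  move=> qD qz; rewrite ltNge; apply/negP => fq.
  have [s s01 sq] := mE q qD.
  have : (s, q.2) \in K.
    rewrite inE; split; last by rewrite /= /F sq.
    by split; rewrite /= in_itv//=; case: qD.
  by move=> /zmin /=; rewrite leNgt qz.
have z2t0 : t0 < z.2.
  case/andP: z2I; rewrite le_eqVlt => /predU1P[t0z|//] _.
  have := mD z; rewrite /slab/= => -[_]; have ctz : ct z.2 = t0.
    by rewrite -t0z; apply: clip_id; rewrite lexx.
  rewrite ctz => /f0; have -> : (- xi1 t0 + c01 z.1 * (xi1 t0 + xi2 t0), t0) = m z.
    by rewrite /m ctz.
  by rewrite ltNge Fz.
(* Points at the contact time itself are reached from earlier times along curves of constant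
   straightened abscissa [s]; a line of constant [x] could leave the slab. *)
have upto q : slab xi1 xi2 t0 t1 q -> q.2 <= z.2 -> f q <= 0.
  move=> qD; rewrite le_eqVlt => /predU1P[qz|/early-/(_ qD)/ltW//].
  have [s s01 sq] := mE q qD; rewrite leNgt; apply/negP => fq.
  have ch : continuous (fun t => F (s, t)).
    have cp : continuous (fun t : R => (s, t)).
      by move=> t; exact: (cvg_pair (cvg_cst s) cvg_id).
    by move=> t; apply: continuous_comp; [exact: cp|exact: cF].
  have Fs0 : 0 < F (s, z.2) by rewrite /F -qz sq.
  have : \forall t \near z.2, 0 < F (s, t) by exact: (cvgr_gt (F (s, z.2)) (ch z.2) _ Fs0).
  move=> /near_exists_lt[d d0 H].
  pose t := Order.max t0 (z.2 - d).
  have t0t : t0 <= t by rewrite le_max lexx.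
  have dt : z.2 - d <= t by rewrite le_max lexx orbT.
  have tz : t < z.2 by rewrite gt_max z2t0 ltrBlDr ltrDl.
  have := H t; rewrite ler0_norm; last lra.
  have ctt : ct t = t by apply: clip_id; rewrite t0t (le_trans (ltW tz))//; case/andP: z2I.
  have := early (m (s, t)) (mD _); rewrite /= ctt => /(_ tz) Ft.
  have h : - (t - z.2) <= d by lra.
  by move=> /(_ h); rewrite /F ltNge ltW.
have mz2 : (m z).2 = z.2 by apply: clip_id.
apply: (nocontact (m z) (mD z)); rewrite ?mz2//.
by apply/eqP; rewrite eq_le; apply/andP; split; [apply: upto; rewrite ?mz2|].
Qed.

End FirstTouch.

Section Comparison.
Context {R : realType}.

(** Continuity of the free boundaries makes every point strictly between them interior to [Qlat], so
    the partial derivatives are genuine there. *)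
Lemma solution_interior (beta : R) (a : R -> R) (k1 k2 : R * R -> R) (l r : R)
    (u : R * R -> R) (xi1 xi2 : R -> R) :
  (forall t v : R, 0 <= t -> 0 <= v -> k1 (t, v) = - l) ->
  (forall t v : R, 0 <= t -> 0 <= v -> k2 (t, v) = r) ->
  solution beta a k1 k2 u xi1 xi2 ->
  exists ux uxx ut : R * R -> R,
    [/\ {within Qlat xi1 xi2, continuous ux},
      forall x t : R, 0 < t -> - xi1 t < x < xi2 t ->
      [/\ is_derive x 1 (fun y : R => u (y, t)) (ux (x, t)),
          is_derive x 1 (fun y : R => ux (y, t)) (uxx (x, t)),
          is_derive t 1 (fun s : R => u (x, s)) (ut (x, t)) &
          ut (x, t) = a (ux (x, t)) * uxx (x, t)],
      forall t, 0 < t -> ux (- xi1 t, t) = l /\ u (- xi1 t, t) = tan beta * xi1 t &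
      forall t, 0 < t -> ux (xi2 t, t) = r /\ u (xi2 t, t) = tan beta * xi2 t].
Proof.
move=> k1E k2E [xi0 cxi1 cxi2 u0 cu [ux [uxx [ut [[du dux dt] [ueq ul ur]]]]]].
have xi_cont (xi : R -> R) t : C1_pos xi -> 0 < t -> {for t, continuous xi}.
  move=> cxi t0; have [dxi _] := cxi t t0.
  by apply: differentiable_continuous; apply/derivable1_diffP.
have sub (x t : R) : 0 < t -> - xi1 t < x < xi2 t -> (Qlat xi1 xi2)° (x, t).
  move=> t0 /andP[x1 x2].
  have c2 (h : R -> R) : {for t, continuous h} -> {for (x, t), continuous (fun z : R * R => h z.2)}.
    by move=> ch; apply: continuous_comp; [exact: cvg_snd|exact: ch].
  have ct : \forall z \near (x, t), 0 < z.2.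
    by apply: near_gt0 => //; exact: cvg_snd.
  have cx1 : \forall z \near (x, t), 0 < z.1 + xi1 z.2.
    apply: (@near_gt0 _ _ (fun z : R * R => z.1 + xi1 z.2)) => /=; last by lra.
    by apply: cvgD; [exact: cvg_fst|exact: (c2 _ (xi_cont _ _ cxi1 t0))].
  have cx2 : \forall z \near (x, t), 0 < xi2 z.2 - z.1.
    apply: (@near_gt0 _ _ (fun z : R * R => xi2 z.2 - z.1)) => /=; last by lra.
    by apply: cvgB; [exact: (c2 _ (xi_cont _ _ cxi2 t0))|exact: cvg_fst].
  rewrite /interior /=; apply: filterS3 ct cx1 cx2 => z z0 z1 z2.
  by split => //; apply/andP; split; lra.
exists ux, uxx, ut; split.
- by case: du.
- move=> x t t0 xt; have h := sub x t t0 xt; split.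
  + by case: du => _ /(_ _ h).
  + by case: dux => _ /(_ _ h).
  + by case: dt => _ /(_ _ h).
  + by apply: ueq.
- move=> t t0; have [] := ul _ t t0 erefl; rewrite opprK mulrC => -> uE; split => //.
  by rewrite k1E ?opprK ?(ltW t0)//; apply/ltW/u0; split => //=; have [] := xi0 t t0; lra.
- move=> t t0; have [] := ur _ t t0 erefl; rewrite mulrC => -> uE; split => //.
  by rewrite k2E ?(ltW t0)//; apply/ltW/u0; split => //=; have [] := xi0 t t0; lra.
Qed.

(** The sign [sg] treats upper and lower barriers together, and the barrier is tested only where it
    meets [u]. At a first contact on a free boundary, the one-sided extremum contradicts the strict
    inequality between slopes. At an interior contact the slopes agree, [sg * (uxx - zxx) <= 0] and
    [sg * (ut - zt) >= 0], which contradicts the strict differential inequality. *)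
Lemma comparison (beta : R) (a : R -> R) (k1 k2 : R * R -> R) (l r : R)
    (u : R * R -> R) (xi1 xi2 : R -> R) (t0 t1 sg : R) (Z zx zt : R -> R -> R) :
  (forall p, 0 < a p) ->
  (forall t v : R, 0 <= t -> 0 <= v -> k1 (t, v) = - l) ->
  (forall t v : R, 0 <= t -> 0 <= v -> k2 (t, v) = r) ->
  solution beta a k1 k2 u xi1 xi2 ->
  0 <= t0 -> t0 <= t1 -> sg != 0 ->
  {within `[t0, t1], continuous xi1} -> {within `[t0, t1], continuous xi2} ->
  (forall t, t0 <= t <= t1 -> 0 < xi1 t /\ 0 < xi2 t) ->
  {within slab xi1 xi2 t0 t1, continuous u} ->
  {within slab xi1 xi2 t0 t1, continuous (fun p => Z p.1 p.2)} ->
  (forall x t : R, t0 < t -> is_derive x 1 (Z^~ t) (zx x t)) ->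
  (forall t, t0 < t -> continuous (zx^~ t)) ->
  (forall x t : R, t0 < t -> is_derive t 1 (Z x) (zt x t)) ->
  (forall x, - xi1 t0 <= x <= xi2 t0 -> sg * (u (x, t0) - Z x t0) < 0) ->
  (forall x t, t0 < t <= t1 -> - xi1 t < x < xi2 t -> u (x, t) = Z x t ->
    exists (G : R -> R) (zxx : R),
      [/\ is_derive x 1 G zxx,
        (\forall y \near x, x <= y -> zx y t = G y) \/
        (\forall y \near x, y <= x -> zx y t = G y) &
        sg * (a (zx x t) * zxx) < sg * zt x t]) ->
  (forall t, t0 < t <= t1 -> u (- xi1 t, t) = Z (- xi1 t) t ->
    0 < sg * (l - zx (- xi1 t) t)) ->
  (forall t, t0 < t <= t1 -> u (xi2 t, t) = Z (xi2 t) t ->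
    sg * (r - zx (xi2 t) t) < 0) ->
  forall p, slab xi1 xi2 t0 t1 p -> sg * (u p - Z p.1 p.2) < 0.
Proof.
move=> a0 k1E k2E sol t00 t01 sg0 cxi1 cxi2 xi0 cu cZ dZx czx dZt init cint cleft cright.
have [ux [uxx [ut [cux dint ul ur]]]] := solution_interior k1E k2E sol.
apply: first_touch => //.
  exact: within_scaled_difference.
move=> [x t] [/= /andP[_ tt1] xI] t0t /eqP.
rewrite mulf_eq0 (negPf sg0)/= subr_eq0 => /eqP uZ below.
have tpos : 0 < t by exact: le_lt_trans t0t.
have tI : t0 < t <= t1 by rewrite t0t.
have tI' : t0 <= t <= t1 by rewrite (ltW t0t).
have [x1 x2] := xi0 t tI'.
have lr12 : - xi1 t < xi2 t by lra.
pose f y := sg * (u (y, t) - Z y t); pose f1 y := sg * (ux (y, t) - zx y t).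
have fx0 : f x = 0 by rewrite /f uZ subrr mulr0.
have fle y : - xi1 t <= y <= xi2 t -> f y <= f x.
  by move=> yI; rewrite fx0; apply: (below (y, t)) => //=; split.
have df (y : R) : - xi1 t < y < xi2 t -> is_derive y 1 f (f1 y).
  move=> yI; have [h _ _ _] := dint y t tpos yI.
  by apply: is_derive_mull; apply: is_derive_sub; first [exact: h|exact: dZx].
have slice z : `[- xi1 t, xi2 t]%classic z -> Qlat xi1 xi2 (z, t).
  by rewrite /= in_itv/= => zI; split.
have cpair : {within `[- xi1 t, xi2 t], continuous (fun z : R => (z, t))}.
  by apply: continuous_subspaceT => z; exact: (cvg_pair cvg_id (cvg_cst t)).
have cf : {within `[- xi1 t, xi2 t], continuous f}.
  apply: within_scaled_difference.
    exact: (within_comp (solution_u_continuous sol) cpair slice).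
  by apply: continuous_subspaceT => y; exact: is_derive_continuous (dZx y t t0t).
have cf1 : {within `[- xi1 t, xi2 t], continuous f1}.
  apply: within_scaled_difference; first exact: (within_comp cux cpair slice).
  exact: continuous_subspaceT (czx t t0t).
have [xl|xl] := eqVneq x (- xi1 t).
  have : f1 (- xi1 t) <= 0.
    by apply: (touching_left_end lr12 cf cf1) => // y yI; rewrite -xl; exact: fle.
  rewrite /f1 (ul t tpos).1 leNgt; move/negP; apply; apply: cleft => //.
  by rewrite -xl.
have [xr|xr] := eqVneq x (xi2 t).
  have : 0 <= f1 (xi2 t).
    by apply: (touching_right_end lr12 cf cf1) => // y yI; rewrite -xr; exact: fle.
  rewrite /f1 (ur t tpos).1 leNgt; move/negP; apply; apply: cright => //.
  by rewrite -xr.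
have xI' : - xi1 t < x < xi2 t.
  by case/andP: xI => xa xb; rewrite lt_neqAle eq_sym xl xa lt_neqAle xr.
have [hx hxx ht pde] := dint x t tpos xI'.
have [G [zxx [dG zxG strict]]] := cint x t tI xI' uZ.
have nearI : \forall y \near x, - xi1 t < y < xi2 t.
  by apply: near_in_itvoo; rewrite in_itv/=.
have [f1x c0] : f1 x = 0 /\ sg * (uxx (x, t) - zxx) <= 0.
  apply: (@touching_second_order _ f f1 (fun y => sg * (ux (y, t) - G y))).
  - by apply: filterS nearI => y; exact: df.
  - by apply: filterS nearI => y /andP[ya yb]; apply: fle; rewrite !ltW.
  - case: zxG => H; [left|right]; apply: filterS H => y H xy; by rewrite /f1 H.
have uxz : ux (x, t) = zx x t.
  by move/eqP: f1x; rewrite /f1 mulf_eq0 (negPf sg0)/= subr_eq0 => /eqP.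
have : 0 <= sg * (ut (x, t) - zt x t).
  apply: (@touching_first_order _ (fun s => sg * (u (x, s) - Z x s)) t).
    by apply: is_derive_mull; apply: is_derive_sub; exact: dZt.
  have [C1 C2] := (solution_xi1_C1 sol, solution_xi2_C1 sol).
  have xi_cont (xi : R -> R) : C1_pos xi -> {for t, continuous xi}.
    move=> cxi; have [dxi _] := cxi t tpos.
    by apply: differentiable_continuous; apply/derivable1_diffP.
  have n0 : \forall s \near t, t0 < s by exact: lt_nbhsr.
  have n1 : \forall s \near t, 0 < x + xi1 s.
    apply: (@near_gt0 _ _ (fun s => x + xi1 s)); last by case/andP: xI' => *; lra.
    by apply: cvgD; [exact: cvg_cst|exact: xi_cont].
  have n2 : \forall s \near t, 0 < xi2 s - x.
    apply: (@near_gt0 _ _ (fun s => xi2 s - x)); last by case/andP: xI' => *; lra.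
    by apply: cvgB; [exact: xi_cont|exact: cvg_cst].
  apply: filterS3 n0 n1 n2 => s s0 s1 s2 st.
  have -> : sg * (u (x, t) - Z x t) = 0 by exact: fx0.
  apply: (below (x, s)) => //=; split => /=.
    by rewrite (ltW s0) (le_trans st).
  by apply/andP; split; lra.
rewrite pde uxz => h.
have : sg * (a (zx x t) * (uxx (x, t) - zxx)) <= 0.
  by rewrite mulrCA pmulr_rle0.
by lra.
Qed.

End Comparison.

(** * Barriers built from cones and from the profile *)

Section SelfSimilar.
Context {R : realType}.
Variables (a : R -> R) (T l r P Q : R) (phi phi' psi psi' : R -> R).
Hypothesis pf : profile a T l r P Q phi phi' psi psi'.

Definition selfsim (f : R -> R) (x t : R) := Num.sqrt t * f (x / Num.sqrt t).

Lemma selfsim_derive_x x t : 0 < t ->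
  is_derive (x : R) 1 (selfsim phi ^~ t) (phi' (x / Num.sqrt t)).
Proof.
move=> tpos; have st : 0 < Num.sqrt t by rewrite sqrtr_gt0.
rewrite /selfsim; set w := Num.sqrt t.
have -> : phi' (x / w) = w * (phi' (x / w) * (1 * w^-1 + x * 0)).
  by field; rewrite gt_eqF.
apply: is_derive_mull; apply: (@is_derive_comp _ phi (fun y => y / w)).
  exact: (profile_derive pf).
exact: is_derive_mul.
Qed.

Lemma selfsim_derive_t x t : 0 < t -> is_derive (t : R) 1 (selfsim phi x)
  ((phi (x / Num.sqrt t) - x / Num.sqrt t * phi' (x / Num.sqrt t)) /
    (2 * Num.sqrt t)).
Proof.
move=> tpos; have st : 0 < Num.sqrt t by rewrite sqrtr_gt0.
pose q (w : R) := w * phi (x / w).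
have dq (w : R) : 0 < w -> is_derive w 1 q (phi (x / w) - x / w * phi' (x / w)).
  move=> w0; have w0' : w != 0 by rewrite gt_eqF.
  have -> : phi (x / w) - x / w * phi' (x / w) =
      1 * phi (x / w) + w * (phi' (x / w) * (x * (- w ^- 2 *: 1))).
    by rewrite /GRing.scale/=; field.
  apply: is_derive_mul; apply: (@is_derive_comp _ phi (fun w => x / w)).
    exact: (profile_derive pf).
  by apply: is_derive_mull; exact: is_deriveV.
exact: (@is_derive_comp _ q Num.sqrt _ _ _ (dq _ st) (is_derive1_sqrt tpos)).
Qed.


Lemma slope_continuous (f : R -> R) (p : R * R) : continuous f -> 0 < p.2 ->
  {for p, continuous (fun z : R * R => f (z.1 / Num.sqrt z.2))}.
Proof.
move=> cf p2; apply: (@continuous_comp _ _ _ (fun z : R * R => z.1 / Num.sqrt z.2) f); last exact: cf.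
apply: cvgM; first exact: cvg_fst.
apply: cvgV; first by rewrite gt_eqF// sqrtr_gt0.
by apply: continuous_comp; [exact: cvg_snd|exact: sqrt_continuous].
Qed.

Lemma selfsim_continuous (f : R -> R) (p : R * R) : continuous f -> 0 < p.2 ->
  {for p, continuous (fun z : R * R => selfsim f z.1 z.2)}.
Proof.
move=> cf p2; apply: cvgM; last exact: slope_continuous.
by apply: continuous_comp; [exact: cvg_snd|exact: sqrt_continuous].
Qed.

(** For [sg = 1] the added term is positive, so the profile is strictly below the line of the cone
    at the contact; this happens only to the left of [- P], where its slope is exactly [l]. For
    [sg = - 1] the bound [l <= phi'] suffices. The quadratic term makes the inequality strict. *)
Lemma barrier_contact_left (sg w E x : R) : sg = 1 \/ sg = -1 ->
  0 < w -> 0 < E -> 0 < x ->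
  T * x = w * phi (- x / w) + sg * (E * (1 + - x * - x)) ->
  0 < sg * (l - (phi' (- x / w) + sg * (E * (2 * - x)))).
Proof.
move=> sg1 w0 E0 x0; have [Tl lr rT] := profile_slopes pf.
have sx : w * (- x / w) = - x by rewrite mulrC divfK// gt_eqF.
have := profile_range pf (- x / w); move: sx; set s := - x / w => sx /andP[h1 h2] uZ.
have Ex : 0 < E * (2 * x) by rewrite mulr_gt0// mulr_gt0.
suff h : 0 <= sg * (l - phi' s).
  have -> : sg * (l - (phi' s + sg * (E * (2 * - x)))) =
    sg * (l - phi' s) + sg * sg * (E * (2 * x)) by ring.
  by case: sg1 h => ->; rewrite ?mulrNN !mul1r => h; rewrite ltr_wpDl.
case: sg1 uZ => ->; rewrite ?mul1r ?mulN1r => uZ; last by rewrite opprB subr_ge0.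
rewrite (profile_left pf) ?subrr// leNgt; apply/negP => sP.
have h3 := profile_ge_left pf (ltW sP).
have h4 : 0 < (T + l) * (s + P) by apply: mulr_gt0; lra.
have h5 : - T * s < phi s by lra.
have : w * (- T * s) < w * phi s by rewrite ltr_pM2l.
have -> : w * (- T * s) = T * x by rewrite mulrCA sx; ring.
have : 0 < E * (1 + - x * - x).
  by rewrite mulr_gt0// mulrNN; have := mulr_gt0 x0 x0; lra.
by rewrite uZ; lra.
Qed.

Lemma barrier_contact_right (sg w E x : R) : sg = 1 \/ sg = -1 ->
  0 < w -> 0 < E -> 0 < x ->
  T * x = w * phi (x / w) + sg * (E * (1 + x * x)) ->
  sg * (r - (phi' (x / w) + sg * (E * (2 * x)))) < 0.
Proof.
move=> sg1 w0 E0 x0; have [Tl lr rT] := profile_slopes pf.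
have sx : w * (x / w) = x by rewrite mulrC divfK// gt_eqF.
have := profile_range pf (x / w); move: sx; set s := x / w => sx /andP[h1 h2] uZ.
have Ex : 0 < E * (2 * x) by rewrite mulr_gt0// mulr_gt0.
suff h : sg * (r - phi' s) <= 0.
  have -> : sg * (r - (phi' s + sg * (E * (2 * x)))) =
    sg * (r - phi' s) - sg * sg * (E * (2 * x)) by ring.
  by case: sg1 h => ->; rewrite ?mulrNN !mul1r => h; rewrite subr_lt0 (le_lt_trans h).
case: sg1 uZ => ->; rewrite ?mul1r ?mulN1r => uZ; last by rewrite opprB subr_le0.
rewrite (profile_right pf) ?subrr// leNgt; apply/negP => sQ.
have h3 := profile_ge_right pf (ltW sQ).
have h4 : 0 < (T - r) * (Q - s) by apply: mulr_gt0; lra.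
have h5 : T * s < phi s by lra.
have : w * (T * s) < w * phi s by rewrite ltr_pM2l.
have -> : w * (T * s) = T * x by rewrite mulrCA sx.
have : 0 < E * (1 + x * x).
  by rewrite mulr_gt0//; have := mulr_gt0 x0 x0; lra.
by rewrite uZ; lra.
Qed.

Lemma profile_inside (s : R) : T * `|s| < phi s -> - P <= s <= Q.
Proof.
have [Tl lr rT] := profile_slopes pf; have T0 := profile_T_gt0 pf => h.
apply/andP; split; rewrite leNgt; apply/negP => sP.
  have := profile_le_left pf (ltW sP); have := ler_norm (- s); rewrite normrN => h1 h2.
  have : T * - s <= T * `|s| by rewrite ler_pM2l.
  have : 0 <= (T + l) * (- P - s) by apply: mulr_ge0; lra.
  by lra.
have := profile_le_right pf (ltW sP); have := ler_norm s => h1 h2.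
have : T * s <= T * `|s| by rewrite ler_pM2l.
have : 0 <= (T - r) * (s - Q) by apply: mulr_ge0; lra.
by lra.
Qed.

End SelfSimilar.

Lemma locally_lipschitz {R : realType} (a : R -> R) (B : R) : C2_real a -> 0 <= B ->
  exists A L, [/\ 0 <= L, forall p, `|p| <= B -> a p <= A &
    forall p q, `|p| <= B -> `|q| <= B -> `|a p - a q| <= L * `|p - q|].
Proof.
move=> [da dda _] B0.
have dera (x : R) : is_derive x 1 a (a^`() x) by rewrite derive1E; exact/derivableP.
have ca : continuous a by move=> x; exact: is_derive_continuous (dera x).
have ca' : continuous (fun x => `|a^`() x|).
  move=> x; apply: cvg_norm; apply: differentiable_continuous.
  exact/derivable1_diffP.
have NB : - B <= B by lra.
have [|x0 _ x0E] := @EVT_max R a (- B) B NB; first exact: continuous_subspaceT.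
have [x1 _ x1E] := @EVT_max R _ (- B) B NB (continuous_subspaceT ca').
exists (a x0), `|a^`() x1|; split=> // [p|p q].
  by rewrite ler_norml => pB; exact: x0E.
rewrite 2!ler_norml.
wlog pq : p q / p <= q.
  move=> H pB qB; case/orP: (le_total p q) => /H; first exact.
  by rewrite distrC [`|q - p|]distrC; apply.
move=> pB qB; move: pq; rewrite le_eqVlt => /predU1P[->|pq]; first by rewrite !subrr !normr0 mulr0.
have [c /andP[pc cq]] := mean_value pq (fun x _ => dera x).
rewrite distrC [`|p - q|]distrC => ->; rewrite normrM ler_wpM2r//.
apply: x1E; rewrite in_itv/=.
by case/andP: pB => *; case/andP: qB => *; apply/andP; split; lra.
Qed.

(** Here [a0] and [az] are the values of [a] at the slopes of the profile and of the barrier, [f2]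
    stands for the second derivative of the profile, and [h] for [phi - s phi']. In [C], the term
    [2 * L * K2 / w0] pays for the change of [a] under the slope perturbation [2 * E * x], the term
    [2 * A] for the second derivative [2 * E] of the added quadratic, and the final 1 for
    strictness. *)
Lemma barrier_strict {R : realType} (sg a0 az f2 w h E x L K2 w0 A C : R) :
  sg = 1 \/ sg = -1 -> 0 < w0 -> w0 <= w -> 0 <= f2 <= K2 -> 0 < E -> 0 <= L ->
  `|az - a0| <= L * (2 * E * `|x|) -> 0 < az -> az <= A ->
  sg * (a0 * f2) <= sg * (h / 2) -> C = 2 * L * K2 / w0 + 2 * A + 1 ->
  sg * (az * (f2 / w + sg * (E * 2))) <
  sg * (h / (2 * w) + sg * (C * E * (1 + x * x))).
Proof.
move=> sg1 w00 w0w /andP[f20 f2K] E0 L0 aza az0 azA eqn CE.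
have w_gt0 : 0 < w by exact: lt_le_trans w0w.
have sgsg : sg * sg = 1 by case: sg1 => ->; rewrite ?mul1r// mulrNN mulr1.
have nsg : `|sg| = 1 by case: sg1 => ->; rewrite ?normrN normr1.
have h1 : sg * ((az - a0) * f2) <= L * (2 * E * `|x|) * K2.
  apply: le_trans (ler_norm _) _; rewrite normrM nsg mul1r normrM.
  by rewrite (ger0_norm f20) ler_pM.
have h2 : sg * (az * f2) <= sg * (h / 2) + L * (2 * E * `|x|) * K2.
  have -> : sg * (az * f2) = sg * (a0 * f2) + sg * ((az - a0) * f2) by ring.
  exact: lerD.
have K20 : 0 <= K2 by exact: le_trans f2K.
have N0 : 0 <= L * (2 * E * `|x|) * K2.
  by rewrite mulr_ge0// mulr_ge0// mulr_ge0// mulr_ge0// ltW.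
have h3 : sg * (az * f2) / w <= sg * (h / 2) / w + L * (2 * E * `|x|) * K2 / w0.
  apply: (@le_trans _ _ ((sg * (h / 2) + L * (2 * E * `|x|) * K2) / w)).
    by rewrite ler_pM2r// invr_gt0.
  by rewrite mulrDl lerD2l ler_wpM2l// lef_pV2.
have -> : sg * (az * (f2 / w + sg * (E * 2))) =
    sg * (az * f2) / w + sg * sg * (az * (E * 2)) by ring.
have -> : sg * (h / (2 * w) + sg * (C * E * (1 + x * x))) =
    sg * (h / 2) / w + sg * sg * (C * E * (1 + x * x)).
  by field; rewrite gt_eqF.
rewrite sgsg !mul1r; apply: le_lt_trans (lerD h3 (lexx _)) _.
rewrite -addrA ltrD2l.
have x1 : `|x| <= 1 + x * x.
  have -> : x * x = `|x| * `|x| by rewrite -normrM ger0_norm// -expr2 sqr_ge0.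
  by have := sqr_ge0 (`|x| - 1); rewrite expr2; have := normr_ge0 x; lra.
pose k := 2 * L * K2 / w0.
have k0 : 0 <= k by rewrite divr_ge0 ?(ltW w00)// mulr_ge0// mulr_ge0.
have -> : L * (2 * E * `|x|) * K2 / w0 = k * E * `|x| by rewrite /k; ring.
rewrite CE -/k.
have e1 : k * E * `|x| <= k * E * (1 + x * x) by rewrite ler_wpM2l// mulr_ge0// ltW.
have xx : 0 <= x * x by rewrite -expr2 sqr_ge0.
have e2 : az * (E * 2) <= A * (E * 2) * (1 + x * x).
  apply: (@le_trans _ _ (A * (E * 2))); first by rewrite ler_wpM2r// mulr_ge0// ltW.
  rewrite ler_peMr//; last by lra.
  by rewrite mulr_ge0// ?mulr_ge0 ?(ltW E0)// (le_trans (ltW az0)).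
have e3 : 0 < E * (1 + x * x) by rewrite mulr_gt0//; lra.
by lra.
Qed.

Section Barriers.
Context {R : realType}.
Variables (beta : R) (a : R -> R) (k1 k2 : R * R -> R) (l r : R).
Variables (u : R * R -> R) (xi1 xi2 : R -> R) (t0 t1 : R).
Hypothesis a_gt0 : forall p, 0 < a p.
Hypothesis k1E : forall t v : R, 0 <= t -> 0 <= v -> k1 (t, v) = - l.
Hypothesis k2E : forall t v : R, 0 <= t -> 0 <= v -> k2 (t, v) = r.
Hypothesis sol : solution beta a k1 k2 u xi1 xi2.
Hypotheses (t0_ge0 : 0 <= t0) (t01 : t0 <= t1).
Hypothesis cxi1 : {within `[t0, t1], continuous xi1}.
Hypothesis cxi2 : {within `[t0, t1], continuous xi2}.
Hypothesis xi_gt0 : forall t, t0 <= t <= t1 -> 0 < xi1 t /\ 0 < xi2 t.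
Hypothesis cu : {within slab xi1 xi2 t0 t1, continuous u}.

Let T := tan beta.

Lemma boundary_values t : 0 < t ->
  u (- xi1 t, t) = T * xi1 t /\ u (xi2 t, t) = T * xi2 t.
Proof.
move=> tpos; have [ux [uxx [ut [_ _ ul ur]]]] := solution_interior k1E k2E sol.
by split; [case: (ul t tpos)|case: (ur t tpos)].
Qed.

(** At the free boundaries [u] equals [T * |x|], which is at least [m * x - M]; lowering the linear
    function by [d * (1 + (t - t0))] excludes contact there and makes it a strict subsolution. The
    choice of [d] keeps the total loss below [e] up to time [t1]. *)
Lemma cone_bound (m M : R) : 0 < T -> `|m| <= T -> 0 <= M ->
  (forall x, - xi1 t0 <= x <= xi2 t0 -> m * x - M <= u (x, t0)) ->
  forall p, slab xi1 xi2 t0 t1 p -> m * p.1 - M <= u p.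
Proof.
move=> T0 mT M0 init p pD.
move: mT; rewrite ler_norml => /andP[mT1 mT2].
apply/ler_addgt0Pl => e e0.
pose d := e / (1 + (t1 - t0)).
have w0 : 0 < 1 + (t1 - t0) by move: t01; lra.
have d0 : 0 < d by rewrite divr_gt0.
pose Z x t := m * x - M - d * (1 + (t - t0)).
have : - 1 * (u p - Z p.1 p.2) < 0.
  apply: (@comparison _ beta a k1 k2 l r u xi1 xi2 t0 t1 (- 1) Z
    (fun _ _ => m) (fun _ _ => - d)) => //.
  - apply: continuous_subspaceT => z.
    apply: cvgB; first by apply: cvgB; [apply: cvgM; [exact: cvg_cst|exact: cvg_fst]|exact: cvg_cst].
    apply: cvgM; first exact: cvg_cst.
    apply: cvgD; first exact: cvg_cst.
    by apply: cvgB; [exact: cvg_snd|exact: cvg_cst].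
  - move=> x t _; apply: (is_derive_eq (is_derive_sub (is_derive_sub
      (is_derive_mull m (is_derive_id1 x)) (is_derive_cst1 M x)) (is_derive_cst1 _ x))).
    by ring.
  - by move=> t _ x; exact: cvg_cst.
  - move=> x t _; apply: (is_derive_eq (is_derive_sub (is_derive_cst1 _ t)
      (is_derive_mull d (is_derive_add (is_derive_cst1 1 t)
        (is_derive_sub (is_derive_id1 t) (is_derive_cst1 t0 t)))))).
    by ring.
  - move=> x /init; rewrite /Z subrr addr0 mulr1 => ?; lra.
  - move=> x t _ _ _; exists (fun _ => m), 0; split; first exact: is_derive_cst1.
      by left; near=> y.
    by rewrite !mulr0 mulrNN mul1r.
  - move=> t /andP[t0t _]; have tpos := le_lt_trans t0_ge0 t0t.
    have [-> _] := boundary_values tpos; rewrite /Z => h.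
    have [x1 _] := solution_xi_gt0 sol tpos.
    have : 0 < d * (1 + (t - t0)) by rewrite mulr_gt0//; lra.
    have : 0 <= (m + T) * xi1 t by rewrite mulr_ge0// ?(ltW x1)//; lra.
    by lra.
  - move=> t /andP[t0t _]; have tpos := le_lt_trans t0_ge0 t0t.
    have [_ ->] := boundary_values tpos; rewrite /Z => h.
    have [_ x2] := solution_xi_gt0 sol tpos.
    have : 0 < d * (1 + (t - t0)) by rewrite mulr_gt0//; lra.
    have : 0 <= (T - m) * xi2 t by rewrite mulr_ge0// ?(ltW x2)//; lra.
    by lra.
rewrite /Z; have : d * (1 + (p.2 - t0)) <= e.
  rewrite -[leRHS](@divfK _ (1 + (t1 - t0))) ?gt_eqF// ler_pM2l//.
  by case: pD => /andP[_ ?] _; lra.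
by lra.
Unshelve. all: by end_near. Qed.

Variables (P Q : R) (phi phi' psi psi' : R -> R).
Hypothesis pf : profile a T l r P Q phi phi' psi psi'.

Hypothesis aC2 : C2_real a.

(* The barrier [S + sg E (1 + x ^+ 2)], where [S] is the shifted self-similar
   solution and [E] is a small exponential in time, is a strict supersolution
   ([sg = 1]) or subsolution ([sg = - 1]).  A subsolution touches [u] only
   inside the cone, since [u] lies above the cone; a supersolution may touch
   [u] where [S] is linear, or at the junction, where only a one-sided second
   derivative is available. *)
Lemma profile_comparison (sg tau : R) : sg = 1 \/ sg = -1 -> 0 < t0 + tau ->
  (sg = -1 -> forall p, slab xi1 xi2 t0 t1 p -> T * `|p.1| <= u p) ->
  (forall x, - xi1 t0 <= x <= xi2 t0 ->
    sg * (u (x, t0) - selfsim phi x (t0 + tau)) <= 0) ->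
  forall p, slab xi1 xi2 t0 t1 p ->
    sg * (u p - selfsim phi p.1 (p.2 + tau)) <= 0.
Proof.
move=> sg1 tau0 cone init p pD.
have [Tl lr rT] := profile_slopes pf; have [P0 Q0] := profile_PQ pf.
have T0 := profile_T_gt0 pf.
have sgsg : sg * sg = 1 by case: sg1 => ->; rewrite ?mul1r// mulrNN mulr1.
have sg0 : sg != 0 by apply/eqP => sg0; move: sgsg; rewrite sg0 mul0r => /esym/eqP; rewrite oner_eq0.
have [X [X0 xX]] : exists X, 0 <= X /\ forall q, slab xi1 xi2 t0 t1 q -> `|q.1| <= X.
  have [c1 _ c1E] := @EVT_max R _ t0 t1 t01 cxi1.
  have [c2 _ c2E] := @EVT_max R _ t0 t1 t01 cxi2.
  exists (`|xi1 c1| + `|xi2 c2|); split; first by rewrite addr_ge0.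
  move=> [x t] [/= tI /andP[xa xb]].
  have := c1E t tI; have := c2E t tI; have := ler_norm (xi1 c1).
  have := ler_norm (xi2 c2); have := normr_ge0 (xi1 c1); have := normr_ge0 (xi2 c2).
  by move=> *; rewrite ler_norml; apply/andP; split; lra.
have PQ : - P <= Q by lra.
have [c _ cE] := @EVT_max R psi' (- P) Q PQ (continuous_subspaceT (profile_psi'_continuous pf)).
pose K2 := `|psi' c|.
have psiK s : - P <= s <= Q -> 0 <= psi' s <= K2.
  move=> sI; have [h _] := profile_eqn pf sI; rewrite (ltW h)/=.
  by apply: le_trans (cE s sI) (ler_norm _).
have T10 : 0 <= T + 1 by rewrite addr_ge0// ltW.
have [A [L [L0 aA aL]]] := locally_lipschitz aC2 T10.
pose w0 := Num.sqrt (t0 + tau).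
have w00 : 0 < w0 by rewrite sqrtr_gt0.
pose C := 2 * L * K2 / w0 + 2 * A + 1.
have A0 : 0 < A by apply: lt_le_trans (a_gt0 0) (aA _ _); rewrite normr0.
have C0 : 0 <= C.
  have k0 : 0 <= 2 * L * K2 / w0.
    by rewrite divr_ge0 ?(ltW w00)// mulr_ge0 ?normr_ge0// mulr_ge0.
  by rewrite /C; lra.
pose B := expR (C * (t1 - t0)).
have B0 : 0 < B by exact: expR_gt0.
apply/ler_addgt0Pl => e e0; rewrite addr0.
(* The first bound gives [2 * E t * |x| <= 1], so that the slopes of the barrier stay within
   [T + 1], the range on which [A] and [L] were taken; the second gives [E t * (1 + x * x) <= e]. *)
pose d := Num.min (1 / (2 * (X + 1) * B)) (e / (B * (1 + X * X))).
have XX : 0 <= X * X by rewrite mulr_ge0.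
have d0 : 0 < d.
  rewrite lt_min; apply/andP; split; apply: divr_gt0 => //.
    by rewrite !mulr_gt0//; lra.
  by rewrite mulr_gt0//; lra.
pose E t := d * expR (C * (t - t0)).
have E0 t : 0 < E t by rewrite mulr_gt0// expR_gt0.
have EB t : t <= t1 -> E t <= d * B.
  by move=> tt; rewrite ler_pM2l// ler_expR ler_wpM2l// lerB.
have Esmall (t x : R) : t <= t1 -> `|x| <= X -> 2 * E t * `|x| <= 1.
  move=> tt xX'.
  have dB : d * B * (2 * (X + 1)) <= 1.
    have : d <= 1 / (2 * (X + 1) * B) by rewrite ge_min lexx.
    by rewrite ler_pdivlMr ?mulr_gt0//; lra.
  apply: le_trans dB; rewrite mulrAC [2 * _ * _]mulrC -mulrA [2 * _]mulrC mulrC.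
  have EX : E t * `|x| <= d * B * (X + 1).
    by apply: ler_pM => //; [exact/ltW/E0|exact: EB|lra].
  by lra.
have dE (t : R) : is_derive t 1 E (C * E t).
  have -> : C * E t = d * (expR (C * (t - t0)) * (C * (1 - 0))) by rewrite /E; ring.
  by apply: is_derive_mull; apply: (@is_derive_comp _ expR (fun t => C * (t - t0))).
pose Z (x t : R) := selfsim phi x (t + tau) + sg * (E t * (1 + x * x)).
pose zx (x t : R) : R := phi' (x / Num.sqrt (t + tau)) + sg * (E t * (2 * x)).
pose zt (x t : R) : R := (phi (x / Num.sqrt (t + tau)) - x / Num.sqrt (t + tau) *
    phi' (x / Num.sqrt (t + tau))) / (2 * Num.sqrt (t + tau)) * (1 + 0) +
  sg * (C * E t * (1 + x * x)).
have dquad (x t : R) : is_derive x 1 (fun x => sg * (E t * (1 + x * x))) (sg * (E t * (2 * x))).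
  apply: is_derive_mull; apply: is_derive_mull.
  have -> : 2 * x = 0 + (1 * x + x * 1) by ring.
  exact: (is_derive_add (is_derive_cst1 _ _) (is_derive_mul (is_derive_id1 x) (is_derive_id1 x))).
suff : sg * (u p - Z p.1 p.2) < 0.
  rewrite /Z opprD addrA mulrDr mulrN mulrA sgsg mul1r.
  have p2 : p.2 <= t1 by case: pD => /andP[].
  have : E p.2 * (1 + p.1 * p.1) <= d * B * (1 + X * X).
    apply: ler_pM; [exact/ltW/E0| |exact: EB|].
      by have : 0 <= p.1 * p.1 by [rewrite -expr2 sqr_ge0]; lra.
    rewrite lerD2l; have -> : p.1 * p.1 = `|p.1| * `|p.1|.
      by rewrite -normrM ger0_norm// -expr2 sqr_ge0.
    by apply: ler_pM => //; exact: xX.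
  have : d * (B * (1 + X * X)) <= e.
    by rewrite -ler_pdivlMr ?mulr_gt0//; [rewrite ge_min lexx orbT|lra].
  by lra.
have pos t : t0 <= t -> 0 < t + tau by move: tau0; lra.
have contact_cone x t : slab xi1 xi2 t0 t1 (x, t) -> u (x, t) = Z x t ->
    sg = 1 \/ T * `|x| < selfsim phi x (t + tau).
  move=> xtD uZ; case: sg1 => sgE; [by left|right].
  apply: le_lt_trans (cone sgE _ xtD) _; rewrite uZ /Z sgE mulN1r gtrBl.
  by rewrite mulr_gt0//; have : 0 <= x * x by [rewrite -expr2 sqr_ge0]; lra.
apply: (@comparison _ beta a k1 k2 l r u xi1 xi2 t0 t1 sg Z zx zt) => //.
- apply: continuous_in_subspaceT => q; rewrite inE => -[/andP[/pos q0 _] _].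
  have cs : {for q, continuous (fun z : R * R => selfsim phi z.1 (z.2 + tau))}.
    apply: (@continuous_comp _ _ _ (fun z : R * R => (z.1, z.2 + tau))
      (fun z : R * R => selfsim phi z.1 z.2)).
      exact: (cvg_pair cvg_fst (cvgD cvg_snd (cvg_cst tau))).
    by apply: selfsim_continuous => //; exact: profile_continuous pf.
  have cE' : continuous (fun z : R * R => E z.2).
    move=> z; apply: (@continuous_comp _ _ _ (fun z : R * R => z.2) E).
      exact: cvg_snd.
    exact: is_derive_continuous (dE z.2).
  have cx : continuous (fun z : R * R => 1 + z.1 * z.1).
    by move=> z; apply: cvgD; [exact: cvg_cst|apply: cvgM; exact: cvg_fst].
  exact: (cvgD cs (cvgM (cvg_cst sg) (cvgM (cE' q) (cx q)))).
- move=> x t /ltW/pos tt; apply: is_derive_add; exact: (selfsim_derive_x pf).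
- move=> t /ltW/pos tt.
  have c1 : continuous (fun x : R => phi' (x / Num.sqrt (t + tau))).
    move=> x; apply: (@continuous_comp _ _ _ (fun x : R => x / Num.sqrt (t + tau)) phi').
      exact: (is_derive_continuous (is_derive_mul (is_derive_id1 x) (is_derive_cst1 _ x))).
    exact: (profile_continuous' pf).
  have c2 : continuous (fun x : R => sg * (E t * (2 * x))).
    move=> x; exact: (is_derive_continuous (is_derive_mull sg (is_derive_mull (E t)
      (is_derive_mull 2 (is_derive_id1 x))))).
  by move=> x; exact: (cvgD (c1 x) (c2 x)).
- move=> x t /ltW/pos tt.
  have d1 : is_derive (t : R) 1 (fun t => sg * (E t * (1 + x * x)))
      (sg * (C * E t * (1 + x * x))).
    have -> : C * E t * (1 + x * x) = C * E t * (1 + x * x) + E t * 0 by ring.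
    exact: (is_derive_mull _ (is_derive_mul (dE t) (is_derive_cst1 _ _))).
  have d2 : is_derive (t : R) 1 (fun t => t + tau) (1 + 0).
    exact: (is_derive_add (is_derive_id1 _) (is_derive_cst1 _ _)).
  exact: (is_derive_add (@is_derive_comp _ (selfsim phi x) (fun t => t + tau) _ _ _
    (selfsim_derive_t pf x tt) d2) d1).
- move=> x xI; rewrite /Z opprD addrA mulrDr mulrN mulrA sgsg mul1r.
  apply: le_lt_trans (lerD (init x xI) (lexx _)) _; rewrite add0r oppr_lt0 mulr_gt0//.
  by have : 0 <= x * x by [rewrite -expr2 sqr_ge0]; lra.
- move=> x t /andP[t0t tt1] xI uZ.
  have xtD : slab xi1 xi2 t0 t1 (x, t).
    split; first by rewrite (ltW t0t).
    by case/andP: xI => xa xb; rewrite (ltW xa) (ltW xb).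
  have tt := pos _ (ltW t0t); set w := Num.sqrt (t + tau).
  have w_gt0 : 0 < w by rewrite sqrtr_gt0.
  have w0w : w0 <= w by rewrite ler_wsqrtr// lerD2r ltW.
  set s := x / w.
  have sx : s * w = x by rewrite divfK// gt_eqF.
  have Es : `|sg * (E t * (2 * x))| = 2 * E t * `|x|.
    rewrite normrM [`|E t * _|]normrM [`|2 * x|]normrM; have -> : `|sg| = 1 by case: sg1 => ->; rewrite ?normrN normr1.
    by rewrite (gtr0_norm (E0 t)) normr_nat; ring.
  have phi'T : `|phi' s| <= T.
    have /andP[h1 h2] := profile_range pf s.
    by rewrite ler_norml; apply/andP; split; lra.
  have xX1 := Esmall t x tt1 (xX _ xtD).
  have zxT : `|zx x t| <= T + 1.
    by apply: le_trans (ler_normD _ _) _; rewrite Es; apply: lerD.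
  have phi'T1 : `|phi' s| <= T + 1 by apply: le_trans phi'T _; rewrite lerDl.
  have key f2 : 0 <= f2 <= K2 ->
      sg * (a (phi' s) * f2) <= sg * ((phi s - s * phi' s) / 2) ->
      sg * (a (zx x t) * (f2 / w + sg * (E t * 2))) < sg * zt x t.
    move=> f2K f2E; rewrite /zt addr0 mulr1.
    apply: (@barrier_strict _ sg (a (phi' s)) _ f2 w _ (E t) x L K2 w0 A C) => //.
    - apply: le_trans (aL _ _ zxT phi'T1) _.
      by rewrite /zx -/w -/s [phi' s + _]addrC addrK Es.
    - exact: aA.
  have dlin (v : R) : is_derive (x : R) 1 (fun y : R => v + sg * (E t * (2 * y)))
      (0 / w + sg * (E t * 2)).
    have -> : 0 / w + sg * (E t * 2) = 0 + sg * (E t * (2 * 1)) by ring.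
    exact: (is_derive_add (is_derive_cst1 _ _) (is_derive_mull _ (is_derive_mull _
      (is_derive_mull 2 (is_derive_id1 x))))).
  have near_quot (v : R) : 0 < v * w - x -> \forall y \near x, y / w < v.
    move=> v0; have := @near_gt0 R R (fun y => v * w - y) x.
    move=> /(_ (cvgB (cvg_cst _) cvg_id) v0); apply: filterS => y.
    by rewrite subr_gt0 ltr_pdivrMr.
  have near_quot' (v : R) : 0 < x - v * w -> \forall y \near x, v < y / w.
    move=> v0; have := @near_gt0 R R (fun y => y - v * w) x.
    move=> /(_ (cvgB cvg_id (cvg_cst _)) v0); apply: filterS => y.
    by rewrite subr_gt0 ltr_pdivlMr.
  have [sPQ|sout] := pselect (- P <= s <= Q).
    exists (fun y : R => psi (y / w) + sg * (E t * (2 * y))), (psi' s / w + sg * (E t * 2)).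
    have [_ eqn] := profile_eqn pf sPQ.
    split; last by apply: key; [exact: psiK|rewrite eqn].
      have -> : psi' s / w + sg * (E t * 2) =
          psi' s * (1 * w^-1 + x * 0) + sg * (E t * (2 * 1)) by ring.
      have dq : is_derive (x : R) 1 (fun y => y / w) (1 * w^-1 + x * 0).
        exact: (is_derive_mul (is_derive_id1 x) (is_derive_cst1 _ _)).
      exact: (is_derive_add (@is_derive_comp _ psi (fun y => y / w) _ _ _
        (profile_derive2 pf s) dq) (is_derive_mull _ (is_derive_mull _
        (is_derive_mull 2 (is_derive_id1 x))))).
    (* At the junction [s = Q] the slope agrees with that of [psi] only on the left; at every other
       point of [[- P, Q]], the end [- P] included, it does so on the right. *)
    case/andP: sPQ => sP; rewrite le_eqVlt => /predU1P[sQ|sQ].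
      right; have : 0 < x - - P * w by rewrite -sx sQ -mulrBl mulr_gt0//; lra.
      move=> /near_quot'; apply: filterS => y yP yx.
      rewrite /zx -/w (profile_psiE pf)// (ltW yP)/= -sQ /s.
      by rewrite ler_pM2r ?invr_gt0.
    left; have : 0 < Q * w - x by rewrite -sx -mulrBl mulr_gt0// subr_gt0.
    move=> /near_quot; apply: filterS => y yQ xy.
    rewrite /zx -/w (profile_psiE pf)// (ltW yQ) andbT (le_trans sP)//.
    by rewrite ler_pM2r ?invr_gt0.
  have sgE : sg = 1.
    have [//|] := contact_cone x t xtD uZ; rewrite /selfsim -/w -/s => h.
    case: sout; apply: (profile_inside pf); rewrite -(ltr_pM2l w_gt0).
    apply: le_lt_trans h; rewrite -sx [`|s * w|]normrM [`|w|]gtr0_norm//.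
    by rewrite mulrCA [w * _]mulrC.
  (* On the linear pieces the second derivative is zero while [phi - s phi'] is positive, which is
     the right sign for [sg = 1]. *)
  have key0 : sg * (a (zx x t) * (0 / w + sg * (E t * 2))) < sg * zt x t.
    apply: key; first by rewrite lexx normr_ge0.
    have [g0 [g1 [g00 gE]]] := profile_bounds pf; have /andP[h _] := gE s.
    by rewrite mulr0 mulr0 sgE mul1r; apply: divr_ge0 => //; apply: le_trans h; exact: ltW.
  have [sQ|sQ] := ltP Q s.
    exists (fun y : R => r + sg * (E t * (2 * y))), (0 / w + sg * (E t * 2)).
    split=> //; left; have : 0 < x - Q * w by rewrite -sx -mulrBl mulr_gt0// subr_gt0.
    move=> /near_quot'; apply: filterS => y yQ _.
    by rewrite /zx -/w (profile_right pf (ltW yQ)).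
  have [sP|sP] := ltP s (- P); last by case: sout; rewrite sP.
  exists (fun y : R => l + sg * (E t * (2 * y))), (0 / w + sg * (E t * 2)).
  split=> //; left; have : 0 < - P * w - x by rewrite -sx -mulrBl mulr_gt0// subr_gt0.
  move=> /near_quot; apply: filterS => y yQ _.
  by rewrite /zx -/w (profile_left pf (ltW yQ)).
- move=> t /andP[t0t tt1]; have tpos := le_lt_trans t0_ge0 t0t.
  have [-> _] := boundary_values tpos; have [x1 _] := solution_xi_gt0 sol tpos.
  apply: (barrier_contact_left pf sg1 _ (E0 t) x1).
  by rewrite sqrtr_gt0 pos// ltW.
- move=> t /andP[t0t tt1]; have tpos := le_lt_trans t0_ge0 t0t.
  have [_ ->] := boundary_values tpos; have [_ x2] := solution_xi_gt0 sol tpos.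
  apply: (barrier_contact_right pf sg1 _ (E0 t) x2).
  by rewrite sqrtr_gt0 pos// ltW.
Qed.

End Barriers.

(** * Attraction and uniqueness *)

Section Attraction.
Context {R : realType}.

(** This turns a bounded shift in time into an error of order [1 / sqrt t]. *)
Lemma sqrt_difference (s t : R) : 0 < s -> s <= t ->
  Num.sqrt t - Num.sqrt s <= (t - s) / Num.sqrt t.
Proof.
move=> s0 st; have t0 : 0 < t by exact: lt_le_trans st.
rewrite ler_pdivlMr ?sqrtr_gt0//.
have q0 := sqrtr_ge0 s; have qp : Num.sqrt s <= Num.sqrt t by exact: ler_wsqrtr.
have := sqr_sqrtr (ltW s0); have := sqr_sqrtr (ltW t0).
move: q0 qp; set p := Num.sqrt t; set q := Num.sqrt s => q0 qp <- <-.
by rewrite mulrBl expr2 lerD2l lerN2 expr2 ler_wpM2l.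
Qed.

Section profile.
Variables (a : R -> R) (T l r P Q : R) (phi phi' psi psi' : R -> R).
Hypothesis pf : profile a T l r P Q phi phi' psi psi'.

(** The time derivative is [(phi - s phi') / (2 sqrt t)], with a numerator between two positive
    constants; hence both the self-similar function and [g * sqrt t] minus it are nondecreasing in
    time. *)
Lemma selfsim_time_bounds : exists g, 0 <= g /\ forall x s t, 0 < s -> s <= t ->
  0 <= selfsim phi x t - selfsim phi x s <= g * (Num.sqrt t - Num.sqrt s).
Proof.
have [g0 [g [g00 gE]]] := profile_bounds pf; exists g.
have gge : 0 <= g by have /andP[h1 h2] := gE 0; apply: le_trans (le_trans h1 h2); exact: ltW.
split=> // x s t s0 st.
have pos z : s <= z <= t -> 0 < z by move=> /andP[sz _]; exact: lt_le_trans sz.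
have dS z : s <= z <= t -> is_derive (z : R) 1 (selfsim phi x) _ := fun zI => selfsim_derive_t pf x (pos z zI).
rewrite subr_ge0; apply/andP; split.
  apply: (nondecreasing_of_derive st dS) => z /andP[sz zt].
  have z0 : 0 < Num.sqrt z by rewrite sqrtr_gt0 (lt_trans s0).
  have /andP[h _] := gE (x / Num.sqrt z).
  by rewrite divr_ge0 ?mulr_ge0 ?(ltW z0)// (le_trans (ltW g00) h).
have dq (z : R) : s <= z <= t -> is_derive z 1
    (fun z => g * Num.sqrt z - selfsim phi x z) _ :=
  fun zI => is_derive_sub (is_derive_mull g (is_derive1_sqrt (pos z zI))) (dS z zI).
have : g * Num.sqrt s - selfsim phi x s <= g * Num.sqrt t - selfsim phi x t.
  apply: (nondecreasing_of_derive st dq) => z /andP[sz zt].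
  have z0 : 0 < Num.sqrt z by rewrite sqrtr_gt0 (lt_trans s0).
  have /andP[_ h] := gE (x / Num.sqrt z).
  by rewrite subr_ge0 ler_pM2r// invr_gt0 mulr_gt0.
by lra.
Qed.

(** Transversality: [T * x - w * phi (x / w)] vanishes at [Q * w] and has slope at least [T - r],
    and similarly on the left with [T + l]. An error in height at a free boundary therefore controls
    the error in its position. *)
Lemma boundary_distance (w x : R) : 0 < w ->
  (T - r) * `|x - Q * w| <= `|T * x - w * phi (x / w)| /\
  (T + l) * `|x + P * w| <= `|- T * x - w * phi (x / w)|.
Proof.
move=> w0; have [Tl lr rT] := profile_slopes pf.
have w0' : w != 0 by rewrite gt_eqF.
have [s ->] : exists s, x = w * s by exists (x / w); rewrite mulrC divfK.
have -> : w * s / w = s by field.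
have -> : w * s - Q * w = w * (s - Q) by ring.
have -> : w * s + P * w = w * (s + P) by ring.
have -> : T * (w * s) - w * phi s = w * (T * s - phi s) by ring.
have -> : - T * (w * s) - w * phi s = w * (- T * s - phi s) by ring.
rewrite ![`|w * _|]normrM (gtr0_norm w0) ![_ * (w * _)]mulrCA !ler_pM2l//; split.
  have [sQ|sQ] := leP s Q.
    have h := profile_ge_right pf sQ; have -> : `|s - Q| = Q - s by rewrite distrC ger0_norm ?subr_ge0.
    have := ler_norm (- (T * s - phi s)); rewrite normrN; lra.
  have h := profile_le_right pf (ltW sQ).
  rewrite ger0_norm; last by rewrite subr_ge0 ltW.
  by apply: le_trans (ler_norm _); lra.
have [sP|sP] := leP s (- P).
  have h := profile_le_left pf sP; rewrite ler0_norm; last by lra.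
  by apply: le_trans (ler_norm _); lra.
have h := profile_ge_left pf (ltW sP).
rewrite ger0_norm; last by lra.
have := ler_norm (- (- T * s - phi s)); rewrite normrN; lra.
Qed.

Lemma selfsim_scale (b x t : R) : 0 < b -> 0 < t ->
  selfsim phi (b * x) (b ^+ 2 * t) = b * selfsim phi x t.
Proof.
move=> b0 t0; rewrite /selfsim sqrtrM ?sqr_ge0// sqrtr_sqr gtr0_norm// -mulrA.
by rewrite invfM mulrACA divff ?gt_eqF// mul1r.
Qed.

End profile.

Section solution.
Variables (beta : R) (a : R -> R) (k1 k2 : R * R -> R) (l r : R).
Variables (u : R * R -> R) (xi1 xi2 : R -> R).
Hypothesis a_gt0 : forall p, 0 < a p.
Hypothesis k1E : forall t v : R, 0 <= t -> 0 <= v -> k1 (t, v) = - l.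
Hypothesis k2E : forall t v : R, 0 <= t -> 0 <= v -> k2 (t, v) = r.
Hypothesis sol : solution beta a k1 k2 u xi1 xi2.
Hypothesis aC2 : C2_real a.
Variables (P Q : R) (phi phi' psi psi' : R -> R).
Hypothesis pf : profile a (tan beta) l r P Q phi phi' psi psi'.

Let T := tan beta.

Lemma C1_pos_within (xi : R -> R) (t0 t1 : R) : C1_pos xi -> 0 < t0 ->
  {within `[t0, t1], continuous xi}.
Proof.
move=> cxi t00; apply: continuous_in_subspaceT => t; rewrite inE/= in_itv/= => /andP[tt _].
have [dxi _] := cxi t (lt_le_trans t00 tt).
by apply: differentiable_continuous; apply/derivable1_diffP.
Qed.

Lemma slab_within (t0 t1 : R) : 0 < t0 -> {within slab xi1 xi2 t0 t1, continuous u}.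
Proof.
move=> t00; apply: continuous_subspaceW (solution_u_continuous sol) => p.
by move=> [/andP[tt _] xI]; split => //; exact: lt_le_trans tt.
Qed.

(** The two shifts exist because at time [t0] the self-similar function exceeds any bound on the
    slice when shifted far forward, and sinks below the larger of [T * |x|] and a small constant
    when shifted back close to time zero; [u] is above both by the cone hypothesis and by
    positivity. *)
Lemma profile_attracts (t0 : R) : 0 < t0 ->
  (forall t x, t0 <= t -> - xi1 t <= x <= xi2 t -> T * `|x| <= u (x, t)) ->
  exists C, 0 <= C /\ forall t x, t0 <= t -> - xi1 t <= x <= xi2 t ->
    `|u (x, t) - selfsim phi x t| <= C / Num.sqrt t.
Proof.
move=> t00 cone.
have T0 : 0 < T := profile_T_gt0 pf.
have [P0 Q0] := profile_PQ pf.
have cmp t1 sg tau : t0 <= t1 -> sg = 1 \/ sg = -1 -> 0 < t0 + tau ->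
    (forall x, - xi1 t0 <= x <= xi2 t0 ->
      sg * (u (x, t0) - selfsim phi x (t0 + tau)) <= 0) ->
    forall x, - xi1 t1 <= x <= xi2 t1 ->
      sg * (u (x, t1) - selfsim phi x (t1 + tau)) <= 0.
  move=> t01 sg1 tau0 init x xI.
  have xD : slab xi1 xi2 t0 t1 (x, t1) by split => //=; rewrite t01 lexx.
  apply: (profile_comparison a_gt0 k1E k2E sol (ltW t00) t01
    (C1_pos_within (solution_xi1_C1 sol) t00) (C1_pos_within (solution_xi2_C1 sol) t00)
    _ (slab_within t00) pf aC2 sg1 tau0 _ init xD).
    by move=> t /andP[tt _]; apply: (solution_xi_gt0 sol); exact: lt_le_trans tt.
  by move=> _ [y s] [/= /andP[ts _] yI]; exact: cone.
have [x10 x20] := solution_xi_gt0 sol t00.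
have x12 : - xi1 t0 <= xi2 t0 by lra.
have cslice : {within `[- xi1 t0, xi2 t0], continuous (fun x => u (x, t0))}.
  apply: (within_comp (solution_u_continuous sol)).
    by apply: continuous_subspaceT => z; exact: (cvg_pair cvg_id (cvg_cst t0)).
  by move=> z /=; rewrite in_itv/= => zI; split.
have [cM cMI uM] := EVT_max x12 cslice.
have [cm cmI um] := EVT_min x12 cslice.
have phi0 : 0 < phi 0 by apply: (profile_gt0 pf); lra.
have st0 : 0 < Num.sqrt t0 by rewrite sqrtr_gt0.
have [tau [tau0 tauE]] : exists tau, 0 <= tau /\
    forall x, - xi1 t0 <= x <= xi2 t0 -> 1 * (u (x, t0) - selfsim phi x (t0 + tau)) <= 0.
  (* As [phi] is [T]-Lipschitz, [w * phi (x / w) >= w * phi 0 - T * |x|]; this [w] makes the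
     right-hand side at least the maximum of [u]. *)
  pose w := Num.sqrt t0 + (`|u (cM, t0)| + T * (xi1 t0 + xi2 t0)) / phi 0.
  have N0 : 0 <= `|u (cM, t0)| + T * (xi1 t0 + xi2 t0).
    by rewrite addr_ge0// mulr_ge0 ?(ltW T0)// addr_ge0// ltW.
  have wt : Num.sqrt t0 <= w by rewrite lerDl divr_ge0// ltW.
  have w0 : 0 < w by exact: lt_le_trans wt.
  exists (w ^+ 2 - t0); split.
    by rewrite subr_ge0 -(sqr_sqrtr (ltW t00)) ler_sqr// nnegrE ltW.
  move=> x xI; rewrite mul1r [t0 + _]addrC subrK /selfsim sqrtr_sqr (gtr0_norm w0) subr_le0.
  apply: le_trans (uM x xI) _; apply: le_trans (ler_norm _) _.
  have /andP[xa xb] := xI.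
  have xX : `|x| <= xi1 t0 + xi2 t0 by rewrite ler_norml; apply/andP; split; lra.
  have wphi : `|u (cM, t0)| + T * (xi1 t0 + xi2 t0) <= w * phi 0.
    by rewrite -ler_pdivrMr// lerDr ltW.
  have := profile_lipschitz pf 0 (x / w); rewrite sub0r normrN => h.
  have h' : phi 0 - phi (x / w) <= T * `|x / w| by exact: le_trans (ler_norm _) h.
  have : w * (phi 0 - phi (x / w)) <= w * (T * `|x / w|) by rewrite ler_pM2l.
  have -> : w * (T * `|x / w|) = T * `|x|.
    by rewrite normrM normfV (gtr0_norm w0); field; rewrite gt_eqF.
  have : T * `|x| <= T * (xi1 t0 + xi2 t0) by rewrite ler_pM2l.
  by lra.
have [ta [ta0 [ta1 taE]]] : exists ta, 0 < t0 + ta /\ ta <= 0 /\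
    forall x, - xi1 t0 <= x <= xi2 t0 -> -1 * (u (x, t0) - selfsim phi x (t0 + ta)) <= 0.
  have um0 : 0 < u (cm, t0) by apply: (solution_u_gt0 sol); split.
  pose B := phi 0 + T * (P + Q).
  have B0 : 0 < B by rewrite addr_gt0// mulr_gt0// addr_gt0.
  (* [B] bounds [phi] on [[- P, Q]], so [w * B] is at most the minimum of [u]; where
     [phi (x / w) <= T * |x / w|], the cone hypothesis applies instead. *)
  pose w := Num.min (Num.sqrt t0) (u (cm, t0) / B).
  have w0 : 0 < w by rewrite lt_min st0 divr_gt0.
  have wt : w <= Num.sqrt t0 by rewrite ge_min lexx.
  have wB : w * B <= u (cm, t0) by rewrite -ler_pdivlMr// ge_min lexx orbT.
  exists (w ^+ 2 - t0); split; first by rewrite [t0 + _]addrC subrK exprn_gt0.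
  split; first by rewrite subr_le0 -(sqr_sqrtr (ltW t00)) ler_sqr// nnegrE ltW.
  move=> x xI; rewrite mulN1r oppr_le0 [t0 + _]addrC subrK /selfsim sqrtr_sqr (gtr0_norm w0) subr_ge0.
  have [sPQ|sout] := pselect (T * `|x / w| < phi (x / w)).
    have /andP[sP sQ] := profile_inside pf sPQ.
    apply: le_trans (um x xI); apply: le_trans wB; rewrite ler_pM2l//.
    have := profile_lipschitz pf (x / w) 0; rewrite subr0 => h.
    have h' : phi (x / w) - phi 0 <= T * `|x / w| by exact: le_trans (ler_norm _) h.
    have : T * `|x / w| <= T * (P + Q).
      by rewrite ler_pM2l// ler_norml; apply/andP; split; lra.
    by rewrite /B; lra.
  apply: le_trans (cone t0 x (lexx _) xI).
  move/negP: sout; rewrite -leNgt => sout.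
  have -> : T * `|x| = w * (T * `|x / w|).
    by rewrite normrM normfV (gtr0_norm w0); field; rewrite gt_eqF.
  by rewrite ler_pM2l.
have [g [g0 gE]] := selfsim_time_bounds pf.
exists (g * (tau - ta)); split; first by rewrite mulr_ge0//; lra.
move=> t x tt xI; have tpos : 0 < t by exact: lt_le_trans tt.
have st : 0 < Num.sqrt t by rewrite sqrtr_gt0.
have h1 : u (x, t) <= selfsim phi x (t + tau).
  by rewrite -subr_le0 -[leLHS]mul1r; apply: cmp => //; [left|rewrite ltr_wpDr].
have h2 : selfsim phi x (t + ta) <= u (x, t).
  rewrite -subr_ge0 -oppr_le0 -mulN1r; apply: cmp => //; by right.
have ttau : t <= t + tau by rewrite lerDl.
have /andP[_ h3] := gE x t (t + tau) tpos ttau.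
have tta : 0 < t + ta by lra.
have tta' : t + ta <= t by lra.
have /andP[_ h4] := gE x (t + ta) t tta tta'.
have s1 : Num.sqrt (t + tau) - Num.sqrt t <= tau / Num.sqrt t.
  apply: le_trans (sqrt_difference tpos ttau) _.
  rewrite addrAC subrr add0r ler_wpM2l// lef_pV2 ?posrE ?sqrtr_gt0//; last by lra.
  by rewrite ler_wsqrtr// lerDl.
have s2 : Num.sqrt t - Num.sqrt (t + ta) <= - ta / Num.sqrt t.
  by apply: le_trans (sqrt_difference tta tta') _; rewrite opprD addNKr.
have i0 : 0 <= (Num.sqrt t)^-1 by rewrite invr_ge0 ltW.
have b1 : g * (Num.sqrt (t + tau) - Num.sqrt t) <= g * (tau / Num.sqrt t) by rewrite ler_wpM2l.
have b2 : g * (Num.sqrt t - Num.sqrt (t + ta)) <= g * (- ta / Num.sqrt t) by rewrite ler_wpM2l.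
have n1 : 0 <= g * (tau / Num.sqrt t) by rewrite mulr_ge0// mulr_ge0.
have n2 : 0 <= g * (- ta / Num.sqrt t) by rewrite mulr_ge0// mulr_ge0// oppr_ge0.
have -> : g * (tau - ta) / Num.sqrt t =
  g * (tau / Num.sqrt t) + g * (- ta / Num.sqrt t) by ring.
by rewrite ler_norml; apply/andP; split; lra.
Qed.

Lemma boundary_attracts (t D : R) : 0 < t ->
  (forall x, - xi1 t <= x <= xi2 t -> `|u (x, t) - selfsim phi x t| <= D) ->
  (T - r) * `|xi2 t - Q * Num.sqrt t| <= D /\
  (T + l) * `|xi1 t - P * Num.sqrt t| <= D.
Proof.
move=> tpos uD; have st : 0 < Num.sqrt t by rewrite sqrtr_gt0.
have [x1 x2] := solution_xi_gt0 sol tpos.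
have [ul ur] := boundary_values k1E k2E sol tpos; split.
  have [h _] := boundary_distance pf (xi2 t) st; apply: le_trans h _.
  by rewrite -ur; apply: uD; rewrite lexx andbT; lra.
have [_ h] := boundary_distance pf (- xi1 t) st.
have -> : `|xi1 t - P * Num.sqrt t| = `|- xi1 t + P * Num.sqrt t|.
  by rewrite -normrN opprB addrC.
apply: le_trans h _; rewrite mulrNN -ul; apply: uD; rewrite lexx/=; lra.
Qed.

End solution.

(** * Uniqueness by rescaling to large times *)

Section uniqueness.
Variables (beta b : R) (a : R -> R) (k1 k2 : R * R -> R) (l r : R).
Variables (u : R * R -> R) (xi1 xi2 : R -> R).
Hypothesis a_gt0 : forall p, 0 < a p.
Hypothesis k1E : forall t v : R, 0 <= t -> 0 <= v -> k1 (t, v) = - l.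
Hypothesis k2E : forall t v : R, 0 <= t -> 0 <= v -> k2 (t, v) = r.
Hypothesis b1 : 1 < b.
Hypothesis ss : self_similar_solution beta a k1 k2 b u xi1 xi2.
Hypothesis aC2 : C2_real a.
Variables (P Q : R) (phi phi' psi psi' : R -> R).
Hypothesis pf : profile a (tan beta) l r P Q phi phi' psi psi'.

Let T := tan beta.

Lemma le0_of_geometric (x M : R) : (forall n, x <= M / b ^+ n) -> x <= 0.
Proof.
move=> xM; rewrite leNgt; apply/negP => x0.
have b0 : 0 < b by move: b1; lra.
have lim : (fun n => M * b^-1 ^+ n) @ \oo --> M * 0.
  apply: cvgM; first exact: cvg_cst.
  by apply: cvg_expr; rewrite ger0_norm ?invr_ge0 ?(ltW b0)// invf_lt1.
rewrite mulr0 in lim.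
have [n _ H] := cvgr_lt 0 lim _ x0.
by have := H n (leqnn n); rewrite exprVn ltNge xM.
Qed.

Lemma selfsimilar_iter n (t x : R) : 0 < t -> - xi1 t <= x <= xi2 t ->
  [/\ u (b ^+ n * x, (b ^+ n) ^+ 2 * t) = b ^+ n * u (x, t),
    xi1 ((b ^+ n) ^+ 2 * t) = b ^+ n * xi1 t,
    xi2 ((b ^+ n) ^+ 2 * t) = b ^+ n * xi2 t &
    - xi1 ((b ^+ n) ^+ 2 * t) <= b ^+ n * x <= xi2 ((b ^+ n) ^+ 2 * t)].
Proof.
move=> t0 xI; have [_ us xs] := ss; have b0 : 0 < b by move: b1; lra.
elim: n => [|n [IHu IH1 IH2 IHx]]; first by rewrite !expr0 expr1n !mul1r.
have tn0 : 0 < (b ^+ n) ^+ 2 * t by rewrite mulr_gt0// !exprn_gt0.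
have tE : (b ^+ n.+1) ^+ 2 * t = b ^+ 2 * ((b ^+ n) ^+ 2 * t).
  by rewrite [b ^+ n.+1]exprS exprMn mulrA.
have bE y : b ^+ n.+1 * y = b * (b ^+ n * y) by rewrite exprS mulrA.
have [h1 h2] := xs _ tn0; rewrite tE !bE -h1 -h2 IH1 IH2; split=> //.
- by rewrite -IHu (us _ _ tn0 IHx).
- rewrite IH1 IH2 in IHx; case/andP: IHx => ha hb.
  have := ler_wpM2l (ltW b0) ha; have := ler_wpM2l (ltW b0) hb.
  by rewrite mulrN => -> ->.
Qed.

Lemma selfsimilar_cone (t x : R) : 0 < t -> - xi1 t <= x <= xi2 t ->
  T * `|x| <= u (x, t).
Proof.
move=> t0 xI; have [sol _ _] := ss; have b0 : 0 < b by move: b1; lra.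
have T0 : 0 < T := profile_T_gt0 pf.
have [x1 x2] := solution_xi_gt0 sol t0.
suff side m : `|m| <= T -> m * x <= u (x, t).
  have [x0|x0] := leP 0 x.
    by rewrite ger0_norm//; apply: side; rewrite gtr0_norm.
  by rewrite ltr0_norm// mulrN -mulNr; apply: side; rewrite normrN gtr0_norm.
(* The defect [T * (xi1 t + xi2 t)] bounds [m * y] on the slice at time [t], so the lowered line is
   below [0 < u] there. It does not grow at later times, whereas [u] is multiplied by [b ^+ n] at
   the rescaled point. *)
move=> mT; rewrite -subr_le0; apply: (@le0_of_geometric _ (T * (xi1 t + xi2 t))) => n.
have bn0 : 0 < b ^+ n by rewrite exprn_gt0.
have [uE _ _ xnI] := selfsimilar_iter n t0 xI.
have tn : t <= (b ^+ n) ^+ 2 * t.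
  by rewrite ler_peMl ?(ltW t0)// exprn_ege1// exprn_ege1// ltW.
rewrite ler_pdivlMr//.
have M0 : 0 <= T * (xi1 t + xi2 t) by rewrite mulr_ge0 ?(ltW T0)// addr_ge0// ltW.
have pD : slab xi1 xi2 t ((b ^+ n) ^+ 2 * t) (b ^+ n * x, (b ^+ n) ^+ 2 * t).
  by split => //=; rewrite tn lexx.
have := cone_bound a_gt0 k1E k2E sol (ltW t0) tn
    (C1_pos_within (solution_xi1_C1 sol) t0) (C1_pos_within (solution_xi2_C1 sol) t0)
    _ (slab_within sol t0) T0 mT M0 _ pD.
rewrite /= uE => h; suff : m * (b ^+ n * x) - T * (xi1 t + xi2 t) <= b ^+ n * u (x, t).
  by lra.
apply: h.
  by move=> s /andP[ts _]; apply: (solution_xi_gt0 sol); exact: lt_le_trans ts.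
move=> y yI; have u0 : 0 < u (y, t) by apply: (solution_u_gt0 sol); split.
have : m * y <= T * (xi1 t + xi2 t).
  apply: le_trans (ler_norm _) _; rewrite normrM; apply: ler_pM => //.
  by case/andP: yI => ya yb; rewrite ler_norml; apply/andP; split; lra.
by lra.
Qed.

Lemma selfsimilar_unique (t : R) : 0 < t ->
  [/\ xi1 t = P * Num.sqrt t, xi2 t = Q * Num.sqrt t &
    forall x, - xi1 t <= x <= xi2 t -> u (x, t) = selfsim phi x t].
Proof.
move=> t0; have [sol _ _] := ss; have b0 : 0 < b by move: b1; lra.
have [Tl lr rT] := profile_slopes pf.
have st : 0 < Num.sqrt t by rewrite sqrtr_gt0.
have [C [C0 CE]] := profile_attracts a_gt0 k1E k2E sol aC2 pf t0
  (fun s y ts yI => selfsimilar_cone (lt_le_trans t0 ts) yI).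
have uS x : - xi1 t <= x <= xi2 t -> `|u (x, t) - selfsim phi x t| <= 0.
  (* At the rescaled point the error is at most [C / (b ^+ n * sqrt t)], and it equals [b ^+ n]
     times the error at [(x, t)]. *)
  move=> xI; apply: (@le0_of_geometric _ (C / Num.sqrt t)) => n.
  have bn1 : 1 <= b ^+ n by rewrite exprn_ege1// ltW.
  have bn0 : 0 < b ^+ n by rewrite exprn_gt0.
  have [uE _ _ xnI] := selfsimilar_iter n t0 xI.
  have tn : t <= (b ^+ n) ^+ 2 * t.
    by rewrite ler_peMl ?(ltW t0)// exprn_ege1// exprn_ege1// ltW.
  have := CE _ _ tn xnI; rewrite uE selfsim_scale// -mulrBr normrM (gtr0_norm bn0).
  rewrite sqrtrM ?sqr_ge0// sqrtr_sqr (gtr0_norm bn0) => h.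
  have -> : C / Num.sqrt t / b ^+ n = C / (b ^+ n * Num.sqrt t).
    by rewrite invfM mulrA mulrAC.
  by apply: le_trans h; rewrite ler_peMl.
have h x (xI : - xi1 t <= x <= xi2 t) : u (x, t) = selfsim phi x t.
  by apply/eqP; rewrite -subr_eq0 -normr_le0; exact: uS.
have [h1 h2] := boundary_attracts k1E k2E sol pf t0 uS.
split=> //; apply/eqP; rewrite -subr_eq0 -normr_le0.
  by move: h2; rewrite pmulr_rle0//; lra.
by move: h1; rewrite pmulr_rle0// subr_gt0.
Qed.

End uniqueness.
End Attraction.

(** * Existence *)

Section Existence.
Context {R : realType}.

(* The orbit of every point under the inverse scaling tends to the origin. *)
Lemma scaling_invariant_constant (b : R) (k : R * R -> R) : 1 < b ->
  {within quadrant, continuous k} ->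
  (forall t v, 0 <= t -> 0 <= v -> k (t, v) = k (b ^+ 2 * t, b * v)) ->
  forall t v, 0 <= t -> 0 <= v -> k (t, v) = k (0, 0).
Proof.
move=> b1 ck kb t v t0 v0.
have b0 : 0 < b by exact: lt_trans ltr01 b1.
pose f n : R * R := ((b^-1 ^+ 2) ^+ n * t, b^-1 ^+ n * v).
have bV : 0 <= b^-1 < 1 by rewrite invr_ge0 (ltW b0) invf_lt1.
have fq n : quadrant (f n).
  by case/andP: bV => ? _; split; rewrite /= mulr_ge0// !exprn_ge0.
have kf n : k (f n) = k (t, v).
  elim: n => [|n <-]; first by rewrite /f !expr0 !mul1r.
  rewrite (kb (f n.+1).1) ?(fq n.+1).1 ?(fq n.+1).2//.
  congr (k (_, _)); rewrite /=.
    by rewrite [_ ^+ n.+1]exprS; set z := _ ^+ n; field; rewrite gt_eqF.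
  by rewrite [_ ^+ n.+1]exprS; set z := _ ^+ n; field; rewrite gt_eqF.
have cf : f @ \oo --> ((0 : R), (0 : R)).
  have c0 (z y : R) : 0 <= z < 1 -> (fun n => z ^+ n * y) @ \oo --> (0 : R).
    move=> /andP[z0 z1]; rewrite -[X in _ --> X](mul0r y).
    apply: cvgM; last exact: cvg_cst.
    by apply: cvg_expr; rewrite ger0_norm.
  have b2 : 0 <= b^-1 ^+ 2 < 1.
    case/andP: bV => h1 h2; rewrite exprn_ge0//= expr2.
    by apply: le_lt_trans h2; rewrite ler_piMr// ltW// invf_lt1.
  exact: (cvg_pair (c0 _ t b2) (c0 _ v bV)).
have q0 : quadrant ((0 : R), (0 : R)) by split.
move/subspace_continuousP : ck => /(_ _ q0) ck.
apply/eqP; rewrite eq_sym -subr_eq0 -normr_le0; apply/ler_addgt0Pl => e e0; rewrite addr0.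
have : \forall p \near ((0 : R), (0 : R)), quadrant p -> `|k (0, 0) - k p| < e.
  by move/cvgrPdist_lt : ck => /(_ e e0).
move=> /cf[n _ H]; have := H n (leqnn n) (fq n).
by rewrite kf => /ltW.
Qed.

Variables (beta : R) (a : R -> R) (l r P Q : R) (phi phi' psi psi' : R -> R).
Hypothesis pf : profile a (tan beta) l r P Q phi phi' psi psi'.

Let T := tan beta.

Definition selfsim_u (p : R * R) : R := selfsim phi p.1 p.2.
Definition selfsim_xi (c t : R) : R := c * Num.sqrt t.
Definition selfsim_ut (p : R * R) : R :=
  (phi (p.1 / Num.sqrt p.2) - p.1 / Num.sqrt p.2 * phi' (p.1 / Num.sqrt p.2)) /
  (2 * Num.sqrt p.2).

Lemma selfsim_xi_derive (c t : R) : 0 < t ->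
  is_derive (t : R) 1 (selfsim_xi c) (c * (2 * Num.sqrt t)^-1).
Proof. by move=> t0; exact: is_derive_mull (is_derive1_sqrt t0). Qed.

Lemma selfsim_xi_C1 (c : R) : C1_pos (selfsim_xi c).
Proof.
move=> t t0; have [d _] := selfsim_xi_derive c t0; split => //.
have E s : 0 < s -> (selfsim_xi c)^`() s = c * (2 * Num.sqrt s)^-1.
  by move=> s0; rewrite derive1E; have [_ ->] := selfsim_xi_derive c s0.
have lim : (fun s => c * (2 * Num.sqrt s)^-1) @ t --> c * (2 * Num.sqrt t)^-1.
  apply: cvgM; first exact: cvg_cst.
  apply: cvgV; first by rewrite gt_eqF// mulr_gt0// sqrtr_gt0.
  by apply: cvgM; [exact: cvg_cst|exact: sqrt_continuous].
have h : (selfsim_xi c)^`() @ t --> c * (2 * Num.sqrt t)^-1.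
  apply: cvg_trans lim; apply: near_eq_cvg.
  by apply: filterS (lt_nbhsr t0) => s s0; rewrite E.
by rewrite -(E t t0) in h.
Qed.

Lemma selfsim_Qlat (p : R * R) : Qlat (selfsim_xi P) (selfsim_xi Q) p ->
  0 < p.2 /\ - P <= p.1 / Num.sqrt p.2 <= Q.
Proof.
move=> [p2 pI]; split => //; have s0 : 0 < Num.sqrt p.2 by rewrite sqrtr_gt0.
by rewrite ler_pdivlMr// ler_pdivrMr// mulNr.
Qed.

Lemma selfsim_ut_partial :
  is_partial2 (Qlat (selfsim_xi P) (selfsim_xi Q)) selfsim_u selfsim_ut.
Proof.
split.
  apply: continuous_in_subspaceT => p; rewrite inE => -[p2 _].
  have s0 : Num.sqrt p.2 != 0 by rewrite gt_eqF// sqrtr_gt0.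
  have cs : {for p, continuous (fun p : R * R => Num.sqrt p.2)}.
    by apply: continuous_comp; [exact: cvg_snd|exact: sqrt_continuous].
  have c1 := slope_continuous (profile_continuous pf) p2.
  have c2 := slope_continuous (profile_continuous' pf) p2.
  have c3 : {for p, continuous (fun p : R * R => p.1 / Num.sqrt p.2)}.
    by apply: (@slope_continuous _ id) => // x; exact: cvg_id.
  have c4 : {for p, continuous (fun p : R * R => (2 * Num.sqrt p.2)^-1)}.
    by apply: cvgV; [rewrite mulf_neq0|apply: cvgM; [exact: cvg_cst|exact: cs]].
  exact: (cvgM (cvgB c1 (cvgM c3 c2)) c4).
move=> p /interior_subset/selfsim_Qlat[p2 _].
exact: (selfsim_derive_t pf p.1 p2).
Qed.

Lemma selfsim_ut_gt0 (p : R * R) : 0 < p.2 -> 0 < selfsim_ut p.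
Proof.
move=> p2; have [g0 [g1 [g00 gE]]] := profile_bounds pf.
rewrite /selfsim_ut divr_gt0 ?mulr_gt0 ?sqrtr_gt0//.
by have /andP[h _] := gE (p.1 / Num.sqrt p.2); exact: lt_le_trans h.
Qed.

Lemma selfsim_solution (k1 k2 : R * R -> R) :
  (forall t v : R, 0 <= t -> 0 <= v -> k1 (t, v) = - l) ->
  (forall t v : R, 0 <= t -> 0 <= v -> k2 (t, v) = r) ->
  solution beta a k1 k2 selfsim_u (selfsim_xi P) (selfsim_xi Q).
Proof.
move=> k1E k2E; have [P0 Q0] := profile_PQ pf.
have [phiP phiQ] := profile_ends pf.
have u0 p : Qlat (selfsim_xi P) (selfsim_xi Q) p -> 0 < selfsim_u p.
  move=> /selfsim_Qlat[p2 pI]; rewrite mulr_gt0 ?sqrtr_gt0//.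
  exact: (profile_gt0 pf).
have cq (f : R -> R) (p : R * R) : continuous f -> 0 < p.2 ->
    {for p, continuous (fun z : R * R => f (z.1 / Num.sqrt z.2))}.
  by move=> cf p2; exact: slope_continuous.
have cu : {within Qlat (selfsim_xi P) (selfsim_xi Q), continuous selfsim_u}.
  apply: continuous_in_subspaceT => p; rewrite inE => -[p2 _].
  exact: selfsim_continuous (profile_continuous pf) p2.
have cpsi : continuous psi by move=> s; exact: is_derive_continuous (profile_derive2 pf s).
split=> //.
- by move=> t t0; rewrite !mulr_gt0// sqrtr_gt0.
- exact: selfsim_xi_C1.
- exact: selfsim_xi_C1.
(* On [Qlat] this equals [phi'] at the similarity variable; with [psi] the second derivative is
   continuous across the free boundaries, where that of [phi] jumps. *)
exists (fun p => psi (p.1 / Num.sqrt p.2)),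
  (fun p => psi' (p.1 / Num.sqrt p.2) * (1 * (Num.sqrt p.2)^-1 + p.1 * 0)), selfsim_ut.
split; split.
- split.
    by apply: continuous_in_subspaceT => p; rewrite inE => -[p2 _]; exact: cq.
  move=> p /interior_subset/selfsim_Qlat[p2 pI].
  by rewrite -(profile_psiE pf pI); exact: (selfsim_derive_x pf p.1 p2).
- split.
    apply: continuous_in_subspaceT => p; rewrite inE => -[p2 _].
    apply: cvgM; first exact: cq (profile_psi'_continuous pf) p2.
    apply: cvgD; last by apply: cvgM; [exact: cvg_fst|exact: cvg_cst].
    apply: cvgM; first exact: cvg_cst.
    apply: cvgV; first by rewrite gt_eqF// sqrtr_gt0.
    by apply: continuous_comp; [exact: cvg_snd|exact: sqrt_continuous].
  move=> p _.
  have dq : is_derive p.1 1 (fun y : R => y / Num.sqrt p.2) (1 * (Num.sqrt p.2)^-1 + p.1 * 0).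
    exact: (is_derive_mul (is_derive_id1 _) (is_derive_cst1 _ _)).
  exact: (@is_derive_comp _ psi _ _ _ _ (profile_derive2 pf _) dq).
- exact: selfsim_ut_partial.
- move=> p [p2 /andP[pa pb]].
  have pD : Qlat (selfsim_xi P) (selfsim_xi Q) p by split => //; rewrite !ltW.
  have [_ pI] := selfsim_Qlat pD; have [_] := profile_eqn pf pI.
  rewrite (profile_psiE pf pI) /selfsim_ut; set s := p.1 / _ => E.
  rewrite mul1r mulr0 addr0 mulrA E (profile_psiE pf pI) -/s.
  by field; rewrite gt_eqF// sqrtr_gt0.
- move=> x t t0 ->; have s0 : 0 < Num.sqrt t by rewrite sqrtr_gt0.
  have sE : - selfsim_xi P t / Num.sqrt t = - P by rewrite /selfsim_xi -mulNr mulfK// gt_eqF.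
  rewrite k1E ?(ltW t0)//; last first.
    apply/ltW/u0; split => //=; rewrite lexx/= /selfsim_xi.
    by have := mulr_gt0 P0 s0; have := mulr_gt0 Q0 s0; lra.
  rewrite opprK /selfsim_u /selfsim /= sE phiP -(profile_psiE pf) ?(profile_left pf)//.
    by split => //; rewrite /selfsim_xi opprK; ring.
  by rewrite lexx/=; lra.
- move=> x t t0 ->; have s0 : 0 < Num.sqrt t by rewrite sqrtr_gt0.
  have sE : selfsim_xi Q t / Num.sqrt t = Q by rewrite /selfsim_xi mulfK// gt_eqF.
  rewrite k2E ?(ltW t0)//; last first.
    apply/ltW/u0; split => //=; rewrite lexx andbT /selfsim_xi.
    by have := mulr_gt0 P0 s0; have := mulr_gt0 Q0 s0; lra.
  rewrite /selfsim_u /selfsim /= sE phiQ -(profile_psiE pf) ?(profile_right pf)//.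
    by split => //; rewrite /selfsim_xi; ring.
  by rewrite lexx andbT; lra.
Qed.

Lemma selfsim_self_similar (k1 k2 : R * R -> R) (b : R) : 0 < b ->
  (forall t v : R, 0 <= t -> 0 <= v -> k1 (t, v) = - l) ->
  (forall t v : R, 0 <= t -> 0 <= v -> k2 (t, v) = r) ->
  self_similar_solution beta a k1 k2 b selfsim_u (selfsim_xi P) (selfsim_xi Q).
Proof.
move=> b0 k1E k2E; split; first exact: selfsim_solution.
  by move=> x t t0 _; rewrite /selfsim_u /= selfsim_scale.
move=> t t0; rewrite /selfsim_xi sqrtrM ?sqr_ge0// sqrtr_sqr gtr0_norm//.
by rewrite ![_ * (b * _)]mulrCA.
Qed.

(** A self-similar solution is identified with the explicit one only on [Qlat]. At an interior point
    the agreement holds on a short segment in the time direction, which is enough to transfer the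
    derivative. *)
Lemma partial2_congr (A : set (R * R)) (u v vt : R * R -> R) :
  (forall p, A p -> v p = u p) -> is_partial2 A v vt -> is_partial2 A u vt.
Proof.
move=> vu [cvt dvt]; split=> // p Ap.
apply: near_eq_is_derive (dvt p Ap).
have cp : {for p.2, continuous (fun s : R => (p.1, s))}.
  exact: (cvg_pair (cvg_cst p.1) cvg_id).
have : \forall s \near p.2, A (p.1, s) by apply: cp; rewrite -surjective_pairing; exact: Ap.
by apply: filterS => s /vu.
Qed.

End Existence.

(** * Stability *)

Section Hausdorff.
Context {R : realType}.

Lemma hausdorff_dist_le (A B : set (R * R)) (D : R) :
  (forall p, A p -> exists2 q, B q & eucl_dist p q <= D) ->
  (forall q, B q -> exists2 p, A p & eucl_dist q p <= D) ->
  (hausdorff_dist A B <= D%:E)%E.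
Proof.
move=> AB BA; have side (X Y : set (R * R)) :
    (forall p, X p -> exists2 q, Y q & eucl_dist p q <= D) ->
    (ereal_sup [set dist_to Y p | p in X] <= D%:E)%E.
  move=> XY; apply: ge_ereal_sup => _ [p /XY[q Yq pq] <-].
  apply: ereal_inf_le; exists (eucl_dist p q)%:E; first by exists q.
  by rewrite lee_fin.
by rewrite ge_max !side.
Qed.

Lemma eucl_dist_le (p q : R * R) (d e : R) : `|p.1 - q.1| <= d ->
  `|p.2 - q.2| <= e -> eucl_dist p q <= d + e.
Proof.
move=> h1 h2; have d0 := le_trans (normr_ge0 _) h1; have e0 := le_trans (normr_ge0 _) h2.
rewrite /eucl_dist -[d + e]ger0_norm ?addr_ge0// -sqrtr_sqr ler_wsqrtr//.
have s1 : (p.1 - q.1) ^+ 2 <= d ^+ 2 by rewrite -real_normK ?num_real// ler_sqr.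
have s2 : (p.2 - q.2) ^+ 2 <= e ^+ 2 by rewrite -real_normK ?num_real// ler_sqr.
apply: le_trans (lerD s1 s2) _; rewrite !expr2.
by have := mulr_ge0 d0 e0; lra.
Qed.

Lemma clip_distance (a1 a2 b1 b2 e x : R) : - b1 <= b2 -> - a1 <= x <= a2 ->
  `|a1 - b1| <= e -> `|a2 - b2| <= e -> `|x - clip (- b1) b2 x| <= e.
Proof.
move=> b12 /andP[xa1 xa2]; rewrite !ler_norml => /andP[h1 h2] /andP[h3 h4].
by rewrite /clip; case: (ltP x (- b1)) => h5; [|case: (ltP b2 x) => h6];
  apply/andP; split; lra.
Qed.

(** The graphs live over different intervals. A point over [x] is matched with the point over the
    projection of [x] to the other interval: this costs [e] horizontally and [T * e + D] vertically,
    the comparison passing through [S], which is Lipschitz on the whole line. *)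
Lemma graphs_hausdorff (T e D w1 w2 v1 v2 t : R) (S U V : R * R -> R)
    (xi1 xi2 eta1 eta2 : R -> R) : 0 <= T ->
  xi1 t = w1 -> xi2 t = w2 -> eta1 t = v1 -> eta2 t = v2 ->
  - w1 <= w2 -> - v1 <= v2 -> `|v1 - w1| <= e -> `|v2 - w2| <= e ->
  (forall x y, `|S (x, t) - S (y, t)| <= T * `|x - y|) ->
  (forall x, - w1 <= x <= w2 -> U (x, t) = S (x, t)) ->
  (forall x, - v1 <= x <= v2 -> `|V (x, t) - S (x, t)| <= D) ->
  (hausdorff_dist (graph_at U xi1 xi2 t) (graph_at V eta1 eta2 t)
    <= (e + (T * e + D))%:E)%E.
Proof.
move=> T0 <- <- <- <- w12 v12 e1 e2 SL US VS; apply: hausdorff_dist_le.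
  move=> p [x /=]; rewrite in_itv/= => xI <- {p}.
  pose x' := clip (- eta1 t) (eta2 t) x.
  have x'I : - eta1 t <= x' <= eta2 t by exact: clip_itv.
  have xx' : `|x - x'| <= e by apply: clip_distance xI _ _ => //; rewrite distrC.
  exists (x', V (x', t)); first by exists x' => //; rewrite /= in_itv.
  apply: eucl_dist_le => //=; rewrite US//.
  have -> : S (x, t) - V (x', t) = (S (x, t) - S (x', t)) - (V (x', t) - S (x', t)) by ring.
  apply: le_trans (ler_normB _ _) _; apply: lerD; last exact: VS.
  by apply: le_trans (SL _ _) _; rewrite ler_wpM2l.
move=> p [x /=]; rewrite in_itv/= => xI <- {p}.
pose x' := clip (- xi1 t) (xi2 t) x.
have x'I : - xi1 t <= x' <= xi2 t by exact: clip_itv.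
have xx' : `|x - x'| <= e by exact: clip_distance xI _ _.
exists (x', U (x', t)); first by exists x' => //; rewrite /= in_itv.
apply: eucl_dist_le => //=; rewrite US//.
have -> : V (x, t) - S (x', t) = (S (x, t) - S (x', t)) + (V (x, t) - S (x, t)) by ring.
apply: le_trans (ler_normD _ _) _; apply: lerD; last exact: VS.
by apply: le_trans (SL _ _) _; rewrite ler_wpM2l.
Qed.

End Hausdorff.

(** * Solutions with initial data stay above the cone *)

Section InitialData.
Context {R : realType}.

(** Regularity down to time 0 is given on the closure, while comparison asks for it on the slab. A
    point of the slab is the limit of [pt la] as [la] decreases to 0, a path that moves its time
    towards [t1] and its relative position [c] towards the middle. *)
Lemma slab_closure_Qupto (xi1 xi2 : R -> R) (t1 : R) : 0 < t1 ->
  {within `[0, t1], continuous xi1} -> {within `[0, t1], continuous xi2} ->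
  (forall t, 0 <= t <= t1 -> 0 < xi1 t /\ 0 < xi2 t) ->
  slab xi1 xi2 0 t1 `<=` closure (Qupto xi1 xi2 t1).
Proof.
move=> t10 cxi1 cxi2 xi0 [x t] [/= tI xI] B Bxt.
pose tm (la : R) : R := clip 0 t1 (t + la * (t1 - t)).
have ctm : continuous tm.
  move=> la; apply: (@continuous_comp _ _ _ (fun la : R => t + la * (t1 - t)) (clip 0 t1)).
    exact: (is_derive_continuous (is_derive_add (is_derive_cst1 t la)
      (is_derive_mul (is_derive_id1 la) (is_derive_cst1 (t1 - t) la)))).
  exact: (clip_continuous (ltW t10)).
have tmI la : `[0, t1]%classic (tm la).
  by rewrite /= in_itv/=; exact: clip_itv (ltW t10) _.
have c1 : continuous (fun la => xi1 (tm la)) by exact: continuous_comp_within cxi1 ctm tmI.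
have c2 : continuous (fun la => xi2 (tm la)) by exact: continuous_comp_within cxi2 ctm tmI.
have [x1 x2] := xi0 t tI.
pose c := (x + xi1 t) / (xi1 t + xi2 t).
have w0 : 0 < xi1 t + xi2 t by rewrite addr_gt0.
have cw : c * (xi1 t + xi2 t) = x + xi1 t by rewrite divfK// gt_eqF.
have /andP[c0 c1'] : 0 <= c <= 1.
  case/andP: xI => xa xb; apply/andP; split.
    by apply: divr_ge0; [lra|exact: ltW].
  by rewrite ler_pdivrMr// mul1r; lra.
pose cl (la : R) : R := c + la * (2^-1 - c).
have ccl : continuous cl.
  move=> la; exact: (is_derive_continuous (is_derive_add (is_derive_cst1 c la)
    (is_derive_mul (is_derive_id1 la) (is_derive_cst1 (2^-1 - c) la)))).
pose pt (la : R) : R * R := (- xi1 (tm la) + cl la * (xi1 (tm la) + xi2 (tm la)), tm la).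
have cpt : {for 0, continuous pt}.
  apply: (cvg_pair (cvgD (cvgN (c1 0)) (cvgM (ccl 0) (cvgD (c1 0) (c2 0)))) (ctm 0)).
have tm0 : tm 0 = t by rewrite /tm mul0r addr0 clip_id.
have pt0 : pt 0 = (x, t).
  by rewrite /pt tm0 /cl mul0r addr0 cw; congr (_, _); ring.
have : \forall la \near (0 : R), B (pt la) by apply: cpt; rewrite pt0.
move=> /near_exists_lt[d d0 H].
pose la := Num.min d 2^-1.
have la0 : 0 < la by rewrite lt_min d0 invr_gt0/=.
have lad : la <= d by rewrite ge_min lexx.
have la2 : la <= 2^-1 by rewrite ge_min lexx orbT.
exists (pt la); split; last by apply: H; rewrite subr0 gtr0_norm.
have /andP[t0 tt1] := tI.
have tmE : tm la = t + la * (t1 - t).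
  apply: clip_id; apply/andP; split; first by rewrite addr_ge0// mulr_ge0 ?(ltW la0)// subr_ge0.
  by have : 0 <= t1 - t by [rewrite subr_ge0]; nra.
have tm_gt0 : 0 < tm la.
  rewrite tmE; have [t_gt0|t_le0] := ltP 0 t.
    by rewrite ltr_pwDl// mulr_ge0 ?(ltW la0)// subr_ge0.
  have -> : t = 0 by apply/eqP; rewrite eq_le t_le0 t0.
  by rewrite add0r subr0 mulr_gt0.
have /andP[_ tm_le] : 0 <= tm la <= t1 by have := tmI la; rewrite /= in_itv.
have [y1 y2] : 0 < xi1 (tm la) /\ 0 < xi2 (tm la) by apply: xi0; rewrite (ltW tm_gt0).
have cl0 : 0 < cl la by rewrite /cl; nra.
have cl1 : cl la < 1 by rewrite /cl; nra.
split; first by rewrite /= tm_gt0.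
have y12 : 0 < xi1 (tm la) + xi2 (tm la) by rewrite addr_gt0.
have p1 : 0 < cl la * (xi1 (tm la) + xi2 (tm la)) by rewrite mulr_gt0.
have p2 : 0 < (1 - cl la) * (xi1 (tm la) + xi2 (tm la)) by rewrite mulr_gt0// subr_gt0.
by rewrite /=; apply/andP; split; lra.
Qed.

(** The data lie on the cone at both ends and have slopes of modulus at most [tan beta]; integrating
    from the end on the same side of 0 as [x] keeps them above it. *)
Lemma admissible_cone (beta sigma mu : R) (k1 k2 : R * R -> R) (u0 : R -> R)
    (xi01 xi02 m x : R) : 0 < sigma ->
  admissible beta sigma mu k1 k2 u0 xi01 xi02 ->
  `|m| <= tan beta -> - xi01 <= x <= xi02 -> m * x <= u0 x.
Proof.
move=> s0 [[x1 x2 _ ul ur] [u0x [u0xx [[cu0 _ du0 _ _] [_ _ slope]]]]] mT /andP[xa xb].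
have x12 : - xi01 < xi02 by lra.
have sT c : - xi01 < c < xi02 -> - tan beta <= u0x c <= tan beta.
  move=> /andP[ca cb].
  have /slope : `[- xi01, xi02]%classic c by rewrite /= in_itv/= (ltW ca) (ltW cb).
  by rewrite ler_norml => /andP[h1 h2]; apply/andP; split; lra.
have T0 : 0 <= tan beta by exact: le_trans mT.
have mx : m * x <= tan beta * `|x|.
  by apply: le_trans (ler_norm _) _; rewrite normrM ler_wpM2r.
apply: le_trans mx _; have [x0|x0] := leP 0 x.
  rewrite ger0_norm//; move: xb; rewrite le_eqVlt => /predU1P[->|xb].
    by rewrite ur mulrC.
  have [|y yI|c] := @MVT R u0 u0x x xi02 xb.
  - by move=> y /[!in_itv]/= /andP[ya yb]; apply: du0; rewrite yb (le_lt_trans xa).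
  - move: y yI; apply: continuous_subspaceW cu0 => y /=.
    by rewrite !in_itv/= => /andP[ya ->]; rewrite (le_trans xa).
  rewrite in_itv/= => /andP[ca cb] E.
  have /andP[_ h] : - tan beta <= u0x c <= tan beta by apply: sT; rewrite cb (le_lt_trans xa).
  have : u0x c * (xi02 - x) <= tan beta * (xi02 - x) by rewrite ler_wpM2r// subr_ge0 ltW.
  by rewrite -E ur; lra.
rewrite ltr0_norm//; move: xa; rewrite le_eqVlt => /predU1P[<-|xa].
  by rewrite ul opprK mulrC.
have [|y yI|c] := @MVT R u0 u0x (- xi01) x xa.
- by move=> y /[!in_itv]/= /andP[ya yb]; apply: du0; rewrite ya (lt_le_trans yb).
- move: y yI; apply: continuous_subspaceW cu0 => y /=.
  by rewrite !in_itv/= => /andP[-> yb]; rewrite (le_trans yb).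
rewrite in_itv/= => /andP[ca cb] E.
have /andP[h _] : - tan beta <= u0x c <= tan beta by apply: sT; rewrite ca (lt_le_trans cb).
have : - tan beta * (x - - xi01) <= u0x c * (x - - xi01) by rewrite ler_wpM2r// subr_ge0 ltW.
by rewrite -E ul; lra.
Qed.

(** The comparison starts at time 0, where the data are already above the cone, so [cone_bound]
    applies with no defect. *)
Lemma global_cone (beta sigma mu : R) (a : R -> R) (k1 k2 : R * R -> R) (l r : R)
    (u0 : R -> R) (xi01 xi02 : R) (u : R * R -> R) (xi1 xi2 : R -> R) :
  (forall p, 0 < a p) ->
  (forall t v : R, 0 <= t -> 0 <= v -> k1 (t, v) = - l) ->
  (forall t v : R, 0 <= t -> 0 <= v -> k2 (t, v) = r) ->
  0 < tan beta -> 0 < sigma ->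
  admissible beta sigma mu k1 k2 u0 xi01 xi02 ->
  global_solution_with_data beta mu a k1 k2 u0 xi01 xi02 u xi1 xi2 ->
  forall t x, 0 < t -> - xi1 t <= x <= xi2 t -> tan beta * `|x| <= u (x, t).
Proof.
move=> a0 k1E k2E T0 s0 adm [sol cxi1 cxi2 i1 i2 iu hol] t x t0 xI.
have W (xi : R -> R) : {within `[0, +oo[, continuous xi} -> {within `[0, t], continuous xi}.
  by apply: continuous_subspaceW => s /=; rewrite !in_itv/= => /andP[->].
have xi_gt0 s : 0 <= s <= t -> 0 < xi1 s /\ 0 < xi2 s.
  move=> /andP[]; rewrite le_eqVlt => /predU1P[<- _|s_gt0 _].
    by rewrite i1 i2; case: adm => -[].
  exact: (solution_xi_gt0 sol).
have cu : {within slab xi1 xi2 0 t, continuous u}.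
  have [cu _] := hol t t0; apply: continuous_subspaceW cu.
  exact: slab_closure_Qupto t0 (W _ cxi1) (W _ cxi2) xi_gt0.
have side m : `|m| <= tan beta -> m * x <= u (x, t).
  move=> mT; rewrite -[m * x]subr0.
  apply: (cone_bound a0 k1E k2E sol (lexx 0) (ltW t0) (W _ cxi1) (W _ cxi2) xi_gt0
    cu T0 mT (lexx 0) _ (p := (x, t))).
    move=> y; rewrite i1 i2 subr0 => yI; rewrite iu//.
    exact: (admissible_cone s0 adm).
  by split => //=; rewrite lexx (ltW t0).
have [x0|x0] := leP 0 x.
  by rewrite ger0_norm//; apply: side; rewrite gtr0_norm.
by rewrite ltr0_norm// mulrN -mulNr; apply: side; rewrite normrN gtr0_norm.
Qed.

End InitialData.

Theorem theorem1p2 (R : realType) (beta b sigma : R) (a : R -> R)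
    (k1 k2 : R * R -> R) (m1 m2 : R)
    (hbeta : 0 < beta < pi / 2)
    (ha : C2_real a) (ha_gt0 : forall p, 0 < a p)
    (hk1 : C2_on quadrant k1) (hk2 : C2_on quadrant k2)
    (hb : 1 < b)
    (hk1_scale : forall t v : R, 0 <= t -> 0 <= v ->
      k1 (t, v) = k1 (b ^+ 2 * t, b * v))
    (hk2_scale : forall t v : R, 0 <= t -> 0 <= v ->
      k2 (t, v) = k2 (b ^+ 2 * t, b * v))
    (hsigma : 0 < sigma < tan beta)
    (hk1_bound : forall t v : R, 0 <= t -> 0 <= v ->
      `|k1 (t, v)| <= tan beta - sigma)
    (hk2_bound : forall t v : R, 0 <= t -> 0 <= v ->
      `|k2 (t, v)| <= tan beta - sigma)
    (hm1 : is_minimum (k1 @` quadrant) m1)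
    (hm2 : is_minimum (k2 @` quadrant) m2)
    (hmin : 0 < m1 + m2) :
  (exists (U : R * R -> R) (Xi1 Xi2 : R -> R),
     self_similar_solution beta a k1 k2 b U Xi1 Xi2) /\
  ((forall t s v : R, 0 <= t -> 0 <= s -> 0 <= v ->
      k1 (t, v) = k1 (s, v) /\ k2 (t, v) = k2 (s, v)) ->
   forall (U : R * R -> R) (Xi1 Xi2 : R -> R),
   self_similar_solution beta a k1 k2 b U Xi1 Xi2 ->
   (* (i) *)
   [/\ forall (V : R * R -> R) (Eta1 Eta2 : R -> R),
         self_similar_solution beta a k1 k2 b V Eta1 Eta2 ->
         (forall t : R, 0 < t -> Eta1 t = Xi1 t /\ Eta2 t = Xi2 t) /\
         (forall p, Qlat Xi1 Xi2 p -> V p = U p),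
       exists Ut : R * R -> R, is_partial2 (Qlat Xi1 Xi2) U Ut /\
         forall p, Qlat Xi1 Xi2 p -> 0 < Ut p &
       forall t : R, 0 < t -> 0 < Xi1^`() t /\ 0 < Xi2^`() t] /\
   (* (ii) *)
   (forall (mu : R) (u0 : R -> R) (xi01 xi02 : R)
           (u : R * R -> R) (xi1 xi2 : R -> R),
      0 < mu < 1 ->
      admissible beta sigma mu k1 k2 u0 xi01 xi02 ->
      global_solution_with_data beta mu a k1 k2 u0 xi01 xi02 u xi1 xi2 ->
      exists C : R, \forall t \near +oo,
        (hausdorff_dist (graph_at U Xi1 Xi2 t) (graph_at u xi1 xi2 t)
         <= (C / Num.sqrt t)%:E)%E)).
Proof.
have b0 : 0 < b by exact: lt_trans ltr01 hb.
have k1_cst := scaling_invariant_constant hb hk1.1 hk1_scale.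
have k2_cst := scaling_invariant_constant hb hk2.1 hk2_scale.
pose l := - k1 (0, 0); pose r := k2 (0, 0).
have k1E (t v : R) : 0 <= t -> 0 <= v -> k1 (t, v) = - l by rewrite opprK; exact: k1_cst.
have k2E (t v : R) : 0 <= t -> 0 <= v -> k2 (t, v) = r by exact: k2_cst.
have /andP[s0 sT] := hsigma.
have lr : l < r.
  have [[[t v] [t0 v0] m1E] _] := hm1; have [[[t' v'] [t'0 v'0] m2E] _] := hm2.
  by move: hmin; rewrite -m1E -m2E k1E// k2E//; lra.
have Tl : - tan beta < l.
  have := hk1_bound 0 0 (lexx 0) (lexx 0); rewrite k1E// normrN ler_norml => /andP[]; lra.
have rT : r < tan beta.
  have := hk2_bound 0 0 (lexx 0) (lexx 0); rewrite k2E// ler_norml => /andP[]; lra.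
have ca : continuous a.
  by move=> x; have [da _ _] := ha; apply: differentiable_continuous; apply/derivable1_diffP.
have [P [Q [phi [phi' [psi [psi' pf]]]]]] := profile_exists ca ha_gt0 Tl lr rT.
have [P0 Q0] := profile_PQ pf; have T0 := profile_T_gt0 pf.
split.
  exists (selfsim_u phi), (selfsim_xi P), (selfsim_xi Q).
  exact: (selfsim_self_similar pf b0 k1E k2E).
move=> _ U Xi1 Xi2 ssU.
have uniq V Eta1 Eta2 (ssV : self_similar_solution beta a k1 k2 b V Eta1 Eta2) :=
  selfsimilar_unique ha_gt0 k1E k2E hb ssV ha pf.
have US p : Qlat Xi1 Xi2 p -> U p = selfsim_u phi p.
  case: p => x t [/= t0 xI]; have [_ _ h] := uniq _ _ _ ssU t t0; exact: h.
split; first split.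
- move=> V Eta1 Eta2 ssV; split=> [t t0|p pD].
    have [-> -> _] := uniq _ _ _ ssU t t0; have [-> -> _] := uniq _ _ _ ssV t t0.
    by [].
  rewrite (US p pD); case: p pD => x t [/= t0]; have [-> -> _] := uniq _ _ _ ssU t t0.
  by have [<- <- h] := uniq _ _ _ ssV t t0 => xI; exact: h.
- have QE : Qlat Xi1 Xi2 = Qlat (selfsim_xi P) (selfsim_xi Q).
    apply/seteqP; split=> p [p2 pI]; have [h1 h2 _] := uniq _ _ _ ssU p.2 p2; split=> //.
      by rewrite /selfsim_xi -h1 -h2.
    by rewrite h1 h2.
  exists (selfsim_ut phi phi'); split; last first.
    by move=> p [p2 _]; exact: (selfsim_ut_gt0 pf).
  apply: (@partial2_congr _ _ _ (selfsim_u phi)) => [p pD|]; first by rewrite US.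
  by rewrite QE; exact: (selfsim_ut_partial pf).
- have dXi (c : R) (Xi : R -> R) : 0 < c -> (forall t, 0 < t -> Xi t = c * Num.sqrt t) ->
      forall t, 0 < t -> 0 < Xi^`() t.
    move=> c0 XiE t t0.
    have : is_derive t 1 Xi (c * (2 * Num.sqrt t)^-1).
      apply: near_eq_is_derive (selfsim_xi_derive c t0).
      by apply: filterS (lt_nbhsr t0) => s s_gt0; rewrite XiE.
    by rewrite derive1E => -[_ ->]; rewrite mulr_gt0// invr_gt0 mulr_gt0// sqrtr_gt0.
  move=> t t0; split.
    by apply: (dXi P) => // s /(uniq _ _ _ ssU)[].
  by apply: (dXi Q) => // s /(uniq _ _ _ ssU)[].
move=> mu u0 xi01 xi02 u xi1 xi2 _ adm glob.
have sol := global_solution glob.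
have cone := global_cone ha_gt0 k1E k2E T0 s0 adm glob.
have [C [C0 CE]] := profile_attracts ha_gt0 k1E k2E sol ha pf ltr01
  (fun t x t1 xI => cone t x (lt_le_trans ltr01 t1) xI).
(* The divisors are the transversality constants at the two ends; the sum bounds both boundary
   errors at once. *)
pose C' := C / (tan beta - r) + C / (tan beta + l).
(* Horizontal matching error, then its vertical effect through the Lipschitz constant [tan beta],
   then the error in height. *)
exists (C' + (tan beta * C' + C)); near=> t.
have t1 : 1 <= t by near: t; exact: nbhs_pinfty_ge.
have t0 : 0 < t by exact: lt_le_trans ltr01 t1.
have st : 0 < Num.sqrt t by rewrite sqrtr_gt0.
have i0 : 0 <= (Num.sqrt t)^-1 by rewrite invr_ge0 ltW.
have [E1 E2 SE] := uniq _ _ _ ssU t t0.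
have uS x : - xi1 t <= x <= xi2 t -> `|u (x, t) - selfsim_u phi (x, t)| <= C / Num.sqrt t.
  exact: CE.
have [d2 d1] := boundary_attracts k1E k2E sol pf t0 uS.
have r0 : 0 < tan beta - r by rewrite subr_gt0.
have l0 : 0 < tan beta + l by lra.
have n1 : 0 <= C / (tan beta - r) / Num.sqrt t by rewrite mulr_ge0// divr_ge0// ltW.
have n2 : 0 <= C / (tan beta + l) / Num.sqrt t by rewrite mulr_ge0// divr_ge0// ltW.
have C'E : C' / Num.sqrt t =
    C / (tan beta - r) / Num.sqrt t + C / (tan beta + l) / Num.sqrt t by rewrite mulrDl.
have e2 : `|xi2 t - Q * Num.sqrt t| <= C' / Num.sqrt t.
  have : `|xi2 t - Q * Num.sqrt t| <= C / (tan beta - r) / Num.sqrt t.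
    by rewrite mulrAC ler_pdivlMr// mulrC.
  by lra.
have e1 : `|xi1 t - P * Num.sqrt t| <= C' / Num.sqrt t.
  have : `|xi1 t - P * Num.sqrt t| <= C / (tan beta + l) / Num.sqrt t.
    by rewrite mulrAC ler_pdivlMr// mulrC.
  by lra.
have -> : (C' + (tan beta * C' + C)) / Num.sqrt t =
  C' / Num.sqrt t + (tan beta * (C' / Num.sqrt t) + C / Num.sqrt t) by ring.
have [x1 x2] := solution_xi_gt0 sol t0.
have PQ : - (P * Num.sqrt t) <= Q * Num.sqrt t.
  by have := mulr_gt0 P0 st; have := mulr_gt0 Q0 st; lra.
apply: (graphs_hausdorff (ltW T0) E1 E2 erefl erefl PQ _ e1 e2 _ _ uS).
- by lra.
- move=> x y; rewrite /selfsim_u /selfsim /= -mulrBr normrM (gtr0_norm st).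
  apply: le_trans (ler_wpM2l (ltW st) (profile_lipschitz pf _ _)) _.
  by rewrite -mulrBl normrM normfV (gtr0_norm st) mulrCA [_ / _]mulrC mulVKf// gt_eqF.
- by move=> x xI; rewrite /selfsim_u; apply: SE; rewrite E1 E2.
Unshelve. all: by end_near. Qed.
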